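(* Let $b>0$, $w<0$ and $$g(t)=\frac{\sin \pi b(t-iw)}{t-iw}.$$ Then the frame set of $g$ is $$\mathcal{F}_g=\{(\alpha,\beta)\,:\,\alpha,\beta>0,\ \alpha\beta\leq 1,\ \beta\leq b\}.$$
   Context: For $g\in L^2(\mathbb{R})$ and $(x,\omega)\in\mathbb{R}^2$ put $\pi_{x,\omega}g(t)=e^{2\pi i\omega t}g(t-x)$. For $\alpha,\beta>0$ the Gabor system is $\mathcal{G}(g;\alpha,\beta)=\{\pi_{\alpha n,\beta m}g\}_{m,n\in\mathbb{Z}}$. It is a (Gabor) frame if there are constants $A,B>0$ with $A\|f\|_2^2\leq\sum_{m,n\in\mathbb{Z}}|(f,\pi_{\alpha n,\beta m}g)|^2\leq B\|f\|_2^2$ for all $f\in L^2(\mathbb{R})$. The frame set of $g$ is $\mathcal{F}_g=\{(\alpha,\beta):\alpha,\beta>0,\ \mathcal{G}(g;\alpha,\beta)\text{ is a frame}\}$. *)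

(* Defs.v *)
(* R : realType, complex numbers R[i] from
   mathcomp-real-closed (complex.v), Lebesgue measure/integral on R. *)
From mathcomp Require Import all_boot all_order all_algebra.
From mathcomp Require Import all_classical all_reals all_analysis.
From mathcomp Require Import complex.
Import GRing.Theory Num.Theory.

Set Implicit Arguments.
Unset Strict Implicit.
Unset Printing Implicit Defensive.

Local Open Scope ring_scope.
Local Open Scope classical_set_scope.
Local Open Scope complex_scope.

Section Gabor.
Context {R : realType}.
Local Notation C := R[i].
Local Notation mu := (@lebesgue_measure R).

(* complex exponential e^(x+iy) = e^x (cos y + i sin y) *)
Definition cexp (z : C) : C :=
  (expR (complex.Re z) * cos (complex.Im z)) +i* (expR (complex.Re z) * sin (complex.Im z)).

(* complex sine: sin z = (e^{iz} - e^{-iz}) / (2i) *)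
Definition csin (z : C) : C := (cexp ('i * z) - cexp (- ('i * z))) / (2 * 'i).

(* squared modulus |z|^2 *)
Definition cabs2 (z : C) : R := complex.Re z ^+ 2 + complex.Im z ^+ 2.

(* Lebesgue measurability of a complex-valued function on R *)
Definition cmeasurable (f : R -> C) : Prop :=
  measurable_fun [set: R] (fun t => complex.Re (f t)) /\
  measurable_fun [set: R] (fun t => complex.Im (f t)).

(* ||f||_2^2 as an extended real *)
Definition L2norm2 (f : R -> C) : \bar R := (\int[mu]_t (cabs2 (f t))%:E)%E.

(* f in L^2(R) *)
Definition L2 (f : R -> C) : Prop := cmeasurable f /\ (L2norm2 f < +oo)%E.

(* Lebesgue integral of a complex-valued (integrable) function on R *)
Definition cintegral (h : R -> C) : C :=
  (Rintegral mu [set: R] (fun t => complex.Re (h t))) +i*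
  (Rintegral mu [set: R] (fun t => complex.Im (h t))).

(* L^2 inner product (f, h) = \int f conj(h) *)
Definition inner (f h : R -> C) : C := cintegral (fun t => f t * (h t)^*).

(* time-frequency shift pi_{x,omega} g (t) = e^{2 pi i omega t} g(t - x) *)
Definition tfshift (x omega : R) (g : R -> C) : R -> C :=
  fun t => cexp ('i * (2 * pi * omega * t)%:C) * g (t - x).

(* G(g; alpha, beta) = {pi_{alpha n, beta m} g}_{m,n in Z} is a frame *)
Definition gabor_frame (g : R -> C) (alpha beta : R) : Prop :=
  exists A B : R, 0 < A /\ 0 < B /\
    forall f : R -> C, L2 f ->
      (A%:E * L2norm2 f <=
         \esum_(mn in [set: int * int])
            (cabs2 (inner f (tfshift (alpha * mn.2%:~R) (beta * mn.1%:~R) g)))%:E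
       <= B%:E * L2norm2 f)%E.

(* frame set F_g *)
Definition frame_set (g : R -> C) : set (R * R) :=
  [set ab | 0 < ab.1 /\ 0 < ab.2 /\ gabor_frame g ab.1 ab.2].

(* g(t) = sin(pi b (t - i w)) / (t - i w) *)
Definition gsinc (b w : R) : R -> C :=
  fun t => csin ((pi * b)%:C * (t%:C - 'i * w%:C)) / (t%:C - 'i * w%:C).

End Gabor.

(* Main.v *)
(* Write r = e^{2 pi w / alpha}, which lies in (0, 1) since w < 0, and p = 1 / alpha.
   The conjugate of g is, up to a constant and a modulation, the Fourier
   transform of e^{2 pi w x} on [0, b).  Parseval on [0, 1 / beta) and then on
   [0, p) turns the sum of |(f, pi g)|^2 into an integral over t in [0, 1 / beta)
   of the squared norms on [0, p) of
     H(x) = sum_k e^{2 pi w (x + k p)} 1_[0, b)(x + k p) C(x + k p),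
   where C is the Fourier series with coefficients f(t + j / beta), so |C| has
   period beta.  If S solves C(x) = S(x) - r S(x + p), then H telescopes to
   e^{2 pi w x} (S(x) - r^N S(x + N p)), with N >= 1 exactly when x < b, and the
   norms of C and S over a period are comparable.

   If beta <= min(p, b), the relation S(x) = r^N S(x + N p) + O(H(x)) holds with
   N >= 1 on a whole period; iterating it bounds S by H.  If beta > q = min(p, b),
   prescribing S = 1 on [q, beta) and iterating S(x) = r^N S(x + N p) on [0, q)
   gives a nonzero periodic S for which H vanishes up to an arbitrarily small
   error; approximating S by trigonometric polynomials yields test functions
   that contradict the lower frame bound. *)

From HB Require Import structures.
Require Import Defs.
From mathcomp Require Import all_boot all_order all_algebra.
From mathcomp Require Import all_classical all_reals all_analysis.
From mathcomp Require Import measurable_realfun complex ring lra zify.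
From mathcomp Require finmap.
Import Order.TTheory GRing.Theory Num.Theory.
Import numFieldNormedType.Exports.
Set Implicit Arguments.
Unset Strict Implicit.
Unset Printing Implicit Defensive.
Local Open Scope ring_scope.
Local Open Scope classical_set_scope.
Local Open Scope complex_scope.

(** * Complex numbers and complex-valued integrals *)

(** All Fourier analysis takes place on bounded intervals and for bounded measurable functions: a
    bounded f of bounded support has finitely many samples f(t + j / beta), so C and S are finite
    exponential sums and the identities between them hold pointwise. The resulting bounds are
    uniform in the number of samples; truncation carries them to L^2 at the cost of a factor 2 in
    each frame constant.

    The sign w < 0 gives r < 1. This makes S explicit, with denominators of modulus at least 1 - r,
    and makes both iterations contract.

    The threshold min(p, b) has a single cause. The norm of H is taken over x in [0, p), and H(x) =
    0 for x >= b, so H only produces relations that start at x in [0, min(p, b)). When beta is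
    larger, no relation starts on the rest [min(p, b), beta) of a period, which is why S can be
    prescribed there.

    With fixed coefficients, the sum S attached to the fiber t differs from that at t = 0 by a phase
    e^{-2 pi i t x}. One S therefore serves only fibers near t = 0, and the test functions are
    supported on fibers t in [0, tau) with tau small. *)

Section ComplexBasics.
Context {R : realType}.
Implicit Types (z u v : R[i]) (x y : R).

Lemma ReD u v : complex.Re (u + v) = complex.Re u + complex.Re v.
Proof. by case: u; case: v. Qed.
Lemma ImD u v : complex.Im (u + v) = complex.Im u + complex.Im v.
Proof. by case: u; case: v. Qed.
Lemma ReN u : complex.Re (- u) = - complex.Re u.
Proof. by case: u. Qed.
Lemma ImN u : complex.Im (- u) = - complex.Im u.
Proof. by case: u. Qed.
Lemma ReM u v : complex.Re (u * v) =
  complex.Re u * complex.Re v - complex.Im u * complex.Im v.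
Proof. by case: u; case: v. Qed.
Lemma ImM u v : complex.Im (u * v) =
  complex.Re u * complex.Im v + complex.Im u * complex.Re v.
Proof. by case: u => a b; case: v. Qed.
Lemma ReJ u : complex.Re (conjc u) = complex.Re u.
Proof. by case: u. Qed.
Lemma ImJ u : complex.Im (conjc u) = - complex.Im u.
Proof. by case: u. Qed.
Lemma complexP u v :
  complex.Re u = complex.Re v -> complex.Im u = complex.Im v -> u = v.
Proof. by case: u => a b; case: v => c d /= -> ->. Qed.

Lemma conjE z : Num.conj z = conjc z.
Proof. by []. Qed.
Lemma conjcM u v : conjc (u * v) = conjc u * conjc v.
Proof. exact: rmorphM. Qed.
Lemma conjcD u v : (conjc (u + v)) = conjc u + conjc v.
Proof. exact: raddfD. Qed.
Lemma conjcN u : (conjc (- u)) = - conjc u.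
Proof. exact: raddfN. Qed.

Lemma conjc_sum I (s : seq I) (F : I -> R[i]) :
  conjc (\sum_(i <- s) F i) = \sum_(i <- s) conjc (F i).
Proof. exact: rmorph_sum. Qed.
Lemma RtoCD x y : (x + y)%:C = x%:C + y%:C :> R[i].
Proof. exact: rmorphD. Qed.
Lemma RtoCB x y : (x - y)%:C = x%:C - y%:C :> R[i].
Proof. exact: rmorphB. Qed.
Lemma RtoCM x y : (x * y)%:C = x%:C * y%:C :> R[i].
Proof. exact: rmorphM. Qed.
Lemma RtoCV x : (x^-1)%:C = x%:C^-1 :> R[i].
Proof. exact: fmorphV. Qed.
Lemma RtoC_sum I (s : seq I) (F : I -> R) :
  (\sum_(i <- s) F i)%:C = \sum_(i <- s) (F i)%:C :> R[i].
Proof. exact: rmorph_sum. Qed.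

Lemma cabs2_ge0 z : 0 <= cabs2 z.
Proof. by rewrite addr_ge0// sqr_ge0. Qed.
Lemma cabs20 : cabs2 (0 : R[i]) = 0.
Proof. by rewrite /cabs2 /= expr0n/= addr0. Qed.
Lemma cabs21 : cabs2 (1 : R[i]) = 1.
Proof. by rewrite /cabs2 /= expr1n expr0n/= addr0. Qed.
Lemma cabs2M u v : cabs2 (u * v) = cabs2 u * cabs2 v.
Proof. by rewrite /cabs2 ReM ImM; ring. Qed.
Lemma cabs2N u : cabs2 (- u) = cabs2 u.
Proof. by rewrite /cabs2 ReN ImN; ring. Qed.
Lemma cabs2J u : cabs2 (conjc u) = cabs2 u.
Proof. by rewrite /cabs2 ReJ ImJ; ring. Qed.
Lemma cabs2C x : cabs2 (x%:C : R[i]) = x ^+ 2.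
Proof. by rewrite /cabs2 /= expr0n/= addr0. Qed.
Lemma cabs2D_le u v : cabs2 (u + v) <= 2 * cabs2 u + 2 * cabs2 v.
Proof.
rewrite /cabs2 ReD ImD.
have := sqr_ge0 (complex.Re u - complex.Re v).
have := sqr_ge0 (complex.Im u - complex.Im v).
by nra.
Qed.
Lemma cabs2B_le u v : cabs2 (u - v) <= 2 * cabs2 u + 2 * cabs2 v.
Proof. by rewrite -(cabs2N v); exact: cabs2D_le. Qed.
Lemma cabs2_eq0 z : (cabs2 z == 0) = (z == 0).
Proof.
apply/eqP/eqP => [|->]; last exact: cabs20.
rewrite /cabs2 => /eqP; rewrite paddr_eq0 ?sqr_ge0// !sqrf_eq0 => /andP[/eqP a /eqP b].
exact: complexP.
Qed.
Lemma cabs2V z : cabs2 (z^-1) = (cabs2 z)^-1.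
Proof.
have [->|z0] := eqVneq z 0; first by rewrite invr0 cabs20 invr0.
apply: (mulfI (x := cabs2 z)); first by rewrite cabs2_eq0.
by rewrite -cabs2M mulfV// cabs21 mulfV// cabs2_eq0.
Qed.
Lemma cabs2E z : (cabs2 z)%:C = z * conjc z.
Proof. by case: z => a b; apply: complexP; rewrite /cabs2 ?ReM ?ImM /=; ring. Qed.

Lemma cexpD u v : cexp (u + v) = cexp u * cexp v.
Proof.
apply: complexP; rewrite ?ReM ?ImM /= ReD ImD expRD ?cosD ?sinD; ring.
Qed.
Lemma cexp0 : cexp (0 : R[i]) = 1.
Proof. by apply: complexP; rewrite /= expR0 ?cos0 ?sin0 ?mulr1 ?mulr0. Qed.
Lemma cexpJ z : (conjc (cexp z)) = cexp (conjc z).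
Proof.
by apply: complexP; rewrite ?ReJ ?ImJ /= ReJ ImJ ?cosN ?sinN ?mulrN.
Qed.
Lemma cexpC x : cexp (x%:C) = (expR x)%:C.
Proof. by apply: complexP; rewrite /= ?cos0 ?sin0 ?mulr1 ?mulr0. Qed.

Definition e2pi x : R[i] := cexp ('i * (2 * pi * x)%:C).

Lemma e2piE x : e2pi x = cos (2 * pi * x) +i* sin (2 * pi * x).
Proof.
rewrite /e2pi /cexp ReM ImM /=.
by apply: complexP => /=; rewrite !(mul0r, mul1r, mulr0, subr0, sub0r, addr0, add0r, oppr0, expR0).
Qed.
Lemma Re_e2pi x : complex.Re (e2pi x) = cos (2 * pi * x).
Proof. by rewrite e2piE. Qed.
Lemma Im_e2pi x : complex.Im (e2pi x) = sin (2 * pi * x).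
Proof. by rewrite e2piE. Qed.
Lemma e2piD x y : e2pi (x + y) = e2pi x * e2pi y.
Proof. by rewrite /e2pi -cexpD -mulrDr -rmorphD/= mulrDr. Qed.
Lemma e2pi0 : e2pi 0 = 1.
Proof. by rewrite e2piE mulr0 cos0 sin0. Qed.
Lemma e2piJ x : (conjc (e2pi x)) = e2pi (- x).
Proof. by rewrite !e2piE mulrN cosN sinN. Qed.
Lemma cabs2_e2pi x : cabs2 (e2pi x) = 1.
Proof. by rewrite e2piE /cabs2 /= cos2Dsin2. Qed.
Lemma e2piNK x : e2pi x * e2pi (- x) = 1.
Proof. by rewrite -e2piD subrr e2pi0. Qed.
Lemma e2pi_nat n : e2pi n%:R = 1.
Proof.
elim: n => [|n ih]; first exact: e2pi0.
by rewrite -natr1 e2piD ih mul1r e2piE mulr1 mulr_natl cos2pi sin2pi.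
Qed.
Lemma e2pi_int (n : int) : e2pi n%:~R = 1.
Proof.
case: n => n; first exact: e2pi_nat.
by rewrite NegzE mulrNz -e2piJ e2pi_nat conjc1.
Qed.
Lemma e2piX x n : e2pi x ^+ n = e2pi (n%:R * x).
Proof.
elim: n => [|n ih]; first by rewrite expr0 mul0r e2pi0.
by rewrite exprS ih -e2piD -natr1 mulrDl mul1r addrC.
Qed.
End ComplexBasics.

Section ComplexIntegral.
Context {R : realType}.
Local Notation C := R[i].
Local Notation mu := (@lebesgue_measure R).
Implicit Types (D : set R) (f g : R -> C).

Definition cint D f : C :=
  (\int[mu]_(t in D) complex.Re (f t))%R +i* (\int[mu]_(t in D) complex.Im (f t))%R.

Definition cintegrable D f :=
  mu.-integrable D (EFin \o (fun t => complex.Re (f t))) /\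
  mu.-integrable D (EFin \o (fun t => complex.Im (f t))).

Lemma cintegralE f : cintegral f = cint setT f.
Proof. by []. Qed.

Lemma eq_cint D f g : (forall t, D t -> f t = g t) -> cint D f = cint D g.
Proof.
by move=> fg; rewrite /cint; congr (_ +i* _); apply: eq_Rintegral => t; rewrite inE => /fg ->.
Qed.

Lemma cintegrableD D f g : measurable D -> cintegrable D f -> cintegrable D g ->
  cintegrable D (fun t => f t + g t).
Proof.
move=> mD [f1 f2] [g1 g2]; split.
- rewrite (_ : _ \o _ = (EFin \o (fun t => complex.Re (f t))) \+ (EFin \o (fun t => complex.Re (g t)))).
    exact: integrableD.
  by apply/funext => t /=; rewrite ReD.
- rewrite (_ : _ \o _ = (EFin \o (fun t => complex.Im (f t))) \+ (EFin \o (fun t => complex.Im (g t)))).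
    exact: integrableD.
  by apply/funext => t /=; rewrite ImD.
Qed.

Lemma cintD D f g : measurable D -> cintegrable D f -> cintegrable D g ->
  cint D (fun t => f t + g t) = cint D f + cint D g.
Proof.
move=> mD [f1 f2] [g1 g2]; apply: complexP; rewrite ?ReD ?ImD /=.
- under eq_Rintegral do rewrite ReD. by rewrite RintegralD.
- under eq_Rintegral do rewrite ImD. by rewrite RintegralD.
Qed.

Lemma integrableZR D (h : R -> R) (r : R) : measurable D ->
  mu.-integrable D (EFin \o h) -> mu.-integrable D (EFin \o (fun t => r * h t)).
Proof.
move=> mD ih; rewrite (_ : _ \o _ = (fun t => r%:E * (EFin \o h) t)%E) //.
exact: integrableZl.
Qed.
Lemma integrableDR D (h k : R -> R) : measurable D ->
  mu.-integrable D (EFin \o h) -> mu.-integrable D (EFin \o k) ->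
  mu.-integrable D (EFin \o (fun t => h t + k t)).
Proof.
by move=> mD ih ik; rewrite (_ : _ \o _ = (EFin \o h) \+ (EFin \o k))%E//; exact: integrableD.
Qed.
Lemma integrableBR D (h k : R -> R) : measurable D ->
  mu.-integrable D (EFin \o h) -> mu.-integrable D (EFin \o k) ->
  mu.-integrable D (EFin \o (fun t => h t - k t)).
Proof.
by move=> mD ih ik; rewrite (_ : _ \o _ = (EFin \o h) \- (EFin \o k))%E//; exact: integrableB.
Qed.

Lemma cintZ D (c : C) f : measurable D -> cintegrable D f ->
  cint D (fun t => c * f t) = c * cint D f.
Proof.
move=> mD [f1 f2]; apply: complexP; rewrite ?ReM ?ImM /=.
- under eq_Rintegral do rewrite ReM.
  by rewrite RintegralB ?RintegralZl//; exact: integrableZR.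
- under eq_Rintegral do rewrite ImM.
  by rewrite RintegralD ?RintegralZl//; exact: integrableZR.
Qed.

Lemma cint0 D : cint D (fun=> 0) = 0.
Proof. by rewrite /cint /= /Rintegral !integral0. Qed.

Lemma cintegrable0 D : cintegrable D (fun=> 0).
Proof. by split; exact: integrable0. Qed.

Lemma cintegrable_sum I (s : seq I) (F : I -> R -> C) D : measurable D ->
  (forall i, cintegrable D (F i)) -> cintegrable D (fun t => \sum_(i <- s) F i t).
Proof.
move=> mD iF; elim: s => [|i s ih].
  by under [X in cintegrable _ X]eq_fun do rewrite big_nil; exact: cintegrable0.
by under [X in cintegrable _ X]eq_fun do rewrite big_cons; exact: cintegrableD.
Qed.

Lemma cint_sum I (s : seq I) (F : I -> R -> C) D : measurable D ->
  (forall i, cintegrable D (F i)) ->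
  cint D (fun t => \sum_(i <- s) F i t) = \sum_(i <- s) cint D (F i).
Proof.
move=> mD iF; elim: s => [|i s ih].
  by under eq_fun do rewrite big_nil; rewrite cint0 big_nil.
under eq_fun do rewrite big_cons; rewrite cintD// ?ih ?big_cons//.
exact: cintegrable_sum.
Qed.

Lemma cintJ D f : measurable D -> cintegrable D f -> cint D (fun t => (conjc (f t))) = (conjc (cint D f)).
Proof.
move=> mD [f1 f2]; apply: complexP; rewrite ?ReJ ?ImJ /=.
  by apply: eq_Rintegral => t _; rewrite ReJ.
under eq_Rintegral do rewrite ImJ -mulN1r.
by rewrite RintegralZl// mulN1r.
Qed.

Lemma cintC D (h : R -> R) : cint D (fun t => (h t)%:C) = (\int[mu]_(t in D) h t)%R%:C.
Proof. by rewrite /cint /= {2}/Rintegral integral0. Qed.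

(** This class is stable under sums, products, conjugation and translation, and its members are
    integrable over every set of finite measure, so integrability goals reduce to closure
    properties. *)
Definition bmeas f := cmeasurable f /\ exists M : R, forall t, cabs2 (f t) <= M.

Definition bmeasR (h : R -> R) := measurable_fun [set: R] h /\ exists M : R, forall t, `|h t| <= M.

Lemma bmeasR_integrable D h : measurable D -> (mu D < +oo)%E -> bmeasR h ->
  mu.-integrable D (EFin \o h).
Proof.
move=> mD fD [mh [M hM]]; apply: measurable_bounded_integrable => //.
  exact: measurable_funTS.
exists M; split; first exact: num_real.
by move=> x Mx t _ /=; apply: le_trans (hM t) _; apply: ltW.
Qed.

Lemma bmeasR_norm_le D h : measurable D -> (mu D < +oo)%E -> bmeasR h ->
  `|(\int[mu]_(x in D) h x)%R| <= (\int[mu]_(x in D) `|h x|)%R.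
Proof.
by move=> mD fD bh; apply: le_normr_Rintegral => //; exact: bmeasR_integrable.
Qed.

Lemma bmeasR_norm h : bmeasR h -> bmeasR (fun t => `|h t|).
Proof.
move=> [mh [M hM]]; split; first exact: measurableT_comp.
by exists M => t; rewrite normr_id.
Qed.

Lemma bmeas_Re f : bmeas f -> bmeasR (fun t => complex.Re (f t)).
Proof.
(* [M] bounds the square of the modulus; [M + 1] bounds the real part because |x| <= x^2 + 1. *)
move=> [[m1 m2] [M hM]]; split=> //; exists (M + 1) => t.
have := hM t; rewrite /cabs2 -(real_normK (num_real (complex.Re (f t)))) .
have := sqr_ge0 (complex.Im (f t)); have := sqr_ge0 (`|complex.Re (f t)| - 1).
have := normr_ge0 (complex.Re (f t)). nra.
Qed.
Lemma bmeas_Im f : bmeas f -> bmeasR (fun t => complex.Im (f t)).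
Proof.
move=> [[m1 m2] [M hM]]; split=> //; exists (M + 1) => t.
have := hM t; rewrite /cabs2 -(real_normK (num_real (complex.Im (f t)))) .
have := sqr_ge0 (complex.Re (f t)); have := sqr_ge0 (`|complex.Im (f t)| - 1).
have := normr_ge0 (complex.Im (f t)). nra.
Qed.
Lemma bmeas_cintegrable D f : measurable D -> (mu D < +oo)%E -> bmeas f ->
  cintegrable D f.
Proof.
move=> mD fD bf; split; apply: bmeasR_integrable => //; [exact: bmeas_Re|exact: bmeas_Im].
Qed.

Lemma cmeasurableD f g : cmeasurable f -> cmeasurable g ->
  cmeasurable (fun t => f t + g t).
Proof.
move=> [f1 f2] [g1 g2]; split.
  by under eq_fun do rewrite ReD; exact: measurable_funD.
by under eq_fun do rewrite ImD; exact: measurable_funD.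
Qed.
Lemma cmeasurableM f g : cmeasurable f -> cmeasurable g ->
  cmeasurable (fun t => f t * g t).
Proof.
move=> [f1 f2] [g1 g2]; split.
  by under eq_fun do rewrite ReM; apply: measurable_funB; exact: measurable_funM.
by under eq_fun do rewrite ImM; apply: measurable_funD; exact: measurable_funM.
Qed.
Lemma cmeasurable_cst (c : C) : cmeasurable (fun=> c).
Proof. by split; exact: measurable_cst. Qed.
Lemma cmeasurableJ f : cmeasurable f -> cmeasurable (fun t => (conjc (f t))).
Proof.
move=> [f1 f2]; split.
  by under eq_fun do rewrite ReJ.
under eq_fun do rewrite ImJ; exact: measurableT_comp.
Qed.
Lemma cmeasurable_cabs2 f : cmeasurable f -> measurable_fun [set: R] (fun t => cabs2 (f t)).
Proof. by move=> [f1 f2]; apply: measurable_funD; exact: measurable_funX. Qed.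
Lemma cmeasurable_comp f (h : R -> R) : cmeasurable f -> measurable_fun [set: R] h ->
  cmeasurable (fun t => f (h t)).
Proof.
move=> [f1 f2] mh; split.
- exact: (measurableT_comp f1 mh).
- exact: (measurableT_comp f2 mh).
Qed.
Lemma cmeasurableC (h : R -> R) : measurable_fun [set: R] h -> cmeasurable (fun t => (h t)%:C).
Proof. by move=> mh; split => //; exact: measurable_cst. Qed.

Lemma bmeasD f g : bmeas f -> bmeas g -> bmeas (fun t => f t + g t).
Proof.
move=> [mf [M fM]] [mg [N gN]]; split; first exact: cmeasurableD.
exists (2 * M + 2 * N) => t; apply: le_trans (cabs2D_le _ _) _.
by have := fM t; have := gN t; lra.
Qed.
Lemma bmeasM f g : bmeas f -> bmeas g -> bmeas (fun t => f t * g t).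
Proof.
move=> [mf [M fM]] [mg [N gN]]; split; first exact: cmeasurableM.
exists (M * N) => t; rewrite cabs2M; apply: ler_pM => //; exact: cabs2_ge0.
Qed.
Lemma bmeas_cst (c : C) : bmeas (fun=> c).
Proof. by split; [exact: cmeasurable_cst | exists (cabs2 c)]. Qed.
Lemma bmeasJ f : bmeas f -> bmeas (fun t => (conjc (f t))).
Proof.
move=> [mf [M fM]]; split; first exact: cmeasurableJ.
by exists M => t; rewrite cabs2J.
Qed.
Lemma bmeasN f : bmeas f -> bmeas (fun t => - f t).
Proof.
by move=> bf; under eq_fun do rewrite -mulN1r; apply: bmeasM => //; exact: bmeas_cst.
Qed.
Lemma bmeasB f g : bmeas f -> bmeas g -> bmeas (fun t => f t - g t).
Proof. by move=> bf bg; apply: bmeasD => //; exact: bmeasN. Qed.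
Lemma bmeas_comp f (h : R -> R) : bmeas f -> measurable_fun [set: R] h ->
  bmeas (fun t => f (h t)).
Proof.
by move=> [mf [M fM]] mh; split; [exact: cmeasurable_comp | exists M].
Qed.
Lemma bmeas_shift f a : bmeas f -> bmeas (fun t => f (t + a)).
Proof. by move=> bf; apply: bmeas_comp => //; exact: measurable_funD. Qed.
Lemma bmeasC (h : R -> R) : bmeasR h -> bmeas (fun t => (h t)%:C).
Proof.
move=> [mh [M hM]]; split; first exact: cmeasurableC.
by exists (M ^+ 2) => t; rewrite cabs2C -(real_normK (num_real (h t))) ler_sqr ?nnegrE// (le_trans _ (hM t)).
Qed.
Lemma bmeas_sum I (s : seq I) (F : I -> R -> C) :
  (forall i, bmeas (F i)) -> bmeas (fun t => \sum_(i <- s) F i t).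
Proof.
move=> bF; elim: s => [|i s ih].
  by under eq_fun do rewrite big_nil; exact: bmeas_cst.
by under eq_fun do rewrite big_cons; exact: bmeasD.
Qed.
Lemma bmeas_cabs2 f : bmeas f -> bmeasR (fun t => cabs2 (f t)).
Proof.
move=> [mf [M fM]]; split; first exact: cmeasurable_cabs2.
by exists M => t; rewrite ger0_norm// cabs2_ge0.
Qed.
Lemma bmeas_indic (A : set R) : measurable A -> bmeas (fun t => (\1_A t)%:C).
Proof.
move=> mA; apply: bmeasC; split; first exact: measurable_indic.
by exists 1 => t; rewrite ger0_norm// indicE lern1 leq_b1.
Qed.
Lemma measurable_cos : measurable_fun [set: R] (@cos R).
Proof. by apply: continuous_measurable_fun => x; exact: continuous_cos. Qed.
Lemma measurable_sin : measurable_fun [set: R] (@sin R).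
Proof. by apply: continuous_measurable_fun => x; exact: continuous_sin. Qed.
Lemma bmeas_e2pi (h : R -> R) : measurable_fun [set: R] h -> bmeas (fun t => e2pi (h t)).
Proof.
move=> mh; split; last by exists 1 => t; rewrite cabs2_e2pi.
split.
- under eq_fun do rewrite Re_e2pi.
  by apply: (measurableT_comp measurable_cos); exact: measurable_funM.
- under eq_fun do rewrite Im_e2pi.
  by apply: (measurableT_comp measurable_sin); exact: measurable_funM.
Qed.
Lemma bmeas_e2piM (a : R) : bmeas (fun t => e2pi (a * t)).
Proof. by apply: bmeas_e2pi; exact: measurable_funM. Qed.

Lemma lebesgue_itv_fin (a b : R) : (mu `[a, b[%classic < +oo)%E.
Proof. by rewrite lebesgue_measure_itv /=; case: ifP => _; rewrite ?ltry // -EFinB ltry. Qed.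
End ComplexIntegral.

(** * Translation, splitting and exponentials under the integral *)

Section IntegralTools.
Context {R : realType}.
Local Notation C := R[i].
Local Notation mu := (@lebesgue_measure R).
Implicit Types (D : set R) (f g : R -> C).

Lemma shift_preimage_itv (a b c : R) :
  (fun x : R => x + c) @^-1` `[a + c, b + c[%classic = `[a, b[%classic.
Proof.
by apply/seteqP; split=> x /=; rewrite !in_itv/= lerD2r ltrD2r.
Qed.

Lemma measurable_shift (c : R) : measurable_fun [set: R] (fun x : R => x + c).
Proof. exact: measurable_funD. Qed.

(** By uniqueness of Lebesgue measure it is enough to compare both measures on half-open intervals,
    whose preimage under the shift is an interval of the same length. *)
Lemma lebesgue_measure_shift (c : R) (A : set R) : measurable A ->
  pushforward mu ((fun x : R => x + c) : _ -> measurableTypeR R) A = mu A.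
Proof.
move=> mA.
pose f : R -> measurableTypeR R := (fun x => x + c).
have mf : measurable_fun setT f := measurable_shift c.
pose mixin := isMeasurableFun.Build _ _ _ _ _ mf.
pose fp : {mfun _ >-> _} := HB.pack f mixin.
have := @lebesgue_measure_unique R (pushforward mu fp).
move=> H; apply/esym/H => //= _ [[a b]] _ <-.
rewrite /pushforward (_ : _ @^-1` _ = `]a - c, b - c]%classic); last first.
  by apply/seteqP; split=> x /=; rewrite !in_itv/= ltrBlDr lerBrDr.
rewrite !lebesgue_measure_itv/= !lte_fin ltrD2r.
by case: ifP => // _; rewrite !EFinN -!EFinB; congr (_%:E); ring.
Qed.

Lemma ge0_integral_shift (D : set R) (c : R) (f : R -> \bar R) : measurable D ->
  measurable_fun [set: R] f -> (forall x, (0 <= f x)%E) ->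
  (\int[mu]_(x in (fun x : R => x + c)%R @^-1` D) f (x + c)%R = \int[mu]_(x in D) f x)%E.
Proof.
move=> mD mf f0.
have := @ge0_integral_pushforward _ _ (measurableTypeR R) (measurableTypeR R) R (fun x => x + c) (measurable_shift c) lebesgue_measure D f.
move=> /(_ mD (measurable_funTS mf) (fun y _ => f0 y)) => <-.
by apply: eq_measure_integral => [|mc A mA AD]; [exact: measurable_shift|exact: lebesgue_measure_shift].
Qed.

Lemma ge0_integral_shift_itv (a b c : R) (f : R -> \bar R) :
  measurable_fun [set: R] f -> (forall x, (0 <= f x)%E) ->
  (\int[mu]_(x in `[a, b[) f (x + c)%R = \int[mu]_(x in `[(a + c)%R, (b + c)%R[) f x)%E.
Proof.
move=> mf f0; rewrite -(@ge0_integral_shift `[a + c, b + c[%classic c f)//.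
by rewrite shift_preimage_itv.
Qed.

Lemma Rintegral_shift (a b c : R) (h : R -> R) : bmeasR h ->
  (\int[mu]_(x in `[a, b[) h (x + c) = \int[mu]_(x in `[a + c, b + c[) h x)%R.
Proof.
move=> bh; rewrite /Rintegral; congr fine.
have := @integral_pushforward _ _ (measurableTypeR R) (measurableTypeR R) R (fun x => x + c) (measurable_shift c) lebesgue_measure `[a + c, b + c[%classic (EFin \o h).
rewrite shift_preimage_itv => H; rewrite -H //.
- by apply: eq_measure_integral => [|mc A mA AD]; [exact: measurable_shift|exact: lebesgue_measure_shift].
- by apply/measurable_EFinP; case: bh.
- case: bh => mh [M hM].
  apply: (@bmeasR_integrable _ _ (fun x => h (x + c))) => //.
    exact: lebesgue_itv_fin.
  split; last by exists M.
  by apply: (measurableT_comp mh); exact: measurable_shift.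
Qed.

Lemma Rintegral_itv_cat (a b c : R) (h : R -> R) : a <= b -> b <= c -> bmeasR h ->
  (\int[mu]_(x in `[a, c[) h x =
   \int[mu]_(x in `[a, b[) h x + \int[mu]_(x in `[b, c[) h x)%R.
Proof.
move=> ab bc bh.
rewrite -(@Rintegral_setU _ _ _ mu `[a, b[%classic `[b, c[%classic h)//.
- by rewrite -itv_bndbnd_setU// bnd_simp.
- apply: bmeasR_integrable => //; first exact: measurableU.
  by rewrite -itv_bndbnd_setU// ?bnd_simp//; exact: lebesgue_itv_fin.
- apply/disj_setPS => y [/=]; rewrite 2!in_itv/= => /andP[_ yx] /andP[].
  by rewrite leNgt yx.
Qed.

Lemma bmeasR_shift (h : R -> R) c : bmeasR h -> bmeasR (fun x => h (x + c)).
Proof.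
move=> [mh [M hM]]; split; last by exists M.
by apply: (measurableT_comp mh); exact: measurable_shift.
Qed.

Lemma Rintegral_split (p : R) (M : nat) (h : R -> R) : 0 <= p -> bmeasR h ->
  (\int[mu]_(x in `[0, M%:R * p[) h x =
   \sum_(k < M) \int[mu]_(x in `[0, p[) h (x + k%:R * p))%R.
Proof.
move=> p0 bh; elim: M => [|M ih].
  by rewrite big_ord0 mul0r set_itv_ge ?Rintegral_set0// bnd_simp ltxx.
rewrite big_ord_recr/= -ih -natr1 (@Rintegral_itv_cat 0 (M%:R * p))//; first last.
- by rewrite ler_wpM2r// lerDl.
- by rewrite mulr_ge0.
by rewrite Rintegral_shift// add0r mulrDl mul1r [p + _]addrC.
Qed.

Lemma cint_split (p : R) (M : nat) f : 0 <= p -> bmeas f ->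
  cint `[0, M%:R * p[ f = \sum_(k < M) cint `[0, p[ (fun x => f (x + k%:R * p)).
Proof.
move=> p0 bf; have bR := bmeas_Re bf; have bI := bmeas_Im bf.
rewrite /cint Rintegral_split// (Rintegral_split _ _ bI)//.
elim/big_rec3: _ => // k x y z _ <-; exact: complexP.
Qed.

Lemma ge0_integral_itv_cat (a b c : R) (h : R -> \bar R) : a <= b -> b <= c ->
  measurable_fun [set: R] h -> (forall x, 0 <= h x)%E ->
  (\int[mu]_(x in `[a, c[) h x =
   \int[mu]_(x in `[a, b[) h x + \int[mu]_(x in `[b, c[) h x)%E.
Proof.
move=> ab bc mh h0.
rewrite -ge0_integral_setU//.
- by rewrite -itv_bndbnd_setU// bnd_simp.
- exact: measurable_funTS.
- apply/disj_setPS => y [/=]; rewrite 2!in_itv/= => /andP[_ yx] /andP[].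
  by rewrite leNgt yx.
Qed.

Lemma ge0_integral_split (a p : R) (M : nat) (h : R -> \bar R) : 0 <= p ->
  measurable_fun [set: R] h -> (forall x, 0 <= h x)%E ->
  (\int[mu]_(x in `[a, (a + M%:R * p)%R[) h x =
   \sum_(k < M) \int[mu]_(x in `[0%R, p[) h (x + (a + k%:R * p))%R)%E.
Proof.
move=> p0 mh h0; elim: M => [|M ih].
  by rewrite big_ord0 mul0r addr0 set_itv_ge ?integral_set0// bnd_simp ltxx.
rewrite big_ord_recr/= -ih -natr1 (@ge0_integral_itv_cat a (a + M%:R * p))//; first last.
- by rewrite lerD2l ler_wpM2r// lerDl.
- by rewrite lerDl mulr_ge0.
by rewrite ge0_integral_shift_itv// add0r (_ : (p + (a + M%:R * p) = a + (M%:R + 1) * p)%R)//; ring.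
Qed.

Lemma Rintegral_FTC (F h : R -> R) (a b : R) : a < b -> continuous h ->
  (forall x : R, is_derive x 1 F (h x)) ->
  (\int[mu]_(x in `[a, b[) h x = F b - F a)%R.
Proof.
move=> ab ch dF.
have cF : continuous F.
  by move=> x; apply/differentiable_continuous/derivable1_diffP; exact: ex_derive.
have mh : measurable_fun `[a, b[ h by apply: measurable_funTS; exact: continuous_measurable_fun.
rewrite /Rintegral integral_itv_bndo_bndc//; last exact/measurable_EFinP.
rewrite (@continuous_FTC2 _ h F)//.
- exact: continuous_subspaceT.
- split; [by move=> x _; exact: ex_derive| |].
  + by apply: cvg_at_right_filter; exact: cF.
  + by apply: cvg_at_left_filter; exact: cF.
- by move=> x _; rewrite derive1E; exact: derive_val.
Qed.

Section cexp_integral.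
Variables a b : R.
Let A (x : R) := expR (a * x) * cos (b * x).
Let B (x : R) := expR (a * x) * sin (b * x).

Let is_derive_lin (c x : R) : is_derive x 1 (fun x : R => c * x) c.
Proof.
have := @is_deriveZ R _ _ id c x 1 1 (is_derive_id _ _).
by rewrite /GRing.scale/= mulr1.
Qed.

Let dE (x : R) : is_derive x 1 (fun x : R => expR (a * x)) (expR (a * x) * a).
Proof. by have := @is_derive1_comp _ expR (fun x : R => a * x) x _ _ (is_derive_expR _) (is_derive_lin a x). Qed.
Let dC (x : R) : is_derive x 1 (fun x : R => cos (b * x)) (- sin (b * x) * b).
Proof. by have := @is_derive1_comp _ cos (fun x : R => b * x) x _ _ (is_derive_cos _) (is_derive_lin b x). Qed.
Let dS (x : R) : is_derive x 1 (fun x : R => sin (b * x)) (cos (b * x) * b).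
Proof. by have := @is_derive1_comp _ sin (fun x : R => b * x) x _ _ (is_derive_sin _) (is_derive_lin b x). Qed.

Let dA (x : R) : is_derive x 1 A (a * A x - b * B x).
Proof.
apply: (is_derive_eq (is_deriveM (dE x) (dC x))).
by rewrite /A /B /GRing.scale/=; ring.
Qed.
Let dB (x : R) : is_derive x 1 B (a * B x + b * A x).
Proof.
apply: (is_derive_eq (is_deriveM (dE x) (dS x))).
by rewrite /A /B /GRing.scale/=; ring.
Qed.
Let cA : continuous A.
Proof. by move=> x; apply/differentiable_continuous/derivable1_diffP; exact: ex_derive. Qed.
Let cB : continuous B.
Proof. by move=> x; apply/differentiable_continuous/derivable1_diffP; exact: ex_derive. Qed.

Lemma cint_cexp_aux (L : R) : a +i* b != 0 -> 0 < L ->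
  cint `[0, L[ (fun x => cexp ((a +i* b) * x%:C)) =
  (cexp ((a +i* b) * L%:C) - 1) / (a +i* b).
Proof.
move=> z0 L0.
have n0 : a ^+ 2 + b ^+ 2 != 0.
  by have := cabs2_eq0 (a +i* b); rewrite (negbTE z0) => /negbT.
have E x : cexp ((a +i* b) * x%:C) = A x +i* B x.
  by rewrite /A /B /cexp ReM ImM /= !(mulr0, subr0, add0r).
rewrite (eq_cint (g := fun x => A x +i* B x)); last by move=> x _; rewrite E.
apply: (mulIf z0); rewrite mulfVK// E /cint /=.
(* The two primitives are the real and imaginary parts of e^{zx} / z, with 1 / z written as conj(z)
   / |z|^2. *)
have dF (x : R) : is_derive x 1 (fun x : R => (a * A x + b * B x) * (a ^+ 2 + b ^+ 2)^-1) (A x).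
  have d1 := @is_deriveZ R _ _ A a x 1 _ (dA x).
  have d2 := @is_deriveZ R _ _ B b x 1 _ (dB x).
  have d3 := @is_deriveZ R _ _ _ (a ^+ 2 + b ^+ 2)^-1 x 1 _ (is_deriveD d1 d2).
  rewrite (_ : (fun x => _) = ((a ^+ 2 + b ^+ 2)^-1 \*: (a \*: A \+ b \*: B))); last first.
    by apply/funext => y /=; rewrite -![_ *: _]/(_ * _); ring.
  apply: (is_derive_eq d3); rewrite -![_ *: _]/(_ * _); field; exact: n0.
have dG (x : R) : is_derive x 1 (fun x : R => (a * B x - b * A x) * (a ^+ 2 + b ^+ 2)^-1) (B x).
  have d1 := @is_deriveZ R _ _ A (- b) x 1 _ (dA x).
  have d2 := @is_deriveZ R _ _ B a x 1 _ (dB x).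
  have d3 := @is_deriveZ R _ _ _ (a ^+ 2 + b ^+ 2)^-1 x 1 _ (is_deriveD d1 d2).
  rewrite (_ : (fun x => _) = ((a ^+ 2 + b ^+ 2)^-1 \*: ((- b) \*: A \+ a \*: B))); last first.
    by apply/funext => y /=; rewrite -![_ *: _]/(_ * _); ring.
  apply: (is_derive_eq d3); rewrite -![_ *: _]/(_ * _); field; exact: n0.
rewrite (Rintegral_FTC L0 cA dF) (Rintegral_FTC L0 cB dG).
rewrite /A /B !mulr0 expR0 cos0 sin0.
apply: complexP; rewrite ?ReM ?ImM ?ReD ?ImD ?ReN ?ImN /=; field; exact: n0.
Qed.
End cexp_integral.

Lemma cint_cexp (z : C) (L : R) : z != 0 -> 0 < L ->
  cint `[0, L[ (fun x => cexp (z * x%:C)) = (cexp (z * L%:C) - 1) / z.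
Proof. by case: z => a b; exact: cint_cexp_aux. Qed.

Lemma cint_e2pi (nu L : R) (n : int) : 0 < L -> nu * L = n%:~R ->
  cint `[0, L[ (fun x => e2pi (nu * x)) = if n == 0 then L%:C else 0.
Proof.
move=> L0 nL; case: eqP => [n0|/eqP n0].
  have -> : nu = 0.
    by move/eqP: nL; rewrite n0 mulf_eq0 (gt_eqF L0) orbF => /eqP.
  rewrite (eq_cint (g := fun=> 1%:C)); last by move=> t _; rewrite mul0r e2pi0.
  rewrite cintC Rintegral_cst//= lebesgue_measure_itv/= lte_fin L0 -EFinB/= subr0 mul1r//.
pose z : C := 0 +i* (2 * pi * nu).
have eeE' x : e2pi (nu * x) = cexp (z * x%:C).
  rewrite /e2pi; congr cexp; rewrite /z; apply: complexP; rewrite ?ReM ?ImM/=; ring.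
have z0 : z != 0.
  rewrite /z eq_complex/= negb_and eqxx/= !mulf_neq0// ?(gt_eqF (pi_gt0 R))//.
  apply/eqP => nu0; move: nL; rewrite nu0 mul0r => /esym/eqP; rewrite intr_eq0.
  by rewrite (negbTE n0).
rewrite (eq_cint (g := fun x => cexp (z * x%:C))); last by move=> t _; rewrite eeE'.
by rewrite cint_cexp// -eeE' nL e2pi_int subrr mul0r.
Qed.
End IntegralTools.

(** * Fourier series *)

Section Trig.
Context {R : realType}.
Local Notation C := R[i].
Local Notation mu := (@lebesgue_measure R).
Variable L : R.
Hypothesis L0 : 0 < L.
Implicit Types (f g : R -> C).
Let D : set R := `[0, L[%classic.
Let mD : measurable D. Proof. exact: measurable_itv. Qed.
Let fD : (mu D < +oo)%E. Proof. exact: lebesgue_itv_fin. Qed.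

Let muD : fine (mu D) = L.
Proof. by rewrite /D lebesgue_measure_itv/= lte_fin L0 -EFinB/= subr0. Qed.

Definition fourier_mode (n : int) (x : R) : C := e2pi (n%:~R / L * x).
(** Squared norms are used throughout, which avoids square roots; the triangle inequality becomes
    [nrmD_le], with a factor 2. *)
Definition nrm f : R := (\int[mu]_(x in D) cabs2 (f x))%R.
Definition ip f g : C := cint D (fun x => f x * (conjc (g x))).

Arguments ip : simpl never.
Let bci f : bmeas f -> cintegrable D f.
Proof. exact: bmeas_cintegrable. Qed.

Lemma bmeas_fourier_mode n : bmeas (fourier_mode n).
Proof. exact: bmeas_e2piM. Qed.

Lemma nrmE f : bmeas f -> (nrm f)%:C = ip f f.
Proof.
by move=> bf; rewrite /nrm -cintC; apply: eq_cint => t _; rewrite cabs2E.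
Qed.

Lemma nrm_ge0 f : 0 <= nrm f.
Proof. by apply: Rintegral_ge0 => x _; exact: cabs2_ge0. Qed.

Lemma le_nrm_int f (h : R -> R) : bmeas f -> bmeasR h ->
  (forall x, D x -> cabs2 (f x) <= h x) -> nrm f <= (\int[mu]_(x in D) h x)%R.
Proof.
move=> bf bh H; apply: le_Rintegral => //; apply: bmeasR_integrable => //.
exact: bmeas_cabs2.
Qed.

Lemma nrmD_le f g : bmeas f -> bmeas g -> nrm (fun x => f x + g x) <= 2 * nrm f + 2 * nrm g.
Proof.
move=> bf bg; rewrite /nrm.
have i1 := bmeasR_integrable mD fD (bmeas_cabs2 bf).
have i2 := bmeasR_integrable mD fD (bmeas_cabs2 bg).
rewrite -!RintegralZl// -RintegralD//; try exact: integrableZR.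
apply: le_Rintegral => //.
- by apply: bmeasR_integrable => //; apply: bmeas_cabs2; exact: bmeasD.
- by apply: integrableDR => //; exact: integrableZR.
- by move=> x _; exact: cabs2D_le.
Qed.

Lemma nrmZ f c : bmeas f -> nrm (fun x => c * f x) = cabs2 c * nrm f.
Proof.
move=> bf; rewrite /nrm -RintegralZl//; last exact: (bmeasR_integrable mD fD (bmeas_cabs2 bf)).
by apply: eq_Rintegral => x _; rewrite cabs2M.
Qed.

Lemma ip_fourier_mode m n : ip (fourier_mode m) (fourier_mode n) = if m == n then L%:C else 0.
Proof.
rewrite /ip (eq_cint (g := fun x => e2pi ((m - n)%:~R / L * x))); last first.
  by move=> t _; rewrite /fourier_mode e2piJ -e2piD rmorphB/= mulrBl mulrBl.
rewrite (@cint_e2pi _ _ _ (m - n))// ?subr_eq0//.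
by rewrite divfK// gt_eqF.
Qed.

Lemma ipDl f g h : bmeas f -> bmeas g -> bmeas h ->
  ip (fun x => f x + g x) h = ip f h + ip g h.
Proof.
move=> bf bg bh; rewrite /ip -cintD//; try by apply: bci; apply: bmeasM => //; exact: bmeasJ.
by apply: eq_cint => t _; rewrite mulrDl.
Qed.
Lemma ipZl c f g : bmeas f -> bmeas g -> ip (fun x => c * f x) g = c * ip f g.
Proof.
move=> bf bg; rewrite /ip -cintZ//; last by apply: bci; apply: bmeasM => //; exact: bmeasJ.
by apply: eq_cint => t _; rewrite mulrA.
Qed.
Lemma ipC f g : bmeas f -> bmeas g -> ip g f = (conjc (ip f g)).
Proof.
move=> bf bg; rewrite /ip -cintJ//; last by apply: bci; apply: bmeasM => //; exact: bmeasJ.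
by apply: eq_cint => t _; rewrite conjcM conjcK mulrC.
Qed.
Lemma ipBl f g h : bmeas f -> bmeas g -> bmeas h ->
  ip (fun x => f x - g x) h = ip f h - ip g h.
Proof.
move=> bf bg bh.
rewrite (_ : ip _ _ = ip (fun x => f x + (-1) * g x) h); last first.
  by apply: eq_cint => t _; rewrite mulN1r.
rewrite ipDl//; last by apply: bmeasM => //; exact: bmeas_cst.
by rewrite ipZl// mulN1r.
Qed.
Lemma ip_suml I (s : seq I) (F : I -> R -> C) h :
  (forall i, bmeas (F i)) -> bmeas h ->
  ip (fun x => \sum_(i <- s) F i x) h = \sum_(i <- s) ip (F i) h.
Proof.
move=> bF bh; rewrite /ip -cint_sum//; last first.
  by move=> i; apply: bci; apply: bmeasM => //; exact: bmeasJ.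
by apply: eq_cint => t _; rewrite big_distrl.
Qed.

Definition trig_poly (X : seq int) (c : int -> C) (x : R) : C := \sum_(n <- X) c n * fourier_mode n x.

Lemma bmeas_trig_poly X c : bmeas (trig_poly X c).
Proof.
by apply: bmeas_sum => n; apply: bmeasM; [exact: bmeas_cst|exact: bmeas_fourier_mode].
Qed.

Lemma ip_trig_poly_fourier_mode X c n : uniq X -> ip (trig_poly X c) (fourier_mode n) = if n \in X then L%:C * c n else 0.
Proof.
move=> uX; rewrite ip_suml; last 2 first.
- by move=> i; apply: bmeasM; [exact: bmeas_cst|exact: bmeas_fourier_mode].
- exact: bmeas_fourier_mode.
rewrite (eq_bigr (fun i => if i == n then L%:C * c n else 0)); last first.
  move=> i _; rewrite ipZl ?ip_fourier_mode; [|exact: bmeas_fourier_mode..].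
  by case: eqP => [->|_]; rewrite ?mulr0// mulrC.
case: ifPn => [nX|nX].
  by rewrite (bigD1_seq n)//= eqxx big1 ?addr0// => i /negbTE ->.
by rewrite big_seq big1// => i iX; case: eqP => // ein; rewrite ein (negbTE nX) in iX.
Qed.

Lemma nrm_trig_poly X c : uniq X -> nrm (trig_poly X c) = L * \sum_(n <- X) cabs2 (c n).
Proof.
move=> uX; apply: complexI.
rewrite nrmE; last exact: bmeas_trig_poly.
rewrite {1}/trig_poly ip_suml; last 2 first.
- by move=> i; apply: bmeasM; [exact: bmeas_cst|exact: bmeas_fourier_mode].
- exact: bmeas_trig_poly.
rewrite rmorphM rmorph_sum/= mulr_sumr big_seq [RHS]big_seq; apply: eq_bigr => n nX.
rewrite ipZl; [|exact: bmeas_fourier_mode|exact: bmeas_trig_poly].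
rewrite ipC; [|exact: bmeas_trig_poly|exact: bmeas_fourier_mode].
rewrite ip_trig_poly_fourier_mode// nX cabs2E conjcM conjc_real; ring.
Qed.

(** Completing the square in each coefficient separates the optimal choice
    [ip f (fourier_mode n) / L] from the deviation of [c n]. Both halves of Parseval follow from
    this identity. *)
Lemma nrm_sub_trig_poly f X c : bmeas f -> uniq X ->
  nrm (fun x => f x - trig_poly X c x) = nrm f +
   \sum_(n <- X) (L * cabs2 (c n - ip f (fourier_mode n) / L%:C) - cabs2 (ip f (fourier_mode n)) / L).
Proof.
move=> bf uX; apply: complexI.
have bT := bmeas_trig_poly X c.
rewrite nrmE; last exact: bmeasB.
rewrite ipBl//; last exact: bmeasB.
rewrite ipC//; last exact: bmeasB.
rewrite [X in _ - X]ipC//; last exact: bmeasB.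
rewrite !ipBl// !conjcD !conjcN -!nrmE// conjc_real.
rewrite nrm_trig_poly// conjc_real.
have -> : ip (trig_poly X c) f = \sum_(n <- X) c n * (conjc (ip f (fourier_mode n))).
  rewrite ip_suml//; last by move=> i; apply: bmeasM; [exact: bmeas_cst|exact: bmeas_fourier_mode].
  apply: eq_bigr => n _; rewrite ipZl//; last exact: bmeas_fourier_mode.
  by rewrite ipC//; exact: bmeas_fourier_mode.
have -> : ip f (trig_poly X c) = \sum_(n <- X) (conjc (c n)) * ip f (fourier_mode n).
  rewrite ipC// ip_suml//; last by move=> i; apply: bmeasM; [exact: bmeas_cst|exact: bmeas_fourier_mode].
  rewrite conjc_sum; apply: eq_bigr => n _; rewrite ipZl//; last exact: bmeas_fourier_mode.
  by rewrite conjcM -ipC//; exact: bmeas_fourier_mode.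
rewrite RtoCD !conjc_sum RtoCM !RtoC_sum mulr_sumr.
rewrite opprB -!addrA; congr (_ + _).
rewrite -!sumrN -!big_split; apply: eq_bigr => n _.
move: (ip f (fourier_mode n)) => a /=.
rewrite RtoCB !RtoCM RtoCV !cabs2E !conjcM conjcK conjcD conjcN conjcM conjc_inv conjc_real conjcK.
field.
by rewrite fmorph_eq0 gt_eqF.
Qed.

(** With the optimal coefficients the squares in [nrm_sub_trig_poly] vanish, and its left-hand side
    is nonnegative. *)
Lemma bessel f X : bmeas f -> uniq X ->
  \sum_(n <- X) cabs2 (ip f (fourier_mode n)) <= L * nrm f.
Proof.
move=> bf uX.
have := nrm_ge0 (fun x => f x - trig_poly X (fun n => ip f (fourier_mode n) / L%:C) x).
rewrite nrm_sub_trig_poly//; under eq_bigr do rewrite subrr cabs20 mulr0 sub0r -mulNr.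
by rewrite -big_distrl/= sumrN mulNr subr_ge0 ler_pdivrMr// mulrC.
Qed.

(** Dropping the squares in [nrm_sub_trig_poly] gives a converse to Bessel, with the approximation
    error of an arbitrary trigonometric polynomial as defect. *)
Lemma nrm_le_bessel f X c : bmeas f -> uniq X ->
  L * (nrm f - nrm (fun x => f x - trig_poly X c x)) <= \sum_(n <- X) cabs2 (ip f (fourier_mode n)).
Proof.
move=> bf uX; rewrite nrm_sub_trig_poly// opprD addrA subrr sub0r -sumrN mulr_sumr.
apply: ler_sum => n _; rewrite opprB mulrBr mulrCA mulfV ?gt_eqF// mulr1.
by rewrite lerBlDr lerDl mulr_ge0 ?mulr_ge0 ?cabs2_ge0// ltW.
Qed.

Definition is_trig_poly f := exists X c, uniq X /\ forall x, f x = trig_poly X c x.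

(** Padding with zero coefficients allows two polynomials to share one list of frequencies, and
    later places any list inside a symmetric range of integers. *)
Lemma trig_poly_widen (X Z : seq int) c : uniq X -> uniq Z -> {subset X <= Z} ->
  trig_poly X c =1 trig_poly Z (fun n => if n \in X then c n else 0).
Proof.
move=> uX uZ XZ x; rewrite /trig_poly.
under [RHS]eq_bigr do rewrite (fun_if (fun z => z * fourier_mode _ x)) mul0r.
rewrite -big_mkcond/= -[RHS]big_filter; apply: perm_big.
apply: uniq_perm => //; first exact: filter_uniq.
by move=> n; rewrite mem_filter; apply/idP/andP => [nX|[]//]; rewrite nX XZ.
Qed.

Lemma is_trig_polyD f g : is_trig_poly f -> is_trig_poly g -> is_trig_poly (fun x => f x + g x).
Proof.
move=> [X [c [uX fX]]] [Y [d [uY gY]]].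
pose Z := undup (X ++ Y).
have uZ : uniq Z by exact: undup_uniq.
exists Z, (fun n => (if n \in X then c n else 0) + (if n \in Y then d n else 0)).
split=> // x; rewrite fX gY.
rewrite (@trig_poly_widen X Z)//; last by move=> n nX; rewrite mem_undup mem_cat nX.
rewrite (@trig_poly_widen Y Z)//; last by move=> n nX; rewrite mem_undup mem_cat nX orbT.
by rewrite /trig_poly -big_split/=; apply: eq_bigr => n _; rewrite mulrDl.
Qed.

Lemma is_trig_poly_fourier_mode c n : is_trig_poly (fun x => c * fourier_mode n x).
Proof. by exists [:: n], (fun=> c); split=> // x; rewrite /trig_poly big_seq1. Qed.

Lemma is_trig_poly_sum I (s : seq I) (F : I -> R -> C) :
  (forall i, is_trig_poly (F i)) -> is_trig_poly (fun x => \sum_(i <- s) F i x).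
Proof.
move=> tF; elim: s => [|i s ih].
  by exists [::], (fun=> 0); split=> // x; rewrite /trig_poly !big_nil.
by under eq_fun do rewrite big_cons; exact: is_trig_polyD.
Qed.

Lemma is_trig_polyZ a f : is_trig_poly f -> is_trig_poly (fun x => a * f x).
Proof.
move=> [X [c [uX fX]]]; exists X, (fun n => a * c n); split=> // x.
by rewrite fX /trig_poly mulr_sumr; apply: eq_bigr => n _; rewrite mulrA.
Qed.

Lemma bmeas_is_trig_poly f : is_trig_poly f -> bmeas f.
Proof. by move=> [X [c [_ fX]]]; rewrite (funext fX); exact: bmeas_trig_poly. Qed.
End Trig.

(** * Fejer means and their pointwise convergence *)

Section Fejer.
Context {R : realType}.
Local Notation C := R[i].
Local Notation mu := (@lebesgue_measure R).
Variable L : R.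
Hypothesis L0 : 0 < L.
Implicit Types (f : R -> C) (g : R -> R).
Let D : set R := `[0, L[%classic.
Let mD : measurable D. Proof. exact: measurable_itv. Qed.
Let fD : (mu D < +oo)%E. Proof. exact: lebesgue_itv_fin. Qed.
Let muD : fine (mu D) = L.
Proof. by rewrite /D lebesgue_measure_itv/= lte_fin L0 -EFinB/= subr0. Qed.

(** The Fejer kernel of period 1, in the form that makes its positivity evident. *)
Definition fejer (N : nat) (u : R) : R :=
  N.+1%:R^-1 * cabs2 (\sum_(k < N.+1) e2pi (k%:R * u)).

Lemma fejer_ge0 N u : 0 <= fejer N u.
Proof. by rewrite mulr_ge0 ?invr_ge0 ?cabs2_ge0. Qed.

Lemma fejerE N u : (fejer N u)%:C =
  \sum_(k < N.+1) \sum_(l < N.+1) (N.+1%:R^-1)%:C * e2pi ((k%:Z - l%:Z)%:~R * u).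
Proof.
rewrite /fejer RtoCM cabs2E conjc_sum mulr_suml mulr_sumr; apply: eq_bigr => k _.
rewrite mulr_sumr mulr_sumr; apply: eq_bigr => l _.
by rewrite e2piJ -e2piD -mulrBl rmorphB.
Qed.

Lemma bmeasR_fejer N x : bmeasR (fun y => fejer N ((x - y) / L)).
Proof.
rewrite (_ : (fun y => _) = (fun y => complex.Re ((fejer N ((x - y) / L))%:C)))//.
apply: bmeas_Re; under eq_fun do rewrite fejerE.
apply: bmeas_sum => k; apply: bmeas_sum => l; apply: bmeasM; first exact: bmeas_cst.
apply: bmeas_e2pi.
by do 2 (apply: measurable_funM => //); apply: measurable_funB.
Qed.

Lemma bmeasRM (g h : R -> R) : bmeasR g -> bmeasR h -> bmeasR (fun x => g x * h x).
Proof.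
move=> bg bh.
rewrite (_ : (fun y => _) = (fun y => complex.Re ((g y)%:C * (h y)%:C))).
  by apply: bmeas_Re; apply: bmeasM; exact: bmeasC.
by apply/funext => y; rewrite -RtoCM.
Qed.

Lemma bmeasR_cst (c : R) : bmeasR (fun=> c).
Proof. by split => //; exists `|c|. Qed.

(** Not normalized: the kernel has total mass [L] on the interval, whence the quotients by [L] in
    the approximation statements. *)
Definition fejer_mean g N x : R := (\int[mu]_(y in D) (g y * fejer N ((x - y) / L)))%R.

Lemma fejer_meanE g N x : bmeasR g -> (fejer_mean g N x)%:C =
  \sum_(k < N.+1) \sum_(l < N.+1)
    ((N.+1%:R^-1)%:C * ip L (fun y => (g y)%:C) (fourier_mode L (k%:Z - l%:Z))) * fourier_mode L (k%:Z - l%:Z) x.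
Proof.
move=> bg; have bgC := bmeasC bg.
rewrite /fejer_mean -cintC.
rewrite (eq_cint (g := fun y => \sum_(k < N.+1) \sum_(l < N.+1)
  ((N.+1%:R^-1)%:C * fourier_mode L (k%:Z - l%:Z) x) * ((g y)%:C * conjc (fourier_mode L (k%:Z - l%:Z) y)))); last first.
  move=> y _; rewrite RtoCM fejerE mulr_sumr; apply: eq_bigr => k _.
  rewrite mulr_sumr; apply: eq_bigr => l _.
  rewrite (_ : _ * ((x - y) / L) = (k%:Z - l%:Z)%:~R / L * x + - ((k%:Z - l%:Z)%:~R / L * y)); last by ring.
  rewrite e2piD /fourier_mode e2piJ; ring.
have bF (k l : nat) : bmeas (fun y => (g y)%:C * conjc (fourier_mode L (k%:Z - l%:Z) y)).
  by apply: bmeasM => //; apply: bmeasJ; exact: bmeas_fourier_mode.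
have iF (k l : nat) c : cintegrable D (fun y => c * ((g y)%:C * conjc (fourier_mode L (k%:Z - l%:Z) y))).
  by apply: bmeas_cintegrable => //; apply: bmeasM => //; exact: bmeas_cst.
rewrite cint_sum//; last by move=> k; exact: cintegrable_sum.
apply: eq_bigr => k _; rewrite cint_sum//; apply: eq_bigr => l _.
rewrite cintZ//; last exact: bmeas_cintegrable.
by rewrite /ip mulrAC.
Qed.

Lemma is_trig_poly_fejer_mean g N : bmeasR g -> is_trig_poly L (fun x => (fejer_mean g N x)%:C).
Proof.
move=> bg; under eq_fun do rewrite fejer_meanE//.
by apply: is_trig_poly_sum => k; apply: is_trig_poly_sum => l; exact: is_trig_poly_fourier_mode.
Qed.

(** By orthogonality only the N + 1 diagonal terms k = l survive in [fejer_meanE], each equal to L /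
    (N + 1). *)
Lemma fejer_mean1 N x : fejer_mean (fun=> 1) N x = L.
Proof.
apply: complexI; rewrite fejer_meanE; last exact: bmeasR_cst.
have e0 y : fourier_mode L 0 y = 1 by rewrite /fourier_mode mul0r mul0r e2pi0.
rewrite (eq_bigr (fun=> (N.+1%:R^-1 * L)%:C)); last first.
  move=> k _; rewrite (bigD1 k)//= big1 ?addr0; last first.
    move=> l lk; rewrite (_ : (fun=> _) = fourier_mode L 0); last by apply/funext => y; rewrite e0.
    rewrite ip_fourier_mode// eq_sym subr_eq0 ifF ?mulr0 ?mul0r//.
    by apply/negbTE; apply: contra lk => /eqP[] kl; apply/eqP/val_inj.
  rewrite (_ : (fun=> _) = fourier_mode L 0); last by apply/funext => y; rewrite e0.
  by rewrite ip_fourier_mode// subrr eqxx e0 mulr1 RtoCM.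
rewrite -RtoC_sum sumr_const card_ord -[(_ * L) *+ _]mulr_natl; congr (_%:C).
by rewrite mulrA mulfV ?mul1r// pnatr_eq0.
Qed.

(** The factor 1 - e(u) closes the geometric sum to 1 - e((N + 1) u), whose squared modulus is at
    most 4. *)
Lemma fejer_bound N u : cabs2 (1 - e2pi u) * fejer N u <= 4 / N.+1%:R.
Proof.
rewrite /fejer mulrCA [leRHS]mulrC ler_wpM2l ?invr_ge0// -cabs2M.
under eq_bigr do rewrite -e2piX.
rewrite -[1 - _]opprB mulNr -subrX1 cabs2N e2piX.
by apply: le_trans (cabs2B_le _ _) _; rewrite cabs2_e2pi cabs21; lra.
Qed.

(** A Korovkin estimate: the hypothesis is integrated against the nonnegative kernel, where [eps]
    meets the total mass and [K] meets [fejer_bound]. *)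
Lemma fejer_mean_approx g N x (eps K : R) : bmeasR g -> 0 <= eps -> 0 <= K ->
  (forall y, D y -> `|g y - g x| <= eps + K * cabs2 (1 - e2pi ((x - y) / L))) ->
  `|fejer_mean g N x / L - g x| <= eps + K * (4 / N.+1%:R).
Proof.
move=> bg e0 K0 H.
have bF := bmeasR_fejer N x.
have -> : fejer_mean g N x / L - g x = (\int[mu]_(y in D) ((g y - g x) * fejer N ((x - y) / L)))%R / L.
  have iF : mu.-integrable D (EFin \o (fun y => fejer N ((x - y) / L))).
    exact: bmeasR_integrable.
  have -> : (\int[mu]_(y in D) ((g y - g x) * fejer N ((x - y) / L)))%R = fejer_mean g N x - g x * fejer_mean (fun=> 1) N x.
    rewrite /fejer_mean -RintegralZl//; last by under eq_fun do rewrite mul1r.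
    rewrite -RintegralB//; last 2 first.
    - by apply: bmeasR_integrable => //; exact: bmeasRM.
    - by apply: bmeasR_integrable => //; under eq_fun do rewrite mul1r; apply: bmeasRM => //; exact: bmeasR_cst.
    by apply: eq_Rintegral => y _; rewrite mul1r mulrBl.
  by rewrite fejer_mean1 mulrBl mulfK// gt_eqF.
rewrite normrM normfV (gtr0_norm L0) ler_pdivrMr//.
have bB : bmeasR (fun y => g y - g x).
  case: bg => mg [M gM]; split; first exact: measurable_funB.
  by exists (M + `|g x|) => t; apply: (le_trans (ler_normB _ _)); rewrite lerD2r.
have bG : bmeasR (fun y => (g y - g x) * fejer N ((x - y) / L)) by exact: bmeasRM.
apply: le_trans (bmeasR_norm_le mD fD bG) _.
have -> : (eps + K * (4 / N.+1%:R)) * L =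
    (\int[mu]_(y in D) (eps * fejer N ((x - y) / L) + K * (4 / N.+1%:R)))%R.
  rewrite RintegralD//; last 2 first.
  - by apply: bmeasR_integrable => //; apply: bmeasRM => //; exact: bmeasR_cst.
  - by apply: bmeasR_integrable => //; exact: bmeasR_cst.
  rewrite RintegralZl//; last exact: bmeasR_integrable.
  rewrite Rintegral_cst// muD mulrDl; congr (_ * _ + _).
  rewrite -[LHS](fejer_mean1 N x) /fejer_mean; apply: eq_Rintegral => y _; by rewrite mul1r.
apply: le_Rintegral => //.
- by apply: bmeasR_integrable => //; exact: bmeasR_norm.
- apply: integrableDR => //; apply: bmeasR_integrable => //; first apply: bmeasRM => //; exact: bmeasR_cst.
- move=> y Dy; rewrite normrM (ger0_norm (fejer_ge0 _ _)).
  apply: le_trans (ler_wpM2r (fejer_ge0 _ _) (H y Dy)) _.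
  rewrite mulrDl lerD2l -mulrA; apply: ler_wpM2l => //; exact: fejer_bound.
Qed.

Lemma cabs2_1Be2pi (u : R) : cabs2 (1 - e2pi u) = 2 - 2 * cos (2 * pi * u).
Proof.
rewrite /cabs2 ReD ImD ReN ImN Re_e2pi Im_e2pi /=.
have := cos2Dsin2 (2 * pi * u); nra.
Qed.

(** The symmetry u -> 1 - u reduces the claim to u <= 1/2, where the cosine of 2 pi u is
    decreasing. *)
Lemma cabs2_1Be2pi_ge (d u : R) : 0 < d -> d <= u -> u <= 1 - d ->
  2 - 2 * cos (2 * pi * d) <= cabs2 (1 - e2pi u).
Proof.
move=> d0 du u1; rewrite cabs2_1Be2pi.
have pi0 := pi_gt0 R.
have main v : d <= v -> v <= 2^-1 -> cos (2 * pi * v) <= cos (2 * pi * d).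
  move=> dv v1.
  by rewrite leNgt ltr_cos -?leNgt ?in_itv/=; [nra | apply/andP; split; nra | apply/andP; split; nra].
have [u2|u2] := lerP u 2^-1; first by have := main u du u2; lra.
have : cos (2 * pi * (1 - u)) <= cos (2 * pi * d) by apply: main; lra.
have -> : cos (2 * pi * (1 - u)) = cos (2 * pi * u).
  rewrite mulrBr mulr1 cosB mulr_natl cos2pi sin2pi; ring.
lra.
Qed.

(** Near x continuity gives [eps]; elsewhere |1 - e((x - y) / L)| is bounded below and the crude
    bound 2 M is absorbed by [K]. Since g need not be periodic, x must be interior: the kernel also
    peaks when |x - y| is close to L. *)
Lemma korovkin g (M : R) (x eps : R) : (forall y, `|g y| <= M) -> {for x, continuous g} ->
  0 < x -> x < L -> 0 < eps ->
  exists K, 0 <= K /\ forall y, D y -> `|g y - g x| <= eps + K * cabs2 (1 - e2pi ((x - y) / L)).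
Proof.
move=> gM cg x0 xL e0.
have /cvgrPdist_le /(_ eps e0) [d1 /= d10 Hd] := cg.
(* [d] keeps |x - y| / L away from both 0 and 1: it is below the radius of continuity [d1], and |x -
   y| <= L - d because x lies at distance at least d from both ends. *)
pose d := Num.min d1 (Num.min x (L - x)) / 2.
have dpos : 0 < d by rewrite divr_gt0// !lt_min d10 x0 subr_gt0 xL.
have dd1 : d < d1.
  have : Num.min d1 (Num.min x (L - x)) <= d1 by rewrite ge_min lexx.
  by rewrite /d; move: dpos; rewrite /d; lra.
have dx : d <= x.
  have : Num.min d1 (Num.min x (L - x)) <= x by rewrite !ge_min lexx ?orbT.
  by move: dpos; rewrite /d; lra.
have dLx : d <= L - x.
  have : Num.min d1 (Num.min x (L - x)) <= L - x by rewrite !ge_min lexx ?orbT.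
  by move: dpos; rewrite /d; lra.
have M0 : 0 <= M by apply: le_trans (gM 0).
pose m := 2 - 2 * cos (2 * pi * (d / L)).
have dL0 : 0 < d / L by rewrite divr_gt0.
have dL1 : d / L <= 2^-1 by rewrite ler_pdivrMr//; lra.
have m0 : 0 < m.
  have pi0 := pi_gt0 R.
  have : cos (2 * pi * (d / L)) < cos 0.
    by rewrite ltr_cos ?in_itv/=; [nra | apply/andP; split; nra | apply/andP; split; nra].
  by rewrite cos0 /m; lra.
exists (2 * M / m); split; first by rewrite divr_ge0 ?mulr_ge0// ltW.
move=> y; rewrite /D/= in_itv/= => /andP[y0 yL].
have [xy|xy] := ltP `|x - y| d1.
  rewrite distrC; apply: le_trans (Hd _ _) _ => //.
  by rewrite lerDl mulr_ge0 ?cabs2_ge0// divr_ge0 ?mulr_ge0// ltW.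
have gg : `|g y - g x| <= 2 * M.
  by apply: le_trans (ler_normB _ _) _; have := gM x; have := gM y; lra.
apply: (le_trans gg); rewrite -[leLHS]add0r; apply: lerD; first exact: ltW.
rewrite -[leLHS](divfK (lt0r_neq0 m0)); apply: ler_wpM2l.
  by rewrite divr_ge0 ?mulr_ge0// ltW.
have bb v : v = `|x - y| / L -> m <= cabs2 (1 - e2pi v).
  move=> ->; apply: cabs2_1Be2pi_ge => //.
    by rewrite ler_pM2r ?invr_gt0// (le_trans (ltW dd1)).
  rewrite -[1](mulfV (lt0r_neq0 L0)) -mulrBl ler_pM2r ?invr_gt0//.
  by rewrite ler_norml; lra.
have [xy0|xy0] := lerP 0 (x - y).
  by apply: bb; rewrite ger0_norm.
rewrite -cabs2J conjcD conjcN e2piJ conjc1; apply: bb; rewrite ltr0_norm//; ring.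
Qed.

Lemma fejer_mean_cvg g (M : R) (x : R) : measurable_fun setT g -> (forall y, `|g y| <= M) ->
  {for x, continuous g} -> 0 < x -> x < L ->
  (fejer_mean g N x / L - g x) @[N --> \oo] --> 0.
Proof.
move=> mg gM cg x0 xL.
have bg : bmeasR g by split => //; exists M.
apply/cvgrPdist_le => e e0.
have e2 : 0 < e / 2 by rewrite divr_gt0.
have [K [K0 HK]] := korovkin gM cg x0 xL e2.
have KN : (K * (4 / N.+1%:R) @[N --> \oo] --> (0 : R)).
  rewrite -[X in _ --> X](mulr0 (K * 4)).
  under eq_fun do rewrite mulrA.
  by apply: cvgMr; exact: cvg_harmonic.
move/cvgrPdist_le : KN => /(_ _ e2); apply: filterS => N.
rewrite !sub0r !normrN => HN.
apply: le_trans (fejer_mean_approx N bg (ltW e2) K0 HK) _.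
by have := le_trans (ler_norm _) HN; move: (K * _) => z; lra.
Qed.

Lemma fejer_mean_le g (M : R) (x : R) N : measurable_fun setT g -> (forall y, `|g y| <= M) ->
  `|fejer_mean g N x / L| <= M.
Proof.
move=> mg gM.
have bg : bmeasR g by split => //; exists M.
have bF := bmeasR_fejer N x.
rewrite normrM normfV (gtr0_norm L0) ler_pdivrMr//.
have bG : bmeasR (fun y => g y * fejer N ((x - y) / L)) by exact: bmeasRM.
apply: le_trans (bmeasR_norm_le mD fD bG) _.
have -> : M * L = (\int[mu]_(y in D) (M * fejer N ((x - y) / L)))%R.
  rewrite RintegralZl//; last exact: bmeasR_integrable.
  congr (_ * _).
  rewrite -[LHS](fejer_mean1 N x) /fejer_mean; apply: eq_Rintegral => y _; by rewrite mul1r.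
apply: le_Rintegral => //.
- by apply: bmeasR_integrable => //; exact: bmeasR_norm.
- apply: bmeasR_integrable => //; apply: bmeasRM => //; exact: bmeasR_cst.
- by move=> y Dy; rewrite normrM (ger0_norm (fejer_ge0 _ _)) ler_wpM2r// fejer_ge0.
Qed.
End Fejer.

Section EsumSeq.
Context {R : realType} {T : choiceType}.
Implicit Types (a : T -> R) (X : seq T).

Lemma esum_ge_seq a X : uniq X ->
  ((\sum_(n <- X) a n)%:E <= \esum_(n in [set: T]) (a n)%:E)%E.
Proof.
move=> uX; apply: esum_ge; exists [set` X] => /=; first by split => //; exact: finite_seq.
by rewrite -fsbig_seq// sumEFin.
Qed.

Lemma esum_le_seq a (B : \bar R) :
  (forall X, uniq X -> ((\sum_(n <- X) a n)%:E <= B)%E) ->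
  (\esum_(n in [set: T]) (a n)%:E <= B)%E.
Proof.
move=> H; apply: ge_ereal_sup => _ [X [finX _] <-].
by rewrite fsbig_finite//= sumEFin; apply: H; exact: finmap.fset_uniq.
Qed.
Lemma esumZl a (c : R) : 0 < c ->
  (\esum_(n in [set: T]) (c * a n)%:E = c%:E * \esum_(n in [set: T]) (a n)%:E)%E.
Proof.
(* One inequality for all scalars suffices; the reverse one is its instance for the inverse
   scalar. *)
have le1 d (f : T -> R) : 0 < d ->
    (\esum_(n in [set: T]) (d * f n)%:E <= d%:E * \esum_(n in [set: T]) (f n)%:E)%E.
  move=> d0; apply: esum_le_seq => X uX.
  by rewrite -mulr_sumr EFinM lee_pmul2l ?lte_fin//; exact: esum_ge_seq.
move=> c0; apply/eqP; rewrite eq_le le1//=.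
rewrite (_ : (fun n => (a n)%:E) = (fun n => (c^-1 * (c * a n))%:E)); last first.
  by apply/funext => n; rewrite mulKf// gt_eqF.
have := @le1 c^-1 (fun n => c * a n); rewrite invr_gt0 => /(_ c0) H.
have c0' : (0 < c%:E)%E by rewrite lte_fin.
rewrite -(lee_pmul2l _ c0')// in H.
by apply: (le_trans H); rewrite muleA -EFinM mulfV ?mul1e// gt_eqF.
Qed.
End EsumSeq.

(** * Density of trigonometric polynomials and Parseval's identity *)

Section Parseval.
Context {R : realType}.
Local Notation C := R[i].
Local Notation mu := (@lebesgue_measure R).
Variable L : R.
Hypothesis L0 : 0 < L.
Implicit Types (f : R -> C) (g : R -> R).
Let D : set R := `[0, L[%classic.
Let mD : measurable D. Proof. exact: measurable_itv. Qed.
Let fD : (mu D < +oo)%E. Proof. exact: lebesgue_itv_fin. Qed.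
Let muD : fine (mu D) = L.
Proof. by rewrite /D lebesgue_measure_itv/= lte_fin L0 -EFinB/= subr0. Qed.

(** Dominated convergence; the endpoint 0, where Fejer means need not converge, is discarded as a
    null set. *)
Lemma Rintegral_cvg0 (h : nat -> R -> R) (M : R) :
  (forall n, measurable_fun setT (h n)) -> (forall n x, `|h n x| <= M) ->
  (forall x, 0 < x -> x < L -> h n x @[n --> \oo] --> 0) ->
  (\int[mu]_(x in D) h n x)%R @[n --> \oo] --> (0 : R).
Proof.
move=> mh hM hc.
have bh n : bmeasR (h n) by split => //; exists M.
have [] := @dominated_convergence _ _ R mu D mD (fun n x => (h n x)%:E) (cst 0%E) (fun=> M%:E).
- by move=> n; apply/measurable_EFinP; apply: (@measurable_funTS _ _ _ _ D (h n)); exact: mh.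
- exact: measurable_cst.
- exists [set 0]; split => //; first exact: lebesgue_measure_set1.
  move=> x /= /not_implyP[]; rewrite /D/= in_itv/= le_eqVlt => /andP[/orP[/eqP <-//|x0] xL] []//.
  by apply: cvg_EFin; [exact: nearW|exact: hc].
- by apply: (@bmeasR_integrable _ D (fun=> M)) => //; exact: bmeasR_cst.
- by apply: aeW => x n _; rewrite lee_fin.
move=> _ _; rewrite integral0 => /fine_cvgP[_]; exact.
Qed.

Lemma dense_cont g (M : R) (eps : R) : continuous g -> (forall y, `|g y| <= M) -> 0 < eps ->
  exists T, is_trig_poly L T /\ nrm L (fun x => (g x)%:C - T x) <= eps.
Proof.
move=> cg gM e0.
have mg : measurable_fun setT g by exact: continuous_measurable_fun.
have bg : bmeasR g by split => //; exists M.
have M0 : 0 <= M by apply: le_trans (gM 0).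
have bc N : bmeas (fun x => (fejer_mean L g N x)%:C) by apply: bmeas_is_trig_poly; exact: is_trig_poly_fejer_mean.
pose h N x := (fejer_mean L g N x / L - g x) ^+ 2.
have mc N : measurable_fun setT (fejer_mean L g N) by case: (bmeas_Re (bc N)).
have : (\int[mu]_(x in D) h n x)%R @[n --> \oo] --> (0 : R).
  apply: (@Rintegral_cvg0 _ ((2 * M) ^+ 2)).
  - by move=> n; apply: measurable_funX; apply: measurable_funB => //; exact: measurable_funM.
  - move=> n x; rewrite normrX ler_sqr ?nnegrE ?mulr_ge0//.
    apply: le_trans (ler_normB _ _) _; have := gM x; have := fejer_mean_le L0 x n mg gM; lra.
  - move=> x x0 xL; have c := fejer_mean_cvg L0 mg gM (cg x) x0 xL.
    have := cvgM c c; rewrite mulr0 => cc.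
    by rewrite /h; under eq_fun do rewrite expr2; exact: cc.
move/cvgrPdist_le => /(_ _ e0) [N _ /(_ N (leqnn N))].
rewrite sub0r normrN => HN.
exists (fun x => (L^-1)%:C * (fejer_mean L g N x)%:C); split.
  by apply: is_trig_polyZ; exact: is_trig_poly_fejer_mean.
apply: le_trans HN; rewrite ger0_norm; last by apply: Rintegral_ge0 => x _; exact: sqr_ge0.
rewrite /nrm le_eqVlt; apply/orP; left; apply/eqP.
apply: eq_Rintegral => x _; rewrite -RtoCM -RtoCB cabs2C /h mulrC.
by rewrite -sqrrN opprB.
Qed.

(** For M >= 0 this is the projection of x onto [-M, M]; the absolute values make its continuity
    immediate. *)
Definition clamp (M x : R) : R := 2^-1 * (`|x + M : R| - `|x - M : R|).

Lemma clamp_le (M x : R) : 0 <= M -> `|clamp M x| <= M.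
Proof.
move=> M0; rewrite /clamp ler_norml.
by case: (ger0P (x + M)) => a; case: (ger0P (x - M)) => b; lra.
Qed.

Lemma clamp_dist (M x y : R) : `|y| <= M -> `|y - clamp M x| <= `|y - x|.
Proof.
rewrite ler_norml => /andP[g1 g2].
rewrite /clamp ler_norml; case: (ger0P (x + M)) => a; case: (ger0P (x - M)) => b;
  case: (ger0P (y - x)) => c; lra.
Qed.

(** Continuous approximants are available in L^1 only. Clamping them to the bound [M] of g upgrades
    this to L^2, because then |g - h|^2 <= 2 M |g - k|. *)
Lemma dense_real g (eps : R) : bmeasR g -> 0 < eps ->
  exists T, is_trig_poly L T /\ nrm L (fun x => (g x)%:C - T x) <= eps.
Proof.
move=> bg e0; have [mg [M gM]] := bg.
have M0 : 0 <= M by apply: le_trans (gM 0).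
have [g_ [cg_ ig_]] := @approximation_continuous_integrable R D g mD fD (bmeasR_integrable mD fD bg).
move=> /fine_cvgP[_] /cvgrPdist_le.
(* This tolerance makes 2 M times the L^1 error at most eps / 4; together with the error eps / 4 of
   [dense_cont] and the factor 2 of [nrmD_le] the total is eps. *)
have e' : 0 < eps / (8 * (M + 1)) by rewrite divr_gt0// mulr_gt0// ltr_wpDl.
move=> /(_ _ e') [N _ /(_ N (leqnn N))] /=; rewrite sub0r normrN => HN.
pose k := g_ N.
have ck : continuous k := cg_ N.
pose h (x : R) : R := clamp M (k x).
have hM x : `|h x| <= M.
  exact: clamp_le.
have gh x : `|g x - h x| <= `|g x - k x| by exact: clamp_dist.
have ch : continuous h.
  move=> x; apply: cvgMr; apply: cvgB; apply: cvg_norm.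
    by apply: cvgD; [exact: ck|exact: cvg_cst].
  by apply: cvgB; [exact: ck|exact: cvg_cst].
have mh : measurable_fun setT h by exact: continuous_measurable_fun.
have bh : bmeasR h by split => //; exists M.
have e4 : 0 < eps / 4 by rewrite divr_gt0.
have [T [tT HT]] := dense_cont ch hM e4.
exists T; split; first exact: tT.
have bhC : bmeas (fun x => (h x)%:C) by exact: bmeasC.
have bgh : bmeas (fun x => (g x)%:C - (h x)%:C) by apply: bmeasB => //; exact: bmeasC.
have -> : (fun x => (g x)%:C - T x) = (fun x => ((g x)%:C - (h x)%:C) + ((h x)%:C - T x)).
  by apply/funext => x; rewrite addrA subrK.
have bhT : bmeas (fun x => (h x)%:C - T x) by apply: bmeasB => //; exact: bmeas_is_trig_poly tT.
apply: (le_trans (nrmD_le L bgh bhT)).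
suff : nrm L (fun x => (g x)%:C - (h x)%:C) <= 2 * M * (eps / (8 * (M + 1))).
  have : 2 * M * (eps / (8 * (M + 1))) <= eps / 4.
    rewrite mulrA ler_pdivrMr; last by lra.
    by nra.
  by lra.
have igk : mu.-integrable D (EFin \o (fun x => `|g x - k x|)).
  apply: (@integrable_norm _ _ _ mu D (fun x => g x - k x)).
  apply: integrableBR => //; first exact: bmeasR_integrable.
  exact: ig_.
have I1 : (\int[mu]_(x in D) `|g x - k x|)%R <= eps / (8 * (M + 1)).
  apply: le_trans HN; apply: le_trans (ler_norm _); exact: lexx.
apply: (@le_trans _ _ (2 * M * (\int[mu]_(x in D) `|g x - k x|)%R)); last first.
  by apply: ler_wpM2l => //; rewrite mulr_ge0.
rewrite /nrm -RintegralZl//; apply: le_Rintegral => //.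
- by apply: bmeasR_integrable => //; exact: bmeas_cabs2.
- exact: integrableZR.
- move=> x _; rewrite -RtoCB cabs2C -(real_normK (num_real _)) expr2.
  apply: ler_pM => //; apply: le_trans (ler_normB _ _) _.
  by have := gM x; have := hM x; lra.
Qed.

Lemma trig_poly_dense f (eps : R) : bmeas f -> 0 < eps ->
  exists T, is_trig_poly L T /\ nrm L (fun x => f x - T x) <= eps.
Proof.
move=> bf e0; have e4 : 0 < eps / 4 by rewrite divr_gt0.
have [T [tT HT]] := dense_real (bmeas_Re bf) e4.
have [S [tS HS]] := dense_real (bmeas_Im bf) e4.
exists (fun x => T x + (0 +i* 1) * S x); split.
  by apply: is_trig_polyD => //; exact: is_trig_polyZ.
have -> : (fun x => f x - (T x + (0 +i* 1) * S x)) = (fun x => ((complex.Re (f x))%:C - T x) +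
   (0 +i* 1) * ((complex.Im (f x))%:C - S x)).
  by apply/funext => x; rewrite {1}[f x]complexE; ring.
have b1 : bmeas (fun x => (complex.Re (f x))%:C - T x).
  by apply: bmeasB; [apply: bmeasC; exact: bmeas_Re|exact: bmeas_is_trig_poly tT].
have b2 : bmeas (fun x => (complex.Im (f x))%:C - S x).
  by apply: bmeasB; [apply: bmeasC; exact: bmeas_Im|exact: bmeas_is_trig_poly tS].
have b3 : bmeas (fun x => (0 +i* 1) * ((complex.Im (f x))%:C - S x)).
  by apply: bmeasM => //; exact: bmeas_cst.
apply: (le_trans (nrmD_le L b1 b3)).
rewrite nrmZ// (_ : cabs2 (0 +i* 1 : C) = 1) ?mul1r; last by rewrite /cabs2/= expr0n expr1n add0r.
by lra.
Qed.

(** One inequality is Bessel; the other is [nrm_le_bessel] for a trigonometric polynomial within e /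
    L of f. *)
Theorem parseval f : bmeas f ->
  (\esum_(n in [set: int]) (cabs2 (ip L f (fourier_mode L n)))%:E = (L * nrm L f)%:E)%E.
Proof.
move=> bf; apply/eqP; rewrite eq_le; apply/andP; split.
  by apply: esum_le_seq => X uX; exact: bessel.
apply/lee_addgt0Pr => e e0.
have eL : 0 < e / L by rewrite divr_gt0.
have [T [[X [c [uX TX]]] HT]] := trig_poly_dense bf eL.
rewrite (funext TX) in HT.
apply: le_trans (leeD2r _ (esum_ge_seq _ uX)).
rewrite -EFinD lee_fin.
have := nrm_le_bessel L0 c bf uX.
have : L * nrm L (fun x => f x - trig_poly L X c x) <= e by rewrite mulrC -ler_pdivlMr.
by rewrite mulrBr; lra.
Qed.
End Parseval.

Section IntCat.
Context {R : realType}.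
Lemma cint_cat (a b c : R) (f : R -> R[i]) : a <= b -> b <= c -> bmeas f ->
  cint `[a, c[ f = cint `[a, b[ f + cint `[b, c[ f.
Proof.
move=> ab bc bf; rewrite /cint (Rintegral_itv_cat ab bc (bmeas_Re bf)).
by rewrite (Rintegral_itv_cat ab bc (bmeas_Im bf)).
Qed.
End IntCat.

(** * The window on the frequency side *)

Section Window.
Context {R : realType}.
Local Notation C := R[i].
Local Notation mu := (@lebesgue_measure R).
Variables b w : R.
Hypotheses (b0 : 0 < b) (w0 : w < 0).

Definition kappa : R := pi * expR (- (pi * b * w)).

Lemma kappa_gt0 : 0 < kappa.
Proof. by rewrite mulr_gt0 ?pi_gt0 ?expR_gt0. Qed.

(* Up to a constant and a modulation, the conjugate of g is the Fourier
   transform of e^{2 pi w x} restricted to [0, b). *)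
Lemma gsinc_conj (t : R) : conjc (gsinc b w t) =
  kappa%:C * e2pi (b / 2 * t) * cint `[0, b[ (fun x => (expR (2 * pi * w * x))%:C * e2pi (- t * x)).
Proof.
have pi0 := pi_gt0 R.
pose z : C := (2 * pi * w) +i* (- (2 * pi * t)).
have z0 : z != 0.
  apply/negP => /eqP/(congr1 (@complex.Re R))/= /eqP.
  by rewrite !mulf_eq0 (gt_eqF pi0) (lt_eqF w0) pnatr_eq0.
rewrite (eq_cint (g := fun x => cexp (z * x%:C))); last first.
  move=> x _; rewrite /e2pi -cexpC -cexpD; congr cexp.
  by apply: complexP; rewrite ?ReD ?ImD ?ReM ?ImM /=; ring.
rewrite cint_cexp//.
(* Multiplying e^{zb} - 1 by e^{-u}, with u half of zb, gives e^u - e^{-u}, the conjugated sine up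
   to a constant. The factor e^{-u} supplies both the modulation and the exponential in [kappa]. *)
pose u : C := z * (b / 2)%:C.
have Hm : kappa%:C * e2pi (b / 2 * t) = pi%:C * cexp (- u).
  rewrite /kappa RtoCM -cexpC /e2pi -mulrA -cexpD; congr (_ * cexp _).
  by apply: complexP; rewrite ?ReD ?ImD ?ReN ?ImN ?ReM ?ImM /=; field.
have Hz : cexp (z * b%:C) = cexp u * cexp u.
  by rewrite -cexpD; congr cexp; apply: complexP; rewrite ?ReD ?ImD ?ReM ?ImM /=; field.
have uN : cexp (- u) * cexp u = 1 by rewrite -cexpD addNr cexp0.
pose zeta : C := t%:C - 'i * w%:C.
have Hc : conjc ('i * ((pi * b)%:C * zeta)) = u.
  by apply: complexP; rewrite ?ReJ ?ImJ /zeta ?ReM ?ImM ?ReD ?ImD ?ReN ?ImN ?ReM ?ImM /=; field.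
have zE : z = pi%:C * conjc (2 * 'i) * conjc zeta.
  apply: complexP; rewrite /zeta !conjcM conjcD conjcN ?conjcM
    ?ReM ?ImM ?ReD ?ImD ?ReN ?ImN ?ReM ?ImM /=; ring.
rewrite /gsinc /csin -/zeta conjcM conjc_inv conjcM conjc_inv conjcD conjcN !cexpJ.
rewrite conjcN Hc Hm Hz.
transitivity (pi%:C * (cexp u - cexp (- u)) / z).
  move: z0; rewrite zE; move: (pi%:C) (conjc (2 * 'i)) (conjc zeta) => a X Y.
  rewrite !mulf_eq0 !negb_or => /andP[/andP[a0 X0] Y0]; field.
  by rewrite a0 X0 Y0.
rewrite [RHS]mulrA; congr (_ / _).
have -> : cexp u - cexp (- u) = (cexp (- u) * cexp u) * cexp u - cexp (- u).
  by rewrite uN mul1r.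
ring.
Qed.

Variables al be : R.
Hypotheses (al0 : 0 < al) (be0 : 0 < be).
Let P : R := be^-1.
Let p : R := al^-1.
Let p0 : 0 < p. Proof. by rewrite invr_gt0. Qed.
Let r : R := expR (2 * pi * w * p).

Definition num_steps : nat := (Num.truncn (b / p)).+1.
Lemma num_stepsP : b <= num_steps%:R * p.
Proof.
rewrite -ler_pdivrMr//; apply/ltW; rewrite /num_steps; exact: truncnS_gt.
Qed.

Definition exp_window (x : R) : C := (\1_(`[0, b[%classic : set R) x * expR (2 * pi * w * x))%:C.

Lemma bmeas_exp_window : bmeas exp_window.
Proof.
have pi0 := pi_gt0 R.
apply: bmeasC; split.
  apply: measurable_funM; first exact: measurable_indic.
  by apply: measurableT_comp => //; exact: measurable_funM.
exists 1 => x; rewrite indicE; case: (boolP (x \in _)) => [|_]; last first.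
  by rewrite mul0r normr0.
rewrite inE/= in_itv/= mul1r => /andP[x0 _].
by rewrite ger0_norm ?expR_ge0// -[leRHS]expR0 ler_expR mulr_le0_ge0// mulr_ge0_le0// ?ltW// mulr_gt0.
Qed.

(* The [c j] play the role of the samples f(s + j / be); [freq_poly] is their
   Fourier transform, and is quasi-periodic with period be. *)
Definition freq_poly (J : nat) (c : nat -> C) (s x : R) : C :=
  \sum_(j < J) c j * e2pi (- (s + j%:R * P) * x).

Lemma bmeas_freq_poly J c s : bmeas (freq_poly J c s).
Proof.
by apply: bmeas_sum => j; apply: bmeasM; [exact: bmeas_cst|exact: bmeas_e2piM].
Qed.

(** The function H of the overview. For x >= 0 the terms with k >= [num_steps] would vanish, since x
    + k p is then beyond the window. *)
Definition periodization (J : nat) (c : nat -> C) (s x : R) : C :=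
  \sum_(k < num_steps) exp_window (x + k%:R * p) * freq_poly J c s (x + k%:R * p).

Lemma bmeas_periodization J c s : bmeas (periodization J c s).
Proof.
apply: bmeas_sum => k; apply: bmeasM; apply: bmeas_shift; [exact: bmeas_exp_window|exact: bmeas_freq_poly].
Qed.

(** Absorbs into the samples the part of the modulation in [gsinc_conj] that depends on j; the part
    that depends on n stays outside the sum and has modulus 1. *)
Definition twist (J : nat) (c : nat -> C) (s : R) (j : nat) : C :=
  c j * e2pi (b / 2 * (s + j%:R * P)).

Lemma cabs2_twist J c s j : cabs2 (twist J c s j) = cabs2 (c j).
Proof. by rewrite /twist cabs2M cabs2_e2pi mulr1. Qed.

Definition window_sample (J : nat) (c : nat -> C) (s : R) (n : int) : C :=
  \sum_(j < J) c j * conjc (gsinc b w (s + j%:R * P - al * n%:~R)).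

(** The integral over [0, b) is cut into pieces of length p, and e(al n x) is invariant under x -> x
    + p because al p = 1. The pieces thus add up to a Fourier coefficient on [0, p). *)
Lemma window_sample_cint J c s n : window_sample J c s n = kappa%:C * e2pi (- (b / 2 * (al * n%:~R))) *
  cint `[0, p[ (fun x => periodization J (twist J c s) s x * fourier_mode p n x).
Proof.
pose D : set R := `[0, b[%classic.
have mD : measurable D by exact: measurable_itv.
have fD : (mu D < +oo)%E by exact: lebesgue_itv_fin.
have bEE x : bmeas (fun y => exp_window y * e2pi (x * y)).
  by apply: bmeasM; [exact: bmeas_exp_window|exact: bmeas_e2piM].
have ewE t : cint D (fun x => (expR (2 * pi * w * x))%:C * e2pi (t * x)) =
    cint D (fun x => exp_window x * e2pi (t * x)).
  apply: eq_cint => x Dx; rewrite /exp_window indicE mem_set// mul1r//.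
transitivity (\sum_(j < J) kappa%:C * e2pi (- (b / 2 * (al * n%:~R))) *
    cint D (fun x => twist J c s j * (exp_window x * e2pi (- (s + j%:R * P - al * n%:~R) * x)))).
  apply: eq_bigr => j _; rewrite gsinc_conj ewE cintZ//; last exact: bmeas_cintegrable.
  rewrite /twist mulrBr e2piD; ring.
rewrite -mulr_sumr; congr (_ * _).
rewrite -cint_sum//; last first.
  by move=> j; apply: bmeas_cintegrable => //; apply: bmeasM => //; exact: bmeas_cst.
pose Phi x := exp_window x * (freq_poly J (twist J c s) s x * e2pi (al * n%:~R * x)).
have bPhi : bmeas Phi.
  by apply: bmeasM; [exact: bmeas_exp_window|apply: bmeasM; [exact: bmeas_freq_poly|exact: bmeas_e2piM]].
rewrite (eq_cint (g := Phi)); last first.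
  move=> x _; rewrite /Phi /freq_poly mulr_suml mulr_sumr; apply: eq_bigr => j _.
  by rewrite opprB addrC mulrDl e2piD; ring.
have ew0 x : b <= x -> exp_window x = 0.
  move=> bx; rewrite /exp_window indicE memNset ?mul0r// /= in_itv/=.
  by move=> /andP[_]; rewrite ltNge bx.
have -> : cint D Phi = cint `[0, num_steps%:R * p[ Phi.
  rewrite (@cint_cat _ 0 b (num_steps%:R * p))//; [|exact: ltW|exact: num_stepsP].
  rewrite [X in _ = _ + X](eq_cint (g := fun=> 0)) ?cint0 ?addr0//.
  by move=> x /=; rewrite in_itv/= => /andP[bx _]; rewrite /Phi ew0// mul0r.
rewrite cint_split//; last exact: ltW.
rewrite -cint_sum//; last first.
  by move=> k; apply: bmeas_cintegrable; [|exact: lebesgue_itv_fin|exact: bmeas_shift].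
apply: eq_cint => x _; rewrite /periodization mulr_suml; apply: eq_bigr => k _.
rewrite /Phi mulrA; congr (_ * _); rewrite /fourier_mode /p invrK [al * _]mulrC mulrDr e2piD.
rewrite [X in _ * X](_ : _ = 1) ?mulr1//.
rewrite mulrCA -mulrA mulfV ?gt_eqF// mulr1 -[k%:R]/(k%:Z%:~R) -intrM; exact: e2pi_int.
Qed.

Theorem esum_window_sample J c s :
  (\esum_(n in [set: int]) (cabs2 (window_sample J c s n))%:E =
    (kappa ^+ 2 * p * nrm p (periodization J (twist J c s) s))%:E)%E.
Proof.
set H := periodization J (twist J c s) s.
have bH : bmeas H by exact: bmeas_periodization.
have bHJ : bmeas (fun x => conjc (H x)) by exact: bmeasJ.
(* [ip] conjugates the Fourier mode whereas [window_sample_cint] pairs H with the mode itself, so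
   Parseval is applied to the conjugate of H. *)
have nJ : nrm p (fun x => conjc (H x)) = nrm p H.
  by apply: eq_Rintegral => x _; rewrite cabs2J.
rewrite -mulrA EFinM -nJ -parseval//.
rewrite -esumZl; last by rewrite exprn_gt0// kappa_gt0.
apply: eq_esum => n _; congr (_%:E).
rewrite window_sample_cint !cabs2M cabs2_e2pi mulr1 cabs2C; congr (_ * _).
rewrite -cabs2J -cintJ//; last first.
  by apply: bmeas_cintegrable; [|exact: lebesgue_itv_fin|apply: bmeasM => //; exact: bmeas_fourier_mode].
by congr cabs2; apply: eq_cint => x _; rewrite conjcM.
Qed.
End Window.

(** * Reduction modulo a period *)

Section Periodic.
Context {R : realType}.
Local Notation mu := (@lebesgue_measure R).
Variable be : R.
Hypothesis be0 : 0 < be.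

Definition wrap (x : R) : R := x - be * (Num.floor (x / be))%:~R.

Lemma wrap_itv x : 0 <= wrap x < be.
Proof.
have /andP[h1 h2] := floor_itv (x / be).
rewrite /wrap subr_ge0 ltrBlDr; apply/andP; split.
  by rewrite mulrC -ler_pdivlMr.
rewrite intrD in h2.
by move: h2; rewrite ltr_pdivrMr//; lra.
Qed.

Lemma wrapE x : exists m : int, x = wrap x + m%:~R * be.
Proof. by exists (Num.floor (x / be)); rewrite /wrap; ring. Qed.

Lemma wrap_id x : 0 <= x -> x < be -> wrap x = x.
Proof.
move=> x0 xb; rewrite /wrap (_ : Num.floor _ = 0) ?mulr0 ?subr0//.
apply: floor_def; rewrite add0r divr_ge0//=; last exact: ltW.
by rewrite ltr_pdivrMr// mul1r.
Qed.

Lemma wrapDz x (m : int) : wrap (x + m%:~R * be) = wrap x.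
Proof.
rewrite /wrap mulrDl mulfK ?gt_eqF// floorDrz ?intr_int// intrKfloor intrD; ring.
Qed.
Lemma wrapD x : wrap (x + be) = wrap x.
Proof. by rewrite -{1}[be]mul1r (wrapDz x 1). Qed.

Lemma measurable_wrap : measurable_fun [set: R] wrap.
Proof.
apply: measurable_funB => //; apply: measurable_funM => //.
apply: nondecreasing_measurable => // x y xy.
by rewrite ler_int; apply: le_floor; rewrite ler_pM2r// invr_gt0.
Qed.

Lemma periodicz (T : Type) (h : R -> T) : (forall x, h (x + be) = h x) ->
  forall x (m : int), h (x + m%:~R * be) = h x.
Proof.
move=> hp.
have hn x (n : nat) : h (x + n%:R * be) = h x.
  elim: n => [|n ih]; first by rewrite mul0r addr0.
  by rewrite -natr1 mulrDl mul1r addrA hp.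
move=> x [n|n]; first exact: hn.
by rewrite NegzE -(hn _ n.+1) mulrNz mulNr subrK.
Qed.

Lemma periodic_wrap (T : Type) (h : R -> T) : (forall x, h (x + be) = h x) ->
  forall x, h x = h (wrap x).
Proof. by move=> hp x; have [m {1}->] := wrapE x; exact: periodicz. Qed.

(** The shift may be reduced modulo [be]; the part of the translated interval beyond [be] is then
    moved back by one period. *)
Lemma Rintegral_periodic (h : R -> R) y : bmeasR h -> (forall x, h (x + be) = h x) ->
  (\int[mu]_(x in `[0, be[) h (x + y) = \int[mu]_(x in `[0, be[) h x)%R.
Proof.
move=> bh hp.
have /andP[y0 yb] := wrap_itv y.
transitivity (\int[mu]_(x in `[0, be[) h (x + wrap y))%R.
  apply: eq_Rintegral => x _; have [m {1}->] := wrapE y.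
  by rewrite addrA (periodicz hp).
rewrite Rintegral_shift// add0r (@Rintegral_itv_cat _ _ be)//; [|exact: ltW|by rewrite lerDl].
have -> : (\int[mu]_(x in `[be, be + wrap y[) h x = \int[mu]_(x in `[0, wrap y[) h x)%R.
  rewrite -[X in `[X, _[]add0r -[be + _]addrC -Rintegral_shift//.
  by apply: eq_Rintegral => x _; rewrite hp.
by rewrite addrC -Rintegral_itv_cat// ltW.
Qed.
End Periodic.

Section RSum.
Context {R : realType}.
Local Notation mu := (@lebesgue_measure R).

Lemma bmeasRD (g h : R -> R) : bmeasR g -> bmeasR h -> bmeasR (fun x => g x + h x).
Proof.
move=> [mg [A HA]] [mh [B HB]]; split; first exact: measurable_funD.
by exists (A + B) => x; apply: le_trans (ler_normD _ _) _; exact: lerD.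
Qed.

Lemma bmeasR_sum I (s : seq I) (F : I -> R -> R) :
  (forall i, bmeasR (F i)) -> bmeasR (fun t => \sum_(i <- s) F i t).
Proof.
move=> bF; elim: s => [|i s ih].
  by under eq_fun do rewrite big_nil; exact: bmeasR_cst.
by under eq_fun do rewrite big_cons; exact: bmeasRD.
Qed.

Lemma Rintegral_sum (a c : R) I (s : seq I) (F : I -> R -> R) :
  (forall i, bmeasR (F i)) ->
  (\int[mu]_(x in `[a, c[) (\sum_(i <- s) F i x) = \sum_(i <- s) \int[mu]_(x in `[a, c[) F i x)%R.
Proof.
move=> bF; elim: s => [|i s ih].
  by rewrite big_nil; under eq_Rintegral do rewrite big_nil; rewrite Rintegral_cst// mul0r.
under eq_Rintegral do rewrite big_cons.
rewrite RintegralD//; first by rewrite ih big_cons.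
- by apply: bmeasR_integrable => //; exact: lebesgue_itv_fin.
- by apply: bmeasR_integrable; [|exact: lebesgue_itv_fin|exact: bmeasR_sum].
Qed.
End RSum.

(** * Bounds for the periodizations *)

Section Bounds.
Context {R : realType}.
Local Notation C := R[i].
Local Notation mu := (@lebesgue_measure R).
Variables b w : R.
Hypotheses (b0 : 0 < b) (w0 : w < 0).
Variables al be : R.
Hypotheses (al0 : 0 < al) (be0 : 0 < be).
Let P : R := be^-1.
Let p : R := al^-1.
Let p0 : 0 < p. Proof. by rewrite invr_gt0. Qed.
Definition decay : R := expR (2 * pi * w * p).
Let r := decay.
Let r0 : 0 < r. Proof. exact: expR_gt0. Qed.
Let r1 : r < 1.
Proof.
by rewrite /r /decay -expR0 ltr_expR pmulr_llt0// pmulr_rlt0// mulr_gt0// pi_gt0.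
Qed.
Local Notation M := (num_steps b al).

(** The points x + k p increase with k, so those inside the window occupy an initial segment of
    indices. Its length N is the exponent that appears after telescoping. *)
Lemma cutoff (x : R) (m : nat) :
  exists N, (N <= m)%N /\ forall k, (k < m)%N -> (x + k%:R * p < b) = (k < N)%N.
Proof.
elim: m => [|m [N [Nm HN]]]; first by exists 0%N.
have [Nm'|Nm'] := eqVneq N m; last first.
  have Nlt : (N < m)%N by rewrite ltn_neqAle Nm'.
  exists N; split; first exact: leqW.
  move=> k; rewrite ltnS leq_eqVlt => /orP[/eqP->|]; last exact: HN.
  rewrite ltnNge Nm/=; apply/negbTE; rewrite -leNgt.
  have := HN N Nlt; rewrite ltnn => /negbT; rewrite -leNgt => /le_trans; apply.
  by rewrite lerD2l ler_pM2r// ler_nat.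
case: (boolP (x + m%:R * p < b)) => xb.
  exists m.+1; split => // k km; rewrite km.
  apply: le_lt_trans xb; by rewrite lerD2l ler_pM2r// ler_nat.
exists m; split => // k; rewrite ltnS leq_eqVlt => /orP[/eqP->|km].
  by rewrite ltnn (negbTE xb).
by rewrite HN// Nm'.
Qed.

(** The weight at x + k p is e^{2 pi w x} r^k, so the term -r S(x + p + k p) of one index cancels
    the leading term of the next. Only the first point and the first one past the window remain. *)
Lemma telescope_window (S : R -> C) (x : R) : 0 <= x ->
  exists N, [/\ (N <= M)%N, (0 < N)%N = (x < b) ,
    (forall k, (k < M)%N -> (x + k%:R * p < b) = (k < N)%N) &
   \sum_(k < M) exp_window b w (x + k%:R * p) * (S (x + k%:R * p) - r%:C * S (x + k%:R * p + p)) =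
   (expR (2 * pi * w * x))%:C * (S x - (r ^+ N)%:C * S (x + N%:R * p))].
Proof.
move=> x0; have [N [NM HN]] := cutoff x M.
exists N; split => //; first by rewrite -HN// mul0r addr0.
rewrite (eq_bigr (fun k : 'I_M => if (k < N)%N then
    (expR (2 * pi * w * x))%:C * ((r ^+ k)%:C * S (x + k%:R * p) - (r ^+ k.+1)%:C * S (x + k.+1%:R * p)) else 0)); last first.
  move=> k _; rewrite /exp_window indicE -HN//.
  have xk0 : 0 <= x + k%:R * p by rewrite addr_ge0// mulr_ge0// ltW.
  case: ifPn => kb; last by rewrite memNset/= ?mul0r ?mul0r// in_itv/= xk0 (negbTE kb).
  rewrite mem_set/=; last by rewrite in_itv/= xk0 kb.
  rewrite mul1r [2 * pi * w * (x + _)]mulrDr expRD (_ : 2 * pi * w * (k%:R * p) = k%:R * (2 * pi * w * p)); last by ring.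
  have -> : x + k.+1%:R * p = x + k%:R * p + p by rewrite -natr1; ring.
  rewrite expRM_natl -/decay -/r RtoCM exprSr RtoCM; ring.
rewrite -big_mkcond/= -(big_ord_widen _ (fun k => (expR (2 * pi * w * x))%:C * ((r ^+ k)%:C * S (x + k%:R * p) - (r ^+ k.+1)%:C * S (x + k.+1%:R * p))))//.
rewrite -mulr_sumr; congr (_ * _).
elim: N {NM HN} => [|N ih]; first by rewrite big_ord0 expr0 mul1r mul0r addr0 subrr.
by rewrite big_ord_recr/= ih; ring.
Qed.

(* S = freq_poly (resolvent c s) s solves S(x) - r S(x + p) = freq_poly c s x,
   where r = e^{2 pi w p}: this is what makes the windowed sums telescope. *)
Definition resolvent (c : nat -> C) (s : R) (j : nat) : C := c j / (1 - r%:C * e2pi (- (s + j%:R * P) * p)).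

(** This makes the coefficients of C and S comparable, uniformly in the fiber and in the number of
    samples; r < 1 comes from w < 0. *)
Lemma resolvent_den_bounds (t : R) : (1 - r) ^+ 2 <= cabs2 (1 - r%:C * e2pi t) <= 4.
Proof.
have := cos2Dsin2 (2 * pi * t); have := cos_le1 (2 * pi * t); have := cos_geN1 (2 * pi * t).
rewrite /cabs2 ReD ImD ReN ImN ReM ImM Re_e2pi Im_e2pi /=.
move: r0 r1 (cos _) (sin _) => r0' r1' u v u1 u2 uv.
have -> : (1 - (r * u - 0 * v)) ^+ 2 + (0 - (r * v + 0 * u)) ^+ 2 = 1 - 2 * r * u + r ^+ 2 * (u ^+ 2 + v ^+ 2) by ring.
by rewrite uv; apply/andP; split; nra.
Qed.

Lemma resolvent_den_neq0 (t : R) : 1 - r%:C * e2pi t != 0.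
Proof.
rewrite -cabs2_eq0 gt_eqF//; have /andP[h _] := resolvent_den_bounds t.
by apply: lt_le_trans h; rewrite exprn_gt0// subr_gt0.
Qed.

Lemma resolvent_le c s j : cabs2 (resolvent c s j) <= cabs2 (c j) / (1 - r) ^+ 2.
Proof.
rewrite /resolvent cabs2M cabs2V ler_wpM2l ?cabs2_ge0//.
have r2 : 0 < (1 - r) ^+ 2 by rewrite exprn_gt0// subr_gt0.
have /andP[h _] := resolvent_den_bounds (- (s + j%:R * P) * p).
by rewrite lef_pV2 ?posrE //; exact: lt_le_trans h.
Qed.
Lemma resolvent_ge c s j : cabs2 (c j) / 4 <= cabs2 (resolvent c s j).
Proof.
rewrite /resolvent cabs2M cabs2V ler_wpM2l ?cabs2_ge0//.
have r2 : 0 < (1 - r) ^+ 2 by rewrite exprn_gt0// subr_gt0.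
have /andP[h h'] := resolvent_den_bounds (- (s + j%:R * P) * p).
by rewrite lef_pV2 ?posrE //; exact: lt_le_trans h.
Qed.

Lemma freq_poly_resolvent J c s x : freq_poly be J c s x =
  freq_poly be J (resolvent c s) s x - r%:C * freq_poly be J (resolvent c s) s (x + p).
Proof.
rewrite /freq_poly mulr_sumr -sumrB; apply: eq_bigr => j _.
rewrite mulrDr e2piD /resolvent -/P; set u := e2pi (_ * x); set v := e2pi (_ * p).
field; exact: resolvent_den_neq0.
Qed.

Lemma periodization_resolvent J c s (x : R) : 0 <= x ->
  exists N, [/\ (N <= M)%N, (0 < N)%N = (x < b) ,
    (forall k, (k < M)%N -> (x + k%:R * p < b) = (k < N)%N) &
   periodization b w al be J c s x =
   (expR (2 * pi * w * x))%:C * (freq_poly be J (resolvent c s) s x - (r ^+ N)%:C * freq_poly be J (resolvent c s) s (x + N%:R * p))].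
Proof.
move=> x0; have [N [h1 h2 h3 h4]] := telescope_window (freq_poly be J (resolvent c s) s) x0; exists N; split => //.
by rewrite -h4; apply: eq_bigr => k _; rewrite (freq_poly_resolvent J c).
Qed.

(** Up to the unimodular factor e(-s x), the sum is a trigonometric polynomial of period [be] with
    frequencies -j; the shift y only changes the phases of its coefficients. *)
Lemma freq_poly_nrm J d s y : (\int[mu]_(x in `[0%R, be[) cabs2 (freq_poly be J d s (x + y)))%R =
  be * \sum_(j < J) cabs2 (d j).
Proof.
pose e (j : nat) : int := - j%:Z.
pose c (n : int) : C := d `|n|%N * e2pi (- (s + `|n|%N%:R * P) * y).
pose X := [seq e j | j <- iota 0 J].
have uX : uniq X.
  by rewrite map_inj_uniq ?iota_uniq// => i j /oppr_inj[].
transitivity (nrm be (trig_poly be X c)).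
  apply: eq_Rintegral => x _.
  rewrite -[RHS]mul1r -(cabs2_e2pi (- s * x)) -cabs2M; congr cabs2.
  rewrite /trig_poly big_map /freq_poly mulr_sumr -[X in iota _ X]subn0 -/(index_iota _ _) big_mkord.
  apply: eq_bigr => j _; rewrite /c /e /fourier_mode abszN absz_nat.
  rewrite mulrCA -[RHS]mulrA -!e2piD; congr (_ * e2pi _).
  rewrite mulrNz -/P; ring.
rewrite nrm_trig_poly// /X big_map -[X in iota _ X]subn0 -/(index_iota _ _) big_mkord; congr (_ * _).
by apply: eq_bigr => j _; rewrite /c /e abszN absz_nat cabs2M cabs2_e2pi mulr1.
Qed.

Lemma bmeas_freq_poly_shift J d s y : bmeas (fun x => freq_poly be J d s (x + y)).
Proof. by apply: bmeas_shift; exact: bmeas_freq_poly. Qed.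

Definition num_turns : nat := (Num.truncn (p / be)).+1.
Lemma num_turnsP : p <= num_turns%:R * be.
Proof. rewrite -ler_pdivrMr//; apply/ltW; exact: truncnS_gt. Qed.

Lemma nrm_p_freq_poly J d s y : nrm p (fun x => freq_poly be J d s (x + y)) <= num_turns%:R * be * \sum_(j < J) cabs2 (d j).
Proof.
have bF := bmeas_cabs2 (bmeas_freq_poly_shift J d s y).
apply: (@le_trans _ _ (\int[mu]_(x in `[0%R, (num_turns%:R * be)%R[) cabs2 (freq_poly be J d s (x + y)))%R).
  rewrite (@Rintegral_itv_cat _ 0 p (num_turns%:R * be))//; [|exact: ltW|exact: num_turnsP].
  by rewrite lerDl; apply: Rintegral_ge0 => x _; exact: cabs2_ge0.
rewrite Rintegral_split//; last exact: ltW.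
rewrite (eq_bigr (fun=> be * \sum_(j < J) cabs2 (d j))); last first.
  move=> k _; rewrite -(freq_poly_nrm J d s (k%:R * be + y)).
  by apply: eq_Rintegral => x _; rewrite addrA.
by rewrite sumr_const card_ord -mulrA [leRHS]mulr_natl.
Qed.

(** One 2 is for S(x), the other for each of the M + 1 possible values of S(x + N p);
    [num_turns * be] covers [0, p) by whole periods, and the denominator passes from S back to C. *)
Definition upper_const : R := (2 + 2 * M.+1%:R) * (num_turns%:R * be) / (1 - r) ^+ 2.

Lemma upper_const_ge0 : 0 <= upper_const.
Proof.
rewrite /upper_const mulr_ge0// ?invr_ge0 ?sqr_ge0// mulr_ge0// ?mulr_ge0 ?(ltW be0)//.
Qed.

Lemma nrm_periodization_upper J c s : nrm p (periodization b w al be J c s) <= upper_const * \sum_(j < J) cabs2 (c j).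
Proof.
pose d := resolvent c s; pose S := freq_poly be J d s.
have mp : measurable (`[0, p[%classic : set R) by exact: measurable_itv.
have fp : (mu `[0%R, p[%classic < +oo)%E by exact: lebesgue_itv_fin.
have bS y : bmeasR (fun x => cabs2 (S (x + y))) by apply: bmeas_cabs2; exact: bmeas_freq_poly_shift.
have bS2 y : bmeasR (fun x => 2 * cabs2 (S (x + y))).
  by apply: bmeasRM; [exact: bmeasR_cst|exact: bS].
(* N varies with x; summing over all its possible values gives a majorant that can be integrated
   term by term. *)
pose h x := \sum_(k < M.+1) 2 * cabs2 (S (x + k%:R * p)).
have bsum : bmeasR h by exact: bmeasR_sum.
have bh : bmeasR (fun x => 2 * cabs2 (S (x + 0)) + h x) by exact: bmeasRD.
apply: (@le_trans _ _ (\int[mu]_(x in `[0%R, p[) (2 * cabs2 (S (x + 0)) + h x))%R).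
  apply: le_nrm_int => //; first exact: bmeas_periodization.
  move=> x; rewrite /= in_itv/= => /andP[x0 _].
  have [N [NM _ _ ->]] := periodization_resolvent J c s x0.
  rewrite cabs2M cabs2C -/d -/S.
  have e1 : expR (2 * pi * w * x) ^+ 2 <= 1.
    rewrite expr_le1// ?expR_ge0// -[leRHS]expR0 ler_expR.
    by rewrite mulr_le0_ge0// pmulr_rle0 ?(ltW w0)// mulr_gt0// pi_gt0.
  apply: (@le_trans _ _ (cabs2 (S x - (r ^+ N)%:C * S (x + N%:R * p)))).
    by rewrite -[leRHS]mul1r ler_wpM2r// cabs2_ge0.
  apply: le_trans (cabs2B_le _ _) _; rewrite addr0 lerD2l.
  rewrite cabs2M cabs2C /h (bigD1 (Ordinal (NM : (N < M.+1)%N)))//= -[leLHS]addr0.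
  apply: lerD.
    rewrite ler_wpM2l// -[leRHS]mul1r ler_wpM2r ?cabs2_ge0//.
    by rewrite -exprM exprn_ile1 ?(ltW r0) ?(ltW r1).
  by apply: sumr_ge0 => k _; rewrite mulr_ge0 ?cabs2_ge0.
have HI y : (\int[mu]_(x in `[0%R, p[) (2 * cabs2 (S (x + y))))%R <= 2 * (num_turns%:R * be * \sum_(j < J) cabs2 (d j)).
  rewrite RintegralZl//; last exact: bmeasR_integrable.
  by rewrite ler_wpM2l//; exact: nrm_p_freq_poly.
rewrite RintegralD//; [|exact: bmeasR_integrable|exact: bmeasR_integrable].
rewrite Rintegral_sum//.
have dsum : \sum_(j < J) cabs2 (d j) <= (\sum_(j < J) cabs2 (c j)) / (1 - r) ^+ 2.
  by rewrite mulr_suml; apply: ler_sum => j _; exact: resolvent_le.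
apply: (@le_trans _ _ (2 * (num_turns%:R * be * \sum_(j < J) cabs2 (d j)) +
    \sum_(k < M.+1) 2 * (num_turns%:R * be * \sum_(j < J) cabs2 (d j)))).
  by apply: lerD => //; apply: ler_sum => k _.
rewrite sumr_const card_ord -[X in _ + X]mulr_natl.
rewrite (_ : _ + _ = (2 + 2 * M.+1%:R) * (num_turns%:R * be) * \sum_(j < J) cabs2 (d j)); last by ring.
rewrite /upper_const -[leRHS]mulrA [_^-1 * _]mulrC; apply: ler_wpM2l => //.
by rewrite mulr_ge0// ?mulr_ge0 ?(ltW be0)// addr_ge0// mulr_ge0.
Qed.
End Bounds.

(** * Iterating an inequality along variable steps *)

Section Iterate.
Context {R : realType}.
Local Notation mu := (@lebesgue_measure R).

(** Convexity of the square with weights 1 - rho and rho, applied to a / (1 - rho) and v. Unlike the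
    bound with factors 2, it keeps a factor below 1 in front of v, so it can be iterated. *)
Lemma cabs2_convex (a v : R[i]) (rho : R) : 0 <= rho -> rho < 1 ->
  cabs2 (a + rho%:C * v) <= cabs2 a / (1 - rho) + rho * cabs2 v.
Proof.
move=> h0 h1; have d0 : 0 < 1 - rho by rewrite subr_gt0.
have main (x y : R) : (x + rho * y) ^+ 2 <= x ^+ 2 / (1 - rho) + rho * y ^+ 2.
  rewrite -(ler_pM2r d0) mulrDl divfK ?gt_eqF// -subr_ge0.
  have -> : x ^+ 2 + rho * y ^+ 2 * (1 - rho) - (x + rho * y) ^+ 2 * (1 - rho) =
    rho * (x - (1 - rho) * y) ^+ 2 by ring.
  by rewrite mulr_ge0 ?sqr_ge0.
rewrite /cabs2 ReD ImD ReM ImM /= !mul0r subr0 addr0 mulrDl mulrDr.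
have := main (complex.Re a) (complex.Re v); have := main (complex.Im a) (complex.Im v).
lra.
Qed.

(** The step N >= 1 depends on the point, hence strong induction on J. The indices jumped over only
    add nonnegative terms, which yields one sum valid for every sequence of steps. *)
Lemma iterate_bound (V H : R -> R) (p r U : R) : 0 <= r -> r <= 1 ->
  (forall x, V x <= U) -> 0 <= U -> (forall x, 0 <= H x) ->
  (forall x, exists2 N, (0 < N)%N & V x <= H x + r ^+ N * V (x + N%:R * p)) ->
  forall J x, V x <= \sum_(j < J) r ^+ j * H (x + j%:R * p) + r ^+ J * U.
Proof.
move=> r0 r1 VU U0 H0 HV J; have [n] := ubnP J; elim: n J => // n ih [|J].
  by move=> _ x; rewrite big_ord0 expr0 mul1r add0r.
rewrite ltnS => Jn x; have [N N0 HN] := HV x.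
have [NJ|NJ] := leqP N J.+1; last first.
  apply: (le_trans HN); rewrite big_ord_recl/= expr0 mul1r mul0r addr0 -addrA lerD2l.
  apply: (@le_trans _ _ (r ^+ J.+1 * U)); last first.
    by rewrite lerDr sumr_ge0// => j _; rewrite mulr_ge0// exprn_ge0.
  apply: (@le_trans _ _ (r ^+ N * U)); first by rewrite ler_wpM2l// exprn_ge0.
  by rewrite ler_wpM2r// ler_wiXn2l// ltnW.
have := ih (J.+1 - N)%N _ (x + N%:R * p).
have JN : (J.+1 - N < n)%N by rewrite -(prednK N0) subSS (leq_ltn_trans (leq_subr _ _)).
move=> /(_ JN) HI; apply: (le_trans HN).
have rN : 0 <= r ^+ N by rewrite exprn_ge0.
apply: le_trans (lerD (lexx _) (ler_wpM2l rN HI)) _.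
rewrite mulrDr mulrA -exprD subnKC// addrA lerD2r.
rewrite -(big_mkord xpredT (fun j => r ^+ j * H (x + j%:R * p))).
rewrite (@big_cat_nat _ _ _ N)//= big_mkord.
apply: lerD.
  rewrite (bigD1 (Ordinal N0))//= expr0 mul1r mul0r addr0 lerDl.
  by rewrite sumr_ge0// => j _; rewrite mulr_ge0// exprn_ge0.
rewrite -[leRHS]/(\sum_(0 + N <= i < J.+1) r ^+ i * H (x + i%:R * p)) big_addn big_mkord mulr_sumr le_eqVlt; apply/orP; left; apply/eqP.
apply: eq_bigr => j _; rewrite mulrA -exprD [(N + j)%N]addnC natrD.
by congr (_ * H _); ring.
Qed.

(** Every translate of H has the same integral over a period, so the sum is geometric, and the term
    with [U] disappears as J grows. The bound [U] therefore leaves no trace in the conclusion. *)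
Lemma integral_iterate (V H : R -> R) (be p r U : R) : 0 < be -> 0 <= r -> r < 1 ->
  bmeasR V -> bmeasR H -> (forall x, H (x + be) = H x) ->
  (forall x, V x <= U) -> 0 <= U -> (forall x, 0 <= H x) ->
  (forall x, exists2 N, (0 < N)%N & V x <= H x + r ^+ N * V (x + N%:R * p)) ->
  (\int[mu]_(x in `[0, be[) V x <= (\int[mu]_(x in `[0, be[) H x) / (1 - r))%R.
Proof.
move=> be0 r0 r1 bV bH Hp VU U0 H0 HV.
set I := (\int[mu]_(x in _) H x)%R.
have I0 : 0 <= I by apply: Rintegral_ge0.
have d0 : 0 < 1 - r by rewrite subr_gt0.
have mD : measurable (`[0, be[%classic : set R) by exact: measurable_itv.
have fD : (mu `[0%R, be[%classic < +oo)%E by exact: lebesgue_itv_fin.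
have muD : fine (mu `[0, be[%classic) = be by rewrite lebesgue_measure_itv/= lte_fin be0 -EFinB/= subr0.
have step J : (\int[mu]_(x in `[0, be[) V x <= I / (1 - r) + (U * be) * r ^+ J)%R.
  have bs j : bmeasR (fun x => r ^+ j * H (x + j%:R * p)).
    by apply: bmeasRM; [exact: bmeasR_cst|exact: bmeasR_shift].
  have bS : bmeasR (fun x => \sum_(j < J) r ^+ j * H (x + j%:R * p)).
    by apply: bmeasR_sum => j; exact: bs.
  apply: (@le_trans _ _ (\int[mu]_(x in `[0, be[) (\sum_(j < J) r ^+ j * H (x + j%:R * p) + r ^+ J * U))%R).
    apply: le_Rintegral => //; first exact: bmeasR_integrable.
      by apply: bmeasR_integrable => //; apply: bmeasRD => //; exact: bmeasR_cst.
    by move=> x _; apply: iterate_bound => //; exact: ltW.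
  rewrite RintegralD//; [|exact: bmeasR_integrable|by apply: bmeasR_integrable => //; exact: bmeasR_cst].
  apply: lerD; last first.
    rewrite Rintegral_cst// muD.
    by rewrite le_eqVlt; apply/orP; left; apply/eqP; ring.
  rewrite Rintegral_sum; last by move=> j; exact: bs.
  rewrite (eq_bigr (fun j : 'I_J => r ^+ j * I)); last first.
    move=> j _; rewrite RintegralZl//; last by apply: bmeasR_integrable => //; exact: bmeasR_shift.
    by rewrite Rintegral_periodic.
  rewrite -mulr_suml mulrC ler_wpM2l// -[leRHS]mul1r ler_pdivlMr//.
  have := subrX1 r J; have : 0 <= r ^+ J by rewrite exprn_ge0.
  move: (r ^+ J) => z z0 Hz.
  suff -> : (\sum_(i < J) r ^+ i) * (1 - r) = 1 - z by lra.
  by rewrite -[RHS]opprB Hz; ring.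
apply/ler_addgt0Pr => e e0.
have r1' : `|r| < 1 by rewrite ger0_norm.
have : U * be * r ^+ J @[J --> \oo] --> U * be * 0.
  by apply: cvgMl_tmp; exact: cvg_expr.
rewrite mulr0.
move=> /cvgrPdist_le /(_ e e0) [J _ /(_ J (leqnn J))]; rewrite sub0r normrN => HJ.
by apply: le_trans (step J) _; rewrite lerD2l (le_trans (ler_norm _)).
Qed.
End Iterate.

(** * Lower bound for the periodizations when [be] is at most min(p, b) *)

Section Lower.
Context {R : realType}.
Local Notation C := R[i].
Local Notation mu := (@lebesgue_measure R).
Variables b w : R.
Hypotheses (b0 : 0 < b) (w0 : w < 0).
Variables al be : R.
Hypotheses (al0 : 0 < al) (be0 : 0 < be) (be_b : be <= b) (be_al : al * be <= 1).
Let p : R := al^-1.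
Let p0 : 0 < p. Proof. by rewrite invr_gt0. Qed.
Let r : R := decay w al.
Let r0 : 0 < r. Proof. exact: expR_gt0. Qed.
Let r1 : r < 1.
Proof.
by rewrite /r /decay -expR0 ltr_expR pmulr_llt0// pmulr_rlt0// mulr_gt0// pi_gt0.
Qed.
Let be_p : be <= p.
Proof. by rewrite /p -[al^-1]mul1r ler_pdivlMr// mulrC. Qed.

(** The frequencies are spaced by 1 / be, so all terms pick up the same phase; in particular the
    squared modulus is periodic. *)
Lemma freq_poly_quasiperiodic J d s x : freq_poly be J d s (x + be) = e2pi (- s * be) * freq_poly be J d s x.
Proof.
rewrite /freq_poly mulr_sumr; apply: eq_bigr => j _.
rewrite mulrCA -e2piD; congr (_ * _).
rewrite (_ : - (s + _) * _ = - s * be + - (s + j%:R / be) * x + - (j%:Z%:~R)); last first.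
  have -> : (j%:Z%:~R : R) = j%:R by [].
  by field; rewrite gt_eqF.
by rewrite [in LHS]e2piD -rmorphN/= e2pi_int mulr1.
Qed.

Let E : R := expR (2 * pi * w * be) ^+ 2.
Let E0 : 0 < E. Proof. by rewrite exprn_gt0// expR_gt0. Qed.
(** [E] bounds the squared exponential weight from below on a period; one factor 1 - r comes from
    [cabs2_convex], the other from the geometric series, 4 from [resolvent_ge] and [be] from
    [freq_poly_nrm]. *)
Definition lower_const : R := be * E * (1 - r) ^+ 2 / 4.

Lemma lower_const_gt0 : 0 < lower_const.
Proof.
have r2 : 0 < (1 - r) ^+ 2 by rewrite exprn_gt0// subr_gt0.
by rewrite /lower_const divr_gt0// mulr_gt0// mulr_gt0.
Qed.

Lemma nrm_periodization_lower J (c : nat -> C) s : lower_const * \sum_(j < J) cabs2 (c j) <= nrm p (periodization b w al be J c s).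
Proof.
pose d := resolvent w al be c s; pose S := freq_poly be J d s; pose H := periodization b w al be J c s.
have bHc : bmeas H by exact: bmeas_periodization.
have bS : bmeas S by exact: bmeas_freq_poly.
have dr : 0 < 1 - r by rewrite subr_gt0.
have [_ [U HU]] := bS.
have U0 : 0 <= U by apply: le_trans (HU 0); exact: cabs2_ge0.
(* H is not periodic; [wrap] extends its values on [0, be) periodically, as [integral_iterate]
   requires. *)
pose G x := cabs2 (H (wrap be x)) * (E * (1 - r))^-1.
have G0 x : 0 <= G x by rewrite mulr_ge0 ?cabs2_ge0// invr_ge0 mulr_ge0 ?ltW.
have bG : bmeasR G.
  apply: bmeasRM; last exact: bmeasR_cst.
  by apply: bmeas_cabs2; apply: bmeas_comp => //; exact: measurable_wrap.
have Sp x : cabs2 (S (x + be)) = cabs2 (S x).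
  by rewrite /S freq_poly_quasiperiodic cabs2M cabs2_e2pi mul1r.
have step x : exists2 N, (0 < N)%N & cabs2 (S x) <= G x + r ^+ N * cabs2 (S (x + N%:R * p)).
  have /andP[x0 xb] := wrap_itv be0 x.
  have [N [_ N0 _ HN]] := periodization_resolvent b w0 be al0 J c s x0.
  (* Here be <= b enters: every point of a period lies in the window, so each relation advances by
     at least one step. *)
  have {}N0 : (0 < N)%N by rewrite N0 (lt_le_trans xb).
  exists N => //.
  rewrite (periodic_wrap (h := fun x => cabs2 (S x)) Sp).
  have -> : cabs2 (S (x + N%:R * p)) = cabs2 (S (wrap be x + N%:R * p)).
    have [m {1}->] := wrapE be x; rewrite -addrA [m%:~R * be + _]addrC addrA.
    exact: (periodicz (h := fun x => cabs2 (S x)) Sp).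
  move: x0 xb HN; rewrite /G; move: (wrap be x) => y y0 yb HN.
  pose e := expR (2 * pi * w * y).
  have e0 : 0 < e by exact: expR_gt0.
  have rN : r ^+ N <= r by rewrite -(prednK N0) exprS -[leRHS]mulr1 ler_pM2l// exprn_ile1 ?ltW.
  have -> : S y = H y / e%:C + (r ^+ N)%:C * S (y + N%:R * p).
    rewrite /H HN -/e -/d -/S; field.
    by rewrite fmorph_eq0 gt_eqF.
  apply: le_trans (cabs2_convex _ _ _ _) _; first by rewrite exprn_ge0// ltW.
    by rewrite (le_lt_trans rN).
  rewrite lerD2r cabs2M cabs2V cabs2C -mulrA -invfM ler_wpM2l ?cabs2_ge0//.
  rewrite lef_pV2 ?posrE ?mulr_gt0 ?exprn_gt0 ?expR_gt0// ?subr_gt0 ?(le_lt_trans rN)//.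
  apply: ler_pM; [exact: ltW|exact: ltW| |by rewrite lerD2l lerN2].
  rewrite /E ler_sqr ?nnegrE ?expR_ge0// ler_expR.
  by rewrite ler_wnM2l ?(ltW yb)// pmulr_rle0 ?(ltW w0)// mulr_gt0// pi_gt0.
have Gp x : G (x + be) = G x by rewrite /G wrapD.
have main := @integral_iterate _ (fun x => cabs2 (S x)) G be p r U be0 (ltW r0) r1
  (bmeas_cabs2 bS) bG Gp HU U0 G0 step.
have IV : (\int[mu]_(x in `[0%R, be[) cabs2 (S x))%R = be * \sum_(j < J) cabs2 (d j).
  rewrite -(freq_poly_nrm be0 J d s 0); apply: eq_Rintegral => x _.
  by rewrite addr0.
have bH2 := bmeas_cabs2 bHc.
have IG : (\int[mu]_(x in `[0%R, be[) G x)%R <= nrm p H / (E * (1 - r)).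
  have -> : (\int[mu]_(x in `[0%R, be[) G x)%R = (\int[mu]_(x in `[0%R, be[) cabs2 (H x))%R / (E * (1 - r)).
    transitivity (\int[mu]_(x in `[0%R, be[) (cabs2 (H x) / (E * (1 - r))))%R.
      by apply: eq_Rintegral => x; rewrite inE/= in_itv/= => /andP[x0 xb]; rewrite /G wrap_id.
    move: (E * (1 - r))^-1 => k.
    have iH : mu.-integrable `[0%R, be[ (EFin \o (fun x => cabs2 (H x))).
      by apply: bmeasR_integrable => //; exact: lebesgue_itv_fin.
    by rewrite RintegralZr.
  apply: ler_wpM2r; first by rewrite invr_ge0 mulr_ge0 ?ltW.
  (* Here al * be <= 1 enters: the whole period [0, be) lies in [0, p), where the norm of H is
     taken. *)
  rewrite /nrm (@Rintegral_itv_cat _ 0 be p)//; last exact: ltW.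
  by rewrite lerDl; apply: Rintegral_ge0 => x _; exact: cabs2_ge0.
rewrite IV in main.
have dsum : (\sum_(j < J) cabs2 (c j)) / 4 <= \sum_(j < J) cabs2 (d j).
  by rewrite mulr_suml; apply: ler_sum => j _; exact: resolvent_ge.
have : be * \sum_(j < J) cabs2 (d j) <= nrm p H / (E * (1 - r)) / (1 - r).
  by apply: (le_trans main); rewrite ler_wpM2r// invr_ge0 ltW.
rewrite -mulrA -invfM ler_pdivlMr; last by rewrite mulr_gt0// mulr_gt0.
apply: le_trans; rewrite /lower_const.
rewrite (_ : _ * _ / 4 * _ = (be * (E * (1 - r) * (1 - r))) * ((\sum_(j < J) cabs2 (c j)) / 4)); last by ring.
rewrite [leRHS]mulrAC; apply: ler_wpM2l => //.
by rewrite ltW// mulr_gt0// mulr_gt0// mulr_gt0.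
Qed.
End Lower.

(** * Fibers of the frame operator *)

Section EsumInt.
Context {R : realType}.
Local Notation mu := (@lebesgue_measure R).

(** An enumeration of the integers, used to transfer measurability and monotone convergence from
    series to sums over [int]. *)
Definition int_of_nat (n : nat) : int := if odd n then Negz n./2 else Posz n./2.

Lemma int_of_nat_bij : set_bij [set: nat] [set: int] int_of_nat.
Proof.
split => //.
- move=> i j _ _; rewrite /int_of_nat => h.
  rewrite -(odd_double_half i) -(odd_double_half j).
  by move: h; case: (odd i); case: (odd j) => // -[->].
- move=> [n|n] _ /=.
    by exists n.*2 => //; rewrite /int_of_nat odd_double doubleK.
  by exists n.*2.+1 => //; rewrite /int_of_nat /= odd_double /= uphalf_double.
Qed.

Lemma esum_int_series (a : int -> \bar R) : (forall n, 0 <= a n)%E ->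
  (\esum_(n in [set: int]) a n = \sum_(i <oo) a (int_of_nat i))%E.
Proof.
move=> a0; rewrite (reindex_esum [set: nat] [set: int] int_of_nat)//; last exact: int_of_nat_bij.
by rewrite nneseries_esumT.
Qed.

Lemma measurable_esum_int (a : int -> R -> R) :
  (forall n, measurable_fun setT (a n)) -> (forall n x, 0 <= a n x) ->
  measurable_fun [set: R] (fun x => \esum_(n in [set: int]) (a n x)%:E)%E.
Proof.
move=> ma a0; rewrite (_ : (fun x => _) = (fun x => \sum_(i <oo) (a (int_of_nat i) x)%:E)%E); last first.
  by apply/funext => x; rewrite esum_int_series// => n; rewrite lee_fin.
apply: ge0_emeasurable_sum => //.
  by move=> i x _ _; rewrite lee_fin.
by move=> i _; apply/measurable_EFinP.
Qed.

Lemma integral_esum_int (D : set R) (a : int -> R -> R) : measurable D ->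
  (forall n, measurable_fun setT (a n)) -> (forall n x, 0 <= a n x) ->
  (\esum_(n in [set: int]) \int[mu]_(x in D) (a n x)%:E =
   \int[mu]_(x in D) \esum_(n in [set: int]) (a n x)%:E)%E.
Proof.
move=> mD ma a0; rewrite esum_int_series; last by move=> n; apply: integral_ge0 => x _; rewrite lee_fin.
rewrite -integral_nneseries//.
- by apply: eq_integral => x _; rewrite esum_int_series// => n; rewrite lee_fin.
- by move=> n; apply/measurable_EFinP; apply: (@measurable_funTS _ _ _ _ D (a _)); exact: ma.
- by move=> n x _; rewrite lee_fin.
Qed.

Lemma esum_pair_swap (a : int * int -> \bar R) : (forall x, 0 <= a x)%E ->
  (\esum_(mn in [set: int * int]) a mn =
   \esum_(n in [set: int]) \esum_(m in [set: int]) a (m, n))%E.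
Proof.
move=> a0; rewrite (@esum_esum _ _ _ setT (fun=> setT))//.
rewrite (reindex_esum [set: int * int] setT (fun x => (x.2, x.1))).
  by congr esum; apply/seteqP; split.
split => //=; first by move=> [i1 i2] [j1 j2] /= _ _ [] -> ->.
by move=> [i1 i2] _ /=; exists (i2, i1).
Qed.
End EsumInt.

Section GsincMeas.
Context {R : realType}.
Local Notation C := R[i].
Variables b w : R.
Hypotheses (b0 : 0 < b) (w0 : w < 0).

(** On the line Im = -w the sine is a combination of two exponentials of constant modulus, and the
    denominator satisfies |t - iw|^2 >= w^2 > 0. *)
Lemma bmeas_gsinc : bmeas (gsinc b w).
Proof.
have wn : w != 0 by rewrite lt_eqF.
have binv : bmeas (fun t : R => (t%:C - 'i * w%:C : C)^-1).
  have c2 (t : R) : cabs2 (t%:C - 'i * w%:C) = t ^+ 2 + w ^+ 2.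
    by rewrite /cabs2 ReD ImD ReN ImN ReM ImM /=; ring.
  have w2 : 0 < w ^+ 2 by rewrite exprn_even_gt0.
  have c2p (t : R) : 0 < t ^+ 2 + w ^+ 2 by rewrite ltr_wpDl ?sqr_ge0.
  split; last first.
    exists (w ^+ 2)^-1 => t; rewrite cabs2V c2 lef_pV2 ?posrE//.
    by rewrite lerDr sqr_ge0.
  have E (t : R) : (t%:C - 'i * w%:C : C)^-1 = conjc (t%:C - 'i * w%:C) * ((t ^+ 2 + w ^+ 2)^-1)%:C.
    have zn : t%:C - 'i * w%:C != 0 by rewrite -cabs2_eq0 c2 gt_eqF.
    apply: (mulfI zn); rewrite mulfV// mulrA -cabs2E c2 -RtoCM mulfV// gt_eqF//.
  under eq_fun do rewrite E.
  apply: cmeasurableM; first apply: cmeasurableJ.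
    apply: cmeasurableD; last exact: cmeasurable_cst.
    exact: cmeasurableC.
  apply: cmeasurableC; apply: continuous_measurable_fun => t.
  apply: cvgV; first by rewrite gt_eqF.
  by apply: cvgD; [apply: exprn_continuous|exact: cvg_cst].
have e1 (t : R) : cexp ('i * ((pi * b)%:C * (t%:C - 'i * w%:C))) = (expR (pi * b * w))%:C * e2pi (b / 2 * t).
  rewrite /e2pi -cexpC -cexpD; congr cexp.
  by apply: complexP; rewrite ?ReD ?ImD ?ReM ?ImM ?ReD ?ImD ?ReN ?ImN ?ReM ?ImM /=; field.
have e2 (t : R) : cexp (- ('i * ((pi * b)%:C * (t%:C - 'i * w%:C)))) = (expR (- (pi * b * w)))%:C * e2pi (- (b / 2) * t).
  rewrite /e2pi -cexpC -cexpD; congr cexp.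
  by apply: complexP; rewrite ?ReN ?ImN ?ReD ?ImD ?ReM ?ImM ?ReD ?ImD ?ReN ?ImN ?ReM ?ImM /=; field.
rewrite /gsinc /csin.
under eq_fun do rewrite e1 e2.
apply: bmeasM => //; apply: bmeasM; last exact: bmeas_cst.
apply: bmeasB; (apply: bmeasM; [exact: bmeas_cst|exact: bmeas_e2piM]).
Qed.
End GsincMeas.

Section Fiber.
Context {R : realType}.
Local Notation C := R[i].
Local Notation mu := (@lebesgue_measure R).
Variables b w : R.
Hypotheses (b0 : 0 < b) (w0 : w < 0).
Variables al be : R.
Hypotheses (al0 : 0 < al) (be0 : 0 < be).
Let P : R := be^-1.
Let P0 : 0 < P. Proof. by rewrite invr_gt0. Qed.

Lemma inner_tfshift (f : R -> C) (m n : int) :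
  inner f (tfshift (al * n%:~R) (be * m%:~R) (gsinc b w)) =
  cint setT (fun t => f t * conjc (gsinc b w (t - al * n%:~R)) * e2pi (- (be * m%:~R) * t)).
Proof.
rewrite /inner cintegralE; apply: eq_cint => t _; rewrite conjE /tfshift.
rewrite conjcM mulrA mulrAC; congr (_ * _).
rewrite (_ : cexp _ = e2pi (be * m%:~R * t)); last by rewrite /e2pi !mulrA.
by rewrite e2piJ mulNr.
Qed.

Variables (f : R -> C) (K : nat).
Hypotheses (bf : bmeas f) (f0 : forall t, ~~ (- (K%:R * P) <= t < K%:R * P) -> f t = 0).
Let J := (K + K)%N.
Let sh (t : R) : R := t - K%:R * P.
(** For t in [0, P) the indices j < 2K run through all points of the support interval congruent to t
    modulo P; [sh] moves the first of them to its left end. *)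
Definition fiber_coef (t : R) (j : nat) : C := f (sh t + j%:R * P).

Lemma setT_split (h : R -> \bar R) : measurable_fun setT h -> (forall x, 0 <= h x)%E ->
  (forall t, ~~ (- (K%:R * P) <= t < K%:R * P) -> h t = 0%E) ->
  (\int[mu]_x h x = \int[mu]_(t in `[0%R, P[) \sum_(j < J) h (sh t + j%:R * P)%R)%E.
Proof.
move=> mh h0 hz.
rewrite ge0_integral_sum//; last first.
  by move=> j; apply: measurable_funTS; apply: (measurableT_comp mh); apply: measurable_funD => //; exact: measurable_funB.
transitivity (\int[mu]_(x in `[(- (K%:R * P))%R, (- (K%:R * P) + J%:R * P)%R[) h x)%E.
  rewrite [RHS]integral_mkcond; apply: eq_integral => x _.
  rewrite patchE; case: ifPn => // xn; apply: hz; apply: contra xn => xn.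
  rewrite inE/= in_itv/= natrD mulrDl addrA addNr add0r//.
rewrite ge0_integral_split//; last exact: ltW.
by apply: eq_bigr => j _; apply: eq_integral => x _; congr h; rewrite /sh addrA.
Qed.

Lemma cint_setT_split (h : R -> C) : bmeas h ->
  (forall t, ~~ (- (K%:R * P) <= t < K%:R * P) -> h t = 0) ->
  cint setT h = cint `[0, P[ (fun t => \sum_(j < J) h (sh t + j%:R * P)).
Proof.
move=> bh hz.
have bhs : bmeas (fun t => h (t - K%:R * P)) by exact: bmeas_shift.
rewrite cint_sum//; last first.
  move=> j; apply: bmeas_cintegrable => //; first exact: lebesgue_itv_fin.
  exact: (bmeas_comp bh (measurable_funD (measurable_shift _) (measurable_cst _))).
transitivity (cint `[0, J%:R * P[ (fun t => h (t - K%:R * P))); last first.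
  rewrite cint_split//; last exact: ltW.
  by apply: eq_bigr => j _; apply: eq_cint => t _; rewrite /sh addrAC.
transitivity (cint `[- (K%:R * P), K%:R * P[ h).
  have aux (g : R -> R) : (forall t, ~~ (- (K%:R * P) <= t < K%:R * P) -> g t = 0) ->
      (\int[mu]_x g x = \int[mu]_(x in `[(- (K%:R * P))%R, (K%:R * P)%R[) g x)%R.
    move=> gz; rewrite [RHS]Rintegral_mkcond; apply: eq_Rintegral => x _.
    rewrite patchE; case: ifPn => // xn; apply: gz; apply: contra xn => xn.
    by rewrite inE/= in_itv/=.
  by rewrite /cint aux ?[X in _ +i* X = _]aux// => t /hz ->.
have aux2 (g : R -> R) : bmeasR g ->
    (\int[mu]_(x in `[(- (K%:R * P))%R, (K%:R * P)%R[) g x =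
     \int[mu]_(t in `[0, J%:R * P[) g (t - K%:R * P))%R.
  move=> bg; rewrite Rintegral_shift// add0r (_ : J%:R * P - K%:R * P = K%:R * P)//.
  by rewrite /J natrD; ring.
by rewrite /cint aux2 ?aux2//; [exact: bmeas_Im|exact: bmeas_Re].
Qed.
Lemma bmeas_fiber_coef j : bmeas (fun t => fiber_coef t j).
Proof. exact: (bmeas_comp bf (measurable_funD (measurable_shift _) (measurable_cst _))). Qed.

Definition fiber_sample (n : int) (t : R) : C := window_sample b w al be J (fiber_coef t) (sh t) n.

Lemma bmeas_fiber_sample n : bmeas (fiber_sample n).
Proof.
apply: bmeas_sum => j; apply: bmeasM; first exact: bmeas_fiber_coef.
apply: bmeasJ; apply: (bmeas_comp (bmeas_gsinc b w0)).
apply: measurable_funB => //; apply: measurable_funD => //; exact: measurable_shift.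
Qed.

(** The modulation e(-be m t) is invariant under translation by P because be P = 1, so it factors
    out of the sum over the fiber and acts as a Fourier mode on [0, P). *)
Lemma coeff_fiber_sample m n : inner f (tfshift (al * n%:~R) (be * m%:~R) (gsinc b w)) =
  ip P (fiber_sample n) (fourier_mode P m).
Proof.
rewrite inner_tfshift cint_setT_split; last 2 first.
- apply: bmeasM; last exact: bmeas_e2piM.
  apply: bmeasM => //; apply: bmeasJ; apply: (bmeas_shift (f := gsinc b w)).
  exact: bmeas_gsinc.
- by move=> t /f0 ->; rewrite !mul0r.
apply: eq_cint => t _; rewrite /fiber_sample /window_sample mulr_suml; apply: eq_bigr => j _.
rewrite /fiber_coef -/P; congr (_ * _); rewrite /fourier_mode e2piJ invrK.
have -> : - (be * m%:~R) * (sh t + j%:R * P) = - (m%:~R * be * t) + (m * (K%:Z - j%:Z))%:~R.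
  have -> : (m * (K%:Z - j%:Z))%:~R = m%:~R * (K%:R - j%:R) :> R by rewrite intrM rmorphB.
  by rewrite /sh /P; field; rewrite gt_eqF.
by rewrite e2piD e2pi_int mulr1.
Qed.

(** For each n, Parseval on [0, P) sums over the modulations and yields the factor P. Monotone
    convergence then brings the sum over n inside the integral, where [esum_window_sample] applies
    at each t. *)
Theorem frame_coefs_fiber :
  (\esum_(mn in [set: int * int])
     (cabs2 (inner f (tfshift (al * mn.2%:~R) (be * mn.1%:~R) (gsinc b w))))%:E =
   P%:E * \int[mu]_(t in `[0%R, P[)
      (kappa b w ^+ 2 * al^-1 * nrm al^-1 (periodization b w al be J (twist b be J (fiber_coef t) (sh t)) (sh t)))%:E)%E.
Proof.
rewrite esum_pair_swap; last by move=> x; rewrite lee_fin cabs2_ge0.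
transitivity (\esum_(n in [set: int]) (P * nrm P (fiber_sample n))%:E)%E.
  apply: eq_esum => n _; rewrite -(parseval P0 (bmeas_fiber_sample n)).
  by apply: eq_esum => m _; rewrite coeff_fiber_sample.
rewrite esumZl//; congr (_ * _)%E.
have mD : measurable (`[0, P[%classic : set R) by exact: measurable_itv.
have fD : (mu `[0%R, P[%classic < +oo)%E by exact: lebesgue_itv_fin.
transitivity (\esum_(n in [set: int]) \int[mu]_(t in `[0%R, P[) (cabs2 (fiber_sample n t))%:E)%E.
  apply: eq_esum => n _; rewrite /nrm /Rintegral fineK//.
  by apply: integrable_fin_num => //; apply: bmeasR_integrable => //; apply: bmeas_cabs2; exact: bmeas_fiber_sample.
rewrite integral_esum_int//.
- by apply: eq_integral => t _; rewrite -esum_window_sample.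
- by move=> n; case: (bmeas_cabs2 (bmeas_fiber_sample n)).
- by move=> n x; exact: cabs2_ge0.
Qed.

(** Measurability in t is read off from the equal sum of squared samples, avoiding measurability of
    a parametric integral. *)
Lemma measurable_fiber : measurable_fun setT (fun t =>
      (kappa b w ^+ 2 * al^-1 * nrm al^-1 (periodization b w al be J (twist b be J (fiber_coef t) (sh t)) (sh t)))%:E).
Proof.
rewrite (_ : (fun t => _) = (fun t => \esum_(n in [set: int]) (cabs2 (fiber_sample n t))%:E)%E); last first.
  by apply/funext => t; rewrite -esum_window_sample.
apply: measurable_esum_int.
- by move=> n; case: (bmeas_cabs2 (bmeas_fiber_sample n)).
- by move=> n x; exact: cabs2_ge0.
Qed.

Lemma L2norm2_fiber : (L2norm2 f = \int[mu]_(t in `[0%R, P[) (\sum_(j < J) cabs2 (fiber_coef t j))%:E)%E.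
Proof.
rewrite /L2norm2 setT_split.
- by apply: eq_integral => t _; rewrite sumEFin.
- by apply/measurable_EFinP; case: (bmeas_cabs2 bf).
- by move=> x; rewrite lee_fin cabs2_ge0.
- by move=> t /f0 ->; rewrite cabs20.
Qed.

Lemma measurable_L2norm2_fiber : measurable_fun setT (fun t => (\sum_(j < J) cabs2 (fiber_coef t j))%:E).
Proof.
apply/measurable_EFinP.
have [] // : bmeasR (fun t => \sum_(j < J) cabs2 (fiber_coef t j)).
by apply: bmeasR_sum => j; apply: bmeas_cabs2; exact: bmeas_fiber_coef.
Qed.
End Fiber.

(** * Sufficiency *)

Section L2Tools.
Context {R : realType}.
Local Notation C := R[i].
Local Notation mu := (@lebesgue_measure R).
Implicit Types f g : R -> C.

Lemma L2_integrable f : L2 f -> mu.-integrable setT (EFin \o (fun t => cabs2 (f t))).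
Proof.
move=> [mf ff]; apply/integrableP; split.
  by apply/measurable_EFinP; exact: cmeasurable_cabs2.
apply: le_lt_trans ff; rewrite /L2norm2 le_eqVlt; apply/orP; left; apply/eqP.
by apply: eq_integral => t _; rewrite /= ger0_norm// cabs2_ge0.
Qed.

Lemma ReM_le (u v : C) : `|complex.Re (u * conjc v)| <= cabs2 u + cabs2 v.
Proof.
rewrite ReM ReJ ImJ /cabs2.
move: (complex.Re u) (complex.Im u) (complex.Re v) (complex.Im v) => x y z t.
have h1 := sqr_ge0 (x - z); have h2 := sqr_ge0 (y - t); have h3 := sqr_ge0 (x + z); have h4 := sqr_ge0 (y + t).
have := sqr_ge0 x; have := sqr_ge0 y; have := sqr_ge0 z; have := sqr_ge0 t => *.
rewrite ler_norml; apply/andP; split; nra.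
Qed.
Lemma ImM_le (u v : C) : `|complex.Im (u * conjc v)| <= cabs2 u + cabs2 v.
Proof.
rewrite ImM ReJ ImJ /cabs2.
move: (complex.Re u) (complex.Im u) (complex.Re v) (complex.Im v) => x y z t.
have h1 := sqr_ge0 (x - t); have h2 := sqr_ge0 (y - z); have h3 := sqr_ge0 (x + t); have h4 := sqr_ge0 (y + z).
have := sqr_ge0 x; have := sqr_ge0 y; have := sqr_ge0 z; have := sqr_ge0 t => *.
rewrite ler_norml; apply/andP; split; nra.
Qed.

Lemma L2_sum_integrable f g : L2 f -> L2 g ->
  mu.-integrable setT (EFin \o (fun t => cabs2 (f t) + cabs2 (g t))).
Proof. by move=> Lf Lg; apply: integrableDR => //; exact: L2_integrable. Qed.

Lemma L2_mul f g : L2 f -> L2 g -> cintegrable setT (fun t => f t * conjc (g t)).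
Proof.
move=> Lf Lg; have ih := L2_sum_integrable Lf Lg.
have [mf _] := Lf; have [mg _] := Lg.
have [m1 m2] := cmeasurableM mf (cmeasurableJ mg).
split; apply: (le_integrable _ _ _ ih) => //; [exact/measurable_EFinP| |exact/measurable_EFinP|];
  move=> t _ /=; rewrite lee_fin (ger0_norm (addr_ge0 (cabs2_ge0 _) (cabs2_ge0 _))).
  exact: ReM_le.
exact: ImM_le.
Qed.

Lemma Rintegral_dom_cvg0 (h : nat -> R -> R) (k : R -> R) :
  (forall n, measurable_fun setT (h n)) -> mu.-integrable setT (EFin \o k) ->
  (forall n x, `|h n x| <= k x) -> (forall x, h n x @[n --> \oo] --> 0) ->
  (\int[mu]_x h n x)%R @[n --> \oo] --> (0 : R).
Proof.
move=> mh ik hk hc.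
have [] := @dominated_convergence _ _ R mu setT measurableT (fun n x => (h n x)%:E) (cst 0%E) (EFin \o k).
- by move=> n; apply/measurable_EFinP; exact: mh.
- exact: measurable_cst.
- by apply: aeW => x _; apply: cvg_EFin; [exact: nearW|exact: hc].
- exact: ik.
- by apply: aeW => x n _; rewrite lee_fin.
move=> _ _; rewrite integral0 => /fine_cvgP[_]; exact.
Qed.

Variable P : R.
Hypothesis P0 : 0 < P.

(** Cutting in both t and |f(t)|^2 makes the truncation bounded with bounded support, as the fiber
    decomposition requires. *)
Definition trunc_set f (N : nat) : set R :=
  `[- (N%:R * P), N%:R * P[%classic `&` [set t | cabs2 (f t) <= N%:R].
Definition trunc f (N : nat) (t : R) : C := f t * (\1_(trunc_set f N) t)%:C.
Definition rest f (N : nat) (t : R) : C := f t - trunc f N t.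

Lemma measurable_trunc_set f N : cmeasurable f -> measurable (trunc_set f N).
Proof.
move=> mf; apply: measurableI => //.
rewrite -[X in measurable X]setTI; have := cmeasurable_cabs2 mf.
move=> H; rewrite (_ : [set t | _] = (fun t => cabs2 (f t)) @^-1` `]-oo, N%:R]%classic).
  by apply: H => //; exact: measurable_itv.
by apply/seteqP; split => t /=; rewrite in_itv.
Qed.

Lemma cmeasurable_trunc f N : cmeasurable f -> cmeasurable (trunc f N).
Proof.
move=> mf; apply: cmeasurableM => //; apply: cmeasurableC; apply: measurable_indic.
exact: measurable_trunc_set.
Qed.
Lemma cmeasurable_rest f N : cmeasurable f -> cmeasurable (rest f N).
Proof.
move=> mf; rewrite /rest; under eq_fun do rewrite -mulN1r.
apply: cmeasurableD => //; apply: cmeasurableM; [exact: cmeasurable_cst|exact: cmeasurable_trunc].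
Qed.

Lemma truncE f N t : trunc f N t = if t \in trunc_set f N then f t else 0.
Proof. by rewrite /trunc indicE; case: ifPn => _; rewrite ?mulr1 ?mulr0. Qed.
Lemma restE f N t : rest f N t = if t \in trunc_set f N then 0 else f t.
Proof. by rewrite /rest truncE; case: ifPn => _; rewrite ?subrr ?subr0. Qed.

Lemma bmeas_trunc f N : cmeasurable f -> bmeas (trunc f N).
Proof.
move=> mf; split; first exact: cmeasurable_trunc.
exists N%:R => t; rewrite truncE; case: ifPn => [|_]; last by rewrite cabs20.
by rewrite inE => -[].
Qed.

Lemma trunc_supp f N t : ~~ (- (N%:R * P) <= t < N%:R * P) -> trunc f N t = 0.
Proof.
move=> H; rewrite truncE ifF//; apply/negbTE; apply: contra H.
by rewrite inE => -[/=]; rewrite in_itv.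
Qed.

(** At each t one of the two parts is zero, so squared norms add up exactly. *)
Lemma trunc_rest f N t : cabs2 (f t) = cabs2 (trunc f N t) + cabs2 (rest f N t).
Proof. by rewrite truncE restE; case: ifPn => _; rewrite cabs20 ?addr0 ?add0r. Qed.

Lemma trunc_le f N t : cabs2 (trunc f N t) <= cabs2 (f t).
Proof. by rewrite (trunc_rest f N t) lerDl cabs2_ge0. Qed.
Lemma rest_le f N t : cabs2 (rest f N t) <= cabs2 (f t).
Proof. by rewrite (trunc_rest f N t) lerDr cabs2_ge0. Qed.

Lemma L2_le f g : cmeasurable g -> L2 f -> (forall t, cabs2 (g t) <= cabs2 (f t)) -> L2 g.
Proof.
move=> mg [mf ff] gf; split => //; apply: le_lt_trans ff.
apply: ge0_le_integral => //.
- by move=> t _; rewrite lee_fin cabs2_ge0.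
- by apply/measurable_EFinP; exact: cmeasurable_cabs2.
- by apply/measurable_EFinP; exact: cmeasurable_cabs2.
- by move=> t _; rewrite lee_fin.
Qed.

Lemma L2_trunc f N : L2 f -> L2 (trunc f N).
Proof.
move=> Lf; apply: (L2_le _ Lf); first by apply: cmeasurable_trunc; case: Lf.
exact: trunc_le.
Qed.
Lemma L2_rest f N : L2 f -> L2 (rest f N).
Proof.
move=> Lf; apply: (L2_le _ Lf); first by apply: cmeasurable_rest; case: Lf.
exact: rest_le.
Qed.

Lemma rest_cvg f t : \forall N \near \oo, rest f N t = 0.
Proof.
pose n0 := (Num.truncn (`|t| / P)).+1; pose n1 := (Num.truncn (cabs2 (f t))).+1.
exists (maxn n0 n1) => // N; rewrite /= geq_max => /andP[h0 h1].
rewrite restE mem_set//; split.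
  have tn : `|t| < N%:R * P.
    rewrite -ltr_pdivrMr//; apply: (lt_le_trans (truncnS_gt _)).
    by rewrite ler_nat.
  by rewrite /= in_itv/=; move: tn; rewrite ltr_norml => /andP[/ltW -> ->].
by apply/ltW; apply: (lt_le_trans (truncnS_gt _)); rewrite ler_nat.
Qed.

Definition norm2 f : R := (\int[mu]_t cabs2 (f t))%R.

Lemma norm2E f : L2 f -> L2norm2 f = (norm2 f)%:E.
Proof.
by move=> Lf; rewrite /norm2 /Rintegral fineK//; apply: integrable_fin_num => //; exact: L2_integrable.
Qed.

Lemma norm2_trunc_rest f N : L2 f -> norm2 f = norm2 (trunc f N) + norm2 (rest f N).
Proof.
move=> Lf; rewrite /norm2 -RintegralD//; last 2 first.
- by apply: L2_integrable; exact: L2_trunc.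
- by apply: L2_integrable; exact: L2_rest.
by apply: eq_Rintegral => t _; rewrite -trunc_rest.
Qed.

Lemma norm2_rest_cvg f : L2 f -> norm2 (rest f N) @[N --> \oo] --> 0.
Proof.
move=> Lf; apply: (@Rintegral_dom_cvg0 _ (fun t => cabs2 (f t))).
- by move=> n; apply: cmeasurable_cabs2; apply: cmeasurable_rest; case: Lf.
- exact: L2_integrable.
- by move=> n x; rewrite ger0_norm ?cabs2_ge0// rest_le.
- move=> x; apply: cvg_near_cst; apply: filterS (rest_cvg f x) => N ->.
  by rewrite cabs20.
Qed.

Lemma innerE f g : inner f g = cint setT (fun t => f t * conjc (g t)).
Proof. by []. Qed.

Lemma inner_trunc_rest f g N : L2 f -> L2 g ->
  inner f g = inner (trunc f N) g + inner (rest f N) g.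
Proof.
move=> Lf Lg; rewrite !innerE -cintD//; last 2 first.
- by apply: L2_mul => //; exact: L2_trunc.
- by apply: L2_mul => //; exact: L2_rest.
by apply: eq_cint => t _; rewrite -mulrDl /rest addrC subrK.
Qed.

Lemma inner_rest_cvg f g : L2 f -> L2 g ->
  cabs2 (inner (rest f N) g) @[N --> \oo] --> 0.
Proof.
move=> Lf Lg; have [mf _] := Lf; have [mg _] := Lg.
have mm N : cmeasurable (fun t => rest f N t * conjc (g t)).
  by apply: cmeasurableM; [exact: cmeasurable_rest|exact: cmeasurableJ].
have dom N t : cabs2 (rest f N t) + cabs2 (g t) <= cabs2 (f t) + cabs2 (g t).
  by rewrite lerD2r rest_le.
have cR : complex.Re (inner (rest f N) g) @[N --> \oo] --> (0 : R).
  apply: (@Rintegral_dom_cvg0 _ (fun t => cabs2 (f t) + cabs2 (g t))).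
  - by move=> n; case: (mm n).
  - exact: L2_sum_integrable.
  - by move=> n x; apply: le_trans (ReM_le _ _) (dom _ _).
  - move=> x; apply: cvg_near_cst; apply: filterS (rest_cvg f x) => N ->.
    by rewrite mul0r.
have cI : complex.Im (inner (rest f N) g) @[N --> \oo] --> (0 : R).
  apply: (@Rintegral_dom_cvg0 _ (fun t => cabs2 (f t) + cabs2 (g t))).
  - by move=> n; case: (mm n).
  - exact: L2_sum_integrable.
  - by move=> n x; apply: le_trans (ImM_le _ _) (dom _ _).
  - move=> x; apply: cvg_near_cst; apply: filterS (rest_cvg f x) => N ->.
    by rewrite mul0r.
have c2 : (complex.Re (inner (rest f N) g) * complex.Re (inner (rest f N) g) +
  complex.Im (inner (rest f N) g) * complex.Im (inner (rest f N) g)) @[N --> \oo] --> (0 * 0 + 0 * 0 : R).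
  by apply: cvgD; apply: cvgM.
by rewrite !mulr0 addr0 in c2; under eq_fun do rewrite /cabs2 !expr2.
Qed.
End L2Tools.

Section Sufficient.
Context {R : realType}.
Local Notation C := R[i].
Local Notation mu := (@lebesgue_measure R).
Variables b w : R.
Hypotheses (b0 : 0 < b) (w0 : w < 0).
Variables al be : R.
Hypotheses (al0 : 0 < al) (be0 : 0 < be).
Let P : R := be^-1.
Let P0 : 0 < P. Proof. by rewrite invr_gt0. Qed.
Local Notation g := (gsinc b w).

Let K1 : R := kappa b w ^+ 2 * al^-1.
Let K1_gt0 : 0 < K1.
Proof. by rewrite mulr_gt0 ?invr_gt0// exprn_gt0// kappa_gt0. Qed.

(** The case of a single sample equal to 1 in [esum_window_sample]; the bound does not depend on
    s. *)
Lemma gsinc_sum_le s : (\esum_(n in [set: int]) (cabs2 (g (s - al * n%:~R)))%:E <=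
  (K1 * upper_const b w al be)%:E)%E.
Proof.
have := esum_window_sample b0 w0 be al0 1 (fun=> 1) s.
rewrite (eq_esum (b := fun n : int => (cabs2 (g (s - al * n%:~R)))%:E)); last first.
  by move=> n _; rewrite /window_sample big_ord1 mul1r cabs2J mul0r addr0.
move=> ->; rewrite lee_fin -/K1 ler_wpM2l ?(ltW K1_gt0)//.
apply: le_trans (nrm_periodization_upper _ w0 al0 be0 _ _ _) _.
by rewrite big_ord1 cabs2_twist cabs21 mulr1.
Qed.

(** Folding the line onto [0, al) and integrating the uniform bound [gsinc_sum_le] replaces an
    estimate of the decay of g. The symmetric intervals [F k] exhaust the line. *)
Lemma L2_gsinc : L2 g.
Proof.
have [mg bdg] := bmeas_gsinc b w0; split => //.
pose F (k : nat) : set R := `[- (k%:R * al), - (k%:R * al) + (k + k)%:R * al[%classic.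
have mc : measurable_fun setT (fun t => (cabs2 (g t))%:E).
  by apply/measurable_EFinP; exact: cmeasurable_cabs2.
have c0 t : (0 <= (cabs2 (g t))%:E)%E by rewrite lee_fin cabs2_ge0.
pose B := (K1 * upper_const b w al be * al)%:E.
have FB k : (\int[mu]_(t in F k) (cabs2 (g t))%:E <= B)%E.
  rewrite ge0_integral_split//; last exact: ltW.
  rewrite -ge0_integral_sum//; last first.
    by move=> j; apply: measurable_funTS; apply: (measurableT_comp mc); exact: measurable_shift.
  rewrite /B EFinM -[X in (_ * X)%E](_ : mu `[0, al[%classic = al%:E); last first.
    by rewrite lebesgue_measure_itv/= lte_fin al0 oppr0 adde0.
  rewrite -integral_cst//; apply: ge0_le_integral => //.
  - by move=> x _; apply: sume_ge0.
  - apply: measurable_funTS; apply: emeasurable_sum => j.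
    by apply: (measurableT_comp mc); exact: measurable_shift.
  - move=> t _; apply: le_trans (gsinc_sum_le t).
    pose X := [seq (k%:Z - j%:Z) | j <- iota 0 (k + k)].
    have uX : uniq X.
      by rewrite map_inj_uniq ?iota_uniq// => i j /addrI/oppr_inj[].
    apply: le_trans (esum_ge_seq (fun n : int => cabs2 (g (t - al * n%:~R))) uX).
    rewrite sumEFin lee_fin /X big_map -[X in iota _ X]subn0 -/(index_iota _ _) big_mkord.
    rewrite le_eqVlt; apply/orP; left; apply/eqP; apply: eq_bigr => j _.
    congr (cabs2 (g _)); rewrite rmorphB/=.
    have -> : (k%:Z%:~R : R) = k%:R by [].
    have -> : (j%:Z%:~R : R) = j%:R by [].
    ring.
have nF : nondecreasing_seq F.
  move=> k l kl; apply/subsetPset => t; rewrite /F/= !in_itv/= !natrD => /andP[h1 h2].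
  have klR : k%:R * al <= l%:R * al by rewrite ler_pM2r// ler_nat.
  by apply/andP; split; lra.
have := @ge0_nondecreasing_set_cvg_integral _ (measurableTypeR R) R F (fun t => (cabs2 (g t))%:E) mu nF.
have -> : \bigcup_i F i = setT.
  apply/seteqP; split => // t _; pose k := (Num.truncn (`|t| / al)).+1.
  exists k => //; rewrite /F/= in_itv/= natrD.
  have : `|t| < k%:R * al by rewrite -ltr_pdivrMr//; exact: truncnS_gt.
  by rewrite ltr_norml => /andP[h1 h2]; apply/andP; split; lra.
move=> /(_ _ _ _)/cvg_lim H.
rewrite /L2norm2 -H//; last 2 first.
- by move=> i; exact: measurable_itv.
- by move=> i; exact: measurable_funTS.
apply: (@le_lt_trans _ _ B); last by rewrite ltry.
apply: lime_le; last by apply: nearW.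
apply: ereal_nondecreasing_is_cvgn.
apply: (@ge0_nondecreasing_set_nondecreasing_integral _ (measurableTypeR R) R F) => //.
- by move=> i; exact: measurable_itv.
- by move=> i; exact: measurable_funTS.
Qed.

Definition gabor_atom (mn : int * int) : R -> C := tfshift (al * mn.2%:~R) (be * mn.1%:~R) g.

Lemma gabor_atomE mn t : gabor_atom mn t = e2pi (be * mn.1%:~R * t) * g (t - al * mn.2%:~R).
Proof. by rewrite /gabor_atom /tfshift; congr (_ * _); rewrite /e2pi !mulrA. Qed.

Lemma L2_gabor_atom mn : L2 (gabor_atom mn).
Proof.
have [mg bdg] := bmeas_gsinc b w0.
have E : gabor_atom mn = (fun t => e2pi (be * mn.1%:~R * t) * g (t - al * mn.2%:~R)).
  by apply/funext => t; rewrite gabor_atomE.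
split.
  rewrite E; apply: cmeasurableM; first by case: (bmeas_e2piM (be * mn.1%:~R)).
  by apply: cmeasurable_comp => //; exact: measurable_funB.
rewrite /L2norm2.
under eq_integral do rewrite gabor_atomE cabs2M cabs2_e2pi mul1r.
have := @ge0_integral_shift R setT (- (al * mn.2%:~R)) (fun t => (cabs2 (g t))%:E) measurableT.
rewrite preimage_setT => ->; first by case: L2_gsinc.
- by apply/measurable_EFinP; exact: cmeasurable_cabs2.
- by move=> x; rewrite lee_fin cabs2_ge0.
Qed.

(** [P] is the Parseval factor of the modulations, [K1] that of the translations. These constants
    serve bounded functions of bounded support; a general f loses a factor 2 on each side. *)
Definition frame_upper : R := P * (K1 * upper_const b w al be).
Definition frame_lower : R := P * (K1 * lower_const w al be).
Local Notation coefs f := (\esum_(mn in [set: int * int]) (cabs2 (inner f (gabor_atom mn)))%:E)%E.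

Lemma bounded_support_upper f K : L2 f -> bmeas f ->
  (forall t, ~~ (- (K%:R * P) <= t < K%:R * P) -> f t = 0) ->
  (coefs f <= (frame_upper * norm2 f)%:E)%E.
Proof.
move=> Lf bf f0; rewrite (frame_coefs_fiber b0 w0 al0 be0 bf f0).
rewrite /frame_upper -mulrA [X in (_ <= X)%E]EFinM lee_pmul2l// ?lte_fin// EFinM -norm2E//.
rewrite (L2norm2_fiber be0 bf f0) -ge0_integralZl_EFin//; first last.
- by rewrite mulr_ge0 ?(ltW K1_gt0)//; exact: upper_const_ge0.
- by apply: measurable_funTS; exact: measurable_L2norm2_fiber.
- by move=> t _; rewrite lee_fin sumr_ge0// => j _; exact: cabs2_ge0.
apply: ge0_le_integral => //.
- move=> t _; rewrite lee_fin mulr_ge0 ?(ltW K1_gt0)//; exact: nrm_ge0.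
- by apply: measurable_funTS; exact: measurable_fiber.
- apply: measurable_funTS; apply: emeasurable_funM => //; exact: measurable_L2norm2_fiber.
- move=> t _; rewrite -EFinM lee_fin -/K1 -[X in _ <= X]mulrA ler_wpM2l ?(ltW K1_gt0)//.
  apply: le_trans (nrm_periodization_upper _ w0 al0 be0 _ _ _) _.
  by under eq_bigr do rewrite cabs2_twist.
Qed.

Lemma bounded_support_lower f K : be <= b -> al * be <= 1 -> L2 f -> bmeas f ->
  (forall t, ~~ (- (K%:R * P) <= t < K%:R * P) -> f t = 0) ->
  ((frame_lower * norm2 f)%:E <= coefs f)%E.
Proof.
move=> beb abe Lf bf f0; rewrite (frame_coefs_fiber b0 w0 al0 be0 bf f0).
rewrite /frame_lower -mulrA [X in (X <= _)%E]EFinM lee_pmul2l// ?lte_fin// EFinM -norm2E//.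
rewrite (L2norm2_fiber be0 bf f0) -ge0_integralZl_EFin//; first last.
- by rewrite mulr_ge0 ?(ltW K1_gt0)// ltW// lower_const_gt0.
- by apply: measurable_funTS; exact: measurable_L2norm2_fiber.
- by move=> t _; rewrite lee_fin sumr_ge0// => j _; exact: cabs2_ge0.
apply: ge0_le_integral => //.
- move=> t _; rewrite -EFinM lee_fin mulr_ge0//.
    by rewrite mulr_ge0 ?(ltW K1_gt0)// ltW// lower_const_gt0.
  by rewrite sumr_ge0// => j _; exact: cabs2_ge0.
- apply: measurable_funTS; apply: emeasurable_funM => //; exact: measurable_L2norm2_fiber.
- by apply: measurable_funTS; exact: measurable_fiber.
- move=> t _; rewrite -EFinM lee_fin -/K1 -[X in X <= _]mulrA ler_wpM2l ?(ltW K1_gt0)//.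
  apply: le_trans (nrm_periodization_lower w0 al0 be0 beb abe _ _ _).
  by under [in leRHS]eq_bigr do rewrite cabs2_twist.
Qed.

Lemma frame_upper_ge0 : 0 <= frame_upper.
Proof. by rewrite mulr_ge0 ?(ltW P0)// mulr_ge0 ?(ltW K1_gt0)//; exact: upper_const_ge0. Qed.

Lemma sum_rest_cvg f (X : seq (int * int)) : L2 f ->
  \sum_(mn <- X) cabs2 (inner (rest P f N) (gabor_atom mn)) @[N --> \oo] --> (0 : R).
Proof.
move=> Lf; elim: X => [|mn X ih].
  by under eq_fun do rewrite big_nil; exact: cvg_cst.
under eq_fun do rewrite big_cons.
have c1 := inner_rest_cvg P0 Lf (L2_gabor_atom mn).
have : (cabs2 (inner (rest P f N) (gabor_atom mn)) + \sum_(mn <- X) cabs2 (inner (rest P f N) (gabor_atom mn))) @[N --> \oo] --> (0 + 0 : R).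
  exact: cvgD.
by rewrite addr0.
Qed.

Lemma coefs_trunc_rest_le f N : L2 f -> forall mn,
  cabs2 (inner f (gabor_atom mn)) <= 2 * cabs2 (inner (trunc P f N) (gabor_atom mn)) + 2 * cabs2 (inner (rest P f N) (gabor_atom mn)).
Proof.
by move=> Lf mn; rewrite (inner_trunc_rest P N Lf (L2_gabor_atom mn)); exact: cabs2D_le.
Qed.

Lemma norm2_ge0 (f : R -> C) : 0 <= norm2 f.
Proof. by apply: Rintegral_ge0 => t _; exact: cabs2_ge0. Qed.

(** The coefficients of [rest] tend to 0 one by one, with no uniformity yet, so the bound is proved
    for each finite family of indices. *)
Lemma L2_upper f : L2 f -> (coefs f <= (2 * frame_upper * norm2 f)%:E)%E.
Proof.
move=> Lf; have [mf _] := Lf; have B00 := frame_upper_ge0.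
apply: esum_le_seq => X uX; rewrite lee_fin.
apply/ler_addgt0Pr => e e0.
have e2 : 0 < e / 2 by rewrite divr_gt0.
have /cvgrPdist_le /(_ _ e2) [N _ /(_ N (leqnn N))] := sum_rest_cvg X Lf.
rewrite sub0r normrN => HN.
apply: (@le_trans _ _ (\sum_(mn <- X) (2 * cabs2 (inner (trunc P f N) (gabor_atom mn)) + 2 * cabs2 (inner (rest P f N) (gabor_atom mn))))).
  by apply: ler_sum => mn _; exact: coefs_trunc_rest_le.
rewrite big_split/= -!mulr_sumr.
have H1 : \sum_(mn <- X) cabs2 (inner (trunc P f N) (gabor_atom mn)) <= frame_upper * norm2 f.
  rewrite -lee_fin; apply: le_trans (esum_ge_seq _ uX) _.
  apply: le_trans (bounded_support_upper (L2_trunc P N Lf) (bmeas_trunc P N mf) (@trunc_supp _ P f N)) _.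
  rewrite lee_fin ler_wpM2l// (norm2_trunc_rest P N Lf) lerDl; exact: norm2_ge0.
have := le_trans (ler_norm _) HN.
move: H1; move: (\sum_(mn <- X) _) (\sum_(mn <- X) _) => x y; lra.
Qed.

(** Finite families do not suffice for a lower bound; all coefficients of [rest] are controlled
    together by [L2_upper]. *)
Lemma L2_lower f : be <= b -> al * be <= 1 -> L2 f -> ((frame_lower / 2 * norm2 f)%:E <= coefs f)%E.
Proof.
move=> beb abe Lf; have [mf _] := Lf; have B00 := frame_upper_ge0.
have cfin g' : L2 g' -> coefs g' \is a fin_num.
  move=> Lg; rewrite ge0_fin_numE; first by apply: le_lt_trans (L2_upper Lg) _; rewrite ltry.
  by apply: esum_ge0 => mn _; rewrite lee_fin cabs2_ge0.
rewrite -(fineK (cfin f Lf)) lee_fin.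
set c := fine (coefs f).
have frame_lower_ge0 : 0 <= frame_lower.
  by rewrite mulr_ge0 ?(ltW P0)// mulr_ge0 ?(ltW K1_gt0)//; apply/ltW; exact: lower_const_gt0.
(* The 4 is the 2 from splitting squares times the 2 in [L2_upper]; the extra [frame_lower] passes
   from the norm of [trunc] to that of f. *)
have step N : frame_lower * norm2 f <= 2 * c + (frame_lower + 4 * frame_upper) * norm2 (rest P f N).
  have H1 := bounded_support_lower beb abe (L2_trunc P N Lf) (bmeas_trunc P N mf) (@trunc_supp _ P f N).
  have Lr := L2_rest P N Lf.
  have H2 := L2_upper Lr.
  have H3 : (coefs (trunc P f N) <= 2%:E * coefs f + 2%:E * coefs (rest P f N))%E.
    rewrite -!esumZl// -esumD; last 2 first.
    - by move=> mn _; rewrite lee_fin mulr_ge0// cabs2_ge0.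
    - by move=> mn _; rewrite lee_fin mulr_ge0// cabs2_ge0.
    apply: le_esum => mn _; rewrite -EFinD lee_fin.
    have -> : inner (trunc P f N) (gabor_atom mn) = inner f (gabor_atom mn) - inner (rest P f N) (gabor_atom mn).
      by rewrite (inner_trunc_rest P N Lf (L2_gabor_atom mn)) addrK.
    exact: cabs2B_le.
  move: H1 H2 H3; rewrite -(fineK (cfin _ Lf)) -(fineK (cfin _ Lr)) -/c.
  rewrite -(fineK (cfin _ (L2_trunc P N Lf))) -!EFinM -EFinD !lee_fin.
  rewrite (norm2_trunc_rest P N Lf); move: (fine _) (fine _) (norm2 _) (norm2 _) => x y u v; lra.
suff : frame_lower * norm2 f <= 2 * c by lra.
apply/ler_addgt0Pr => e e0.
have : (frame_lower + 4 * frame_upper) * norm2 (rest P f N) @[N --> \oo] --> (frame_lower + 4 * frame_upper) * 0.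
  by apply: cvgMl_tmp; exact: norm2_rest_cvg.
rewrite mulr0 => /cvgrPdist_le /(_ _ e0) [N _ /(_ N (leqnn N))].
rewrite sub0r normrN => HN.
by apply: le_trans (step N) _; rewrite lerD2l (le_trans (ler_norm _)).
Qed.

Theorem frame_sufficient : be <= b -> al * be <= 1 -> gabor_frame g al be.
Proof.
(* Adding 1 makes the upper constant positive, since only [frame_upper_ge0] is at hand. *)
move=> beb abe; exists (frame_lower / 2), (2 * frame_upper + 1).
have frame_lower_ge0 : 0 < frame_lower by rewrite mulr_gt0// mulr_gt0//; exact: lower_const_gt0.
have B00 := frame_upper_ge0.
split; first by rewrite divr_gt0.
split; first by rewrite ltr_wpDl// mulr_ge0.
move=> f Lf; rewrite (norm2E Lf) -!EFinM; apply/andP; split; first exact: L2_lower.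
apply: le_trans (L2_upper Lf) _.
by rewrite lee_fin ler_wpM2r ?norm2_ge0// lerDl.
Qed.
End Sufficient.

(** * Necessity *)

(** Converts symmetric frequencies into the indices j < 2K of [freq_poly]; the offset K becomes the
    base point -K P. *)
Lemma int_shift (K : nat) (n : int) : (`|n| < K)%N ->
  exists2 j : nat, (j < K + K)%N & n = K%:Z - j%:Z.
Proof. by move=> nK; exists `|K%:Z - n|%N; lia. Qed.

Section Necessary.
Context {R : realType}.
Local Notation C := R[i].
Local Notation mu := (@lebesgue_measure R).
Variables b w : R.
Hypotheses (b0 : 0 < b) (w0 : w < 0).
Variables al be : R.
Hypotheses (al0 : 0 < al) (be0 : 0 < be).
Let P : R := be^-1.
Let P0 : 0 < P. Proof. by rewrite invr_gt0. Qed.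
Let p : R := al^-1.
Let p0 : 0 < p. Proof. by rewrite invr_gt0. Qed.
Let r : R := decay w al.
Let r0 : 0 < r. Proof. exact: expR_gt0. Qed.
Let r1 : r < 1.
Proof.
by rewrite /r /decay -expR0 ltr_expR pmulr_llt0// pmulr_rlt0// mulr_gt0// pi_gt0.
Qed.
Local Notation M := (num_steps b al).
Local Notation g := (gsinc b w).
Local Notation wrap := (wrap be).
Let q : R := Num.min p b.
Let q0 : 0 < q. Proof. by rewrite lt_min p0 b0. Qed.
Let q_b : q <= b. Proof. by rewrite ge_min lexx orbT. Qed.
Let q_p : q <= p. Proof. by rewrite ge_min lexx. Qed.
Hypothesis q_lt_be : q < be.

(* Fixed-point iteration for S(x) = r^N S(x + N p) on [0, q), where N is the
   number of points x, x + p, ... inside the window, with S = 1 prescribed on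
   the uncovered part [q, be) of the period. *)
Definition almost_inv_step (s : R -> R) (x : R) : R :=
  if q <= wrap x then 1 else
  \sum_(k < M) if wrap x + k%:R * p < b then
     (if b <= wrap x + k.+1%:R * p then r ^+ k.+1 * s (wrap x + k.+1%:R * p) else 0) else 0.

Definition almost_inv (i : nat) : R -> R := iter i almost_inv_step (fun x => if q <= wrap x then 1 else 0).

Lemma almost_inv_q i x : q <= wrap x -> almost_inv i x = 1.
Proof. by case: i => [|i] /= h; rewrite /almost_inv_step h. Qed.

Lemma almost_inv_periodic i x : almost_inv i (x + be) = almost_inv i x.
Proof. by case: i => [|i] /=; rewrite /almost_inv_step wrapD. Qed.

Lemma almost_inv_wrapD i x (y : R) : almost_inv i (wrap x + y) = almost_inv i (x + y).
Proof.
have [m e] := wrapE be x; rewrite [in RHS]e [in RHS]addrAC.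
by rewrite (periodicz (almost_inv_periodic i)).
Qed.

(** The sum in [almost_inv_step] has one nonzero term, k = N - 1: its two tests single out the last
    point inside the window. *)
Lemma almost_invS i x N : wrap x < q -> (0 < N <= M)%N ->
  (forall k, (k < M)%N -> (wrap x + k%:R * p < b) = (k < N)%N) ->
  almost_inv i.+1 x = r ^+ N * almost_inv i (x + N%:R * p).
Proof.
move=> xq /andP[N0 NM] HN; rewrite /= /almost_inv_step leNgt xq/=.
have N1 : (N.-1 < M)%N by rewrite prednK.
have /andP[y0 _] := wrap_itv be0 x.
rewrite (bigD1 (Ordinal N1))//= big1 ?addr0; last first.
  move=> k kN; case: ifPn => // kb; case: ifPn => // bk.
  have {}kb : (k < N)%N by rewrite -HN.
  have kN1 : (k.+1 < N)%N.
    rewrite ltn_neqAle kb andbT; apply: contra kN => /eqP kN; apply/eqP/val_inj.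
    by rewrite /= -kN.
  have := HN k.+1 (leq_trans kN1 NM); rewrite kN1 => kb'.
  by rewrite ltNge bk in kb'.
rewrite HN// prednK// leqnn.
rewrite ifT ?almost_inv_wrapD//.
(* For N = M the hypothesis says nothing about index M, but M p >= b already puts that point outside
   the window. *)
move: NM; rewrite leq_eqVlt => /orP[/eqP ->|NM].
  by apply: le_trans (num_stepsP b al0) _; rewrite lerDr.
by rewrite leNgt HN// ltnn.
Qed.

Lemma almost_inv_cut x : wrap x < q -> exists N, [/\ (0 < N <= M)%N &
  forall k, (k < M)%N -> (wrap x + k%:R * p < b) = (k < N)%N].
Proof.
move=> xq; have [N [NM HN]] := cutoff b al0 (wrap x) M.
exists N; split => //; rewrite NM andbT -HN// mul0r addr0.
exact: lt_le_trans xq q_b.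
Qed.

Lemma almost_inv_bd i x : 0 <= almost_inv i x <= 1.
Proof.
elim: i x => [|i ih] x; first by rewrite /=; case: ifP; rewrite ?lexx ?ler01.
have [xq|xq] := lerP q (wrap x); first by rewrite almost_inv_q// ler01 lexx.
have [N [NM HN]] := almost_inv_cut xq; rewrite (almost_invS i xq NM HN).
have /andP[h1 h2] := ih (x + N%:R * p).
rewrite mulr_ge0 ?exprn_ge0 ?(ltW r0)//= mulr_ile1// ?exprn_ge0 ?(ltW r0)//.
by rewrite exprn_ile1 ?(ltW r0) ?(ltW r1).
Qed.

(** On [0, q) both iterates are multiplied by the same r^N with N >= 1, and elsewhere they agree, so
    each step contracts by r. *)
Lemma almost_inv_diff i x : `|almost_inv i.+1 x - almost_inv i x| <= r ^+ i.+1.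
Proof.
elim: i x => [|i ih] x.
  have [xq|xq] := lerP q (wrap x); first by rewrite !almost_inv_q// subrr normr0 expr1 ltW.
  have [N [NM HN]] := almost_inv_cut xq; rewrite (almost_invS 0 xq NM HN).
  have /andP[h1 h2] := almost_inv_bd 0 (x + N%:R * p).
  have -> : almost_inv 0 x = 0 by rewrite /= leNgt xq.
  rewrite subr0 ger0_norm ?mulr_ge0 ?exprn_ge0 ?(ltW r0)//.
  have /andP[N0 _] := NM; rewrite -{1}(prednK N0) exprS expr1.
  rewrite -mulrA -[leRHS]mulr1 ler_pM2l//.
  by apply: mulr_ile1 => //; [exact: exprn_ge0 (ltW r0)|exact: exprn_ile1 _ (ltW r0) (ltW r1)].
have [xq|xq] := lerP q (wrap x); first by rewrite !almost_inv_q// subrr normr0 exprn_ge0// ltW.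
have [N [NM HN]] := almost_inv_cut xq; rewrite (almost_invS i.+1 xq NM HN) (almost_invS i xq NM HN).
rewrite -mulrBr normrM (ger0_norm (exprn_ge0 _ (ltW r0))) [leRHS]exprS.
apply: ler_pM => //; first by rewrite exprn_ge0// ltW.
have /andP[N0 _] := NM.
by rewrite -(prednK N0) exprS -[leRHS]mulr1 ler_pM2l// exprn_ile1 ?(ltW r0) ?(ltW r1).
Qed.

Lemma measurable_almost_inv i : measurable_fun setT (almost_inv i).
Proof.
have mw : measurable_fun setT wrap by exact: measurable_wrap.
elim: i => [|i ih].
  apply: measurable_fun_ifT => //; exact: measurable_fun_ler.
apply: measurable_fun_ifT => //; first exact: measurable_fun_ler.
apply: measurable_sum => k.
have mk (n : nat) : measurable_fun setT (fun x => wrap x + n%:R * p) by exact: measurable_funD.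
apply: measurable_fun_ifT => //; first exact: measurable_fun_ltr.
apply: measurable_fun_ifT => //; first exact: measurable_fun_ler.
by apply: measurable_funM => //; exact: (measurableT_comp ih).
Qed.

Lemma bmeas_almost_inv i : bmeas (fun x => (almost_inv i x)%:C).
Proof.
apply: bmeasC; split; first exact: measurable_almost_inv.
by exists 1 => x; have /andP[h1 h2] := almost_inv_bd i x; rewrite ger0_norm.
Qed.

(** The prescribed value 1 on [q, be) alone gives a bound independent of i. *)
Lemma nrm_almost_inv i : be - q <= nrm be (fun x => (almost_inv i x)%:C).
Proof.
have bb := bmeas_cabs2 (bmeas_almost_inv i).
rewrite /nrm (@Rintegral_itv_cat _ 0 q be)//; try exact: ltW.
rewrite -[leLHS]add0r; apply: lerD.
  by apply: Rintegral_ge0 => x _; exact: cabs2_ge0.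
rewrite (_ : (\int[mu]_(x in _) _)%R = (\int[mu]_(x in `[q, be[) 1)%R); last first.
  apply: eq_Rintegral => x; rewrite inE/= in_itv/= => /andP[qx xb].
  by rewrite almost_inv_q ?cabs21// wrap_id// (le_trans (ltW q0)).
have mq : fine (mu `[q, be[%classic) = be - q by rewrite lebesgue_measure_itv/= lte_fin q_lt_be -EFinB.
by rewrite Rintegral_cst// mul1r mq.
Qed.

Lemma trig_poly_freq_poly (X : seq int) c (K : nat) x : uniq X -> (forall n, n \in X -> (`|n| < K)%N) ->
  trig_poly be X c x = freq_poly be (K + K) (fun j => if (K%:Z - j%:Z) \in X then c (K%:Z - j%:Z) else 0)
    (- (K%:R * P)) x.
Proof.
move=> uX XK.
pose Z := [seq (K%:Z - j%:Z) | j <- iota 0 (K + K)].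
have uZ : uniq Z by rewrite map_inj_uniq ?iota_uniq// => i j /addrI/oppr_inj[].
rewrite (trig_poly_widen _ c uX uZ); last first.
  move=> n /XK /int_shift[j jK ->]; apply/mapP; exists j => //.
  by rewrite mem_iota.
rewrite /trig_poly /Z big_map -[X in iota _ X]subn0 -/(index_iota _ _) big_mkord.
apply: eq_bigr => j _; congr (_ * _); rewrite /fourier_mode rmorphB/=.
have -> : (K%:Z%:~R : R) = K%:R by [].
have -> : (j%:Z%:~R : R) = j%:R by [].
by congr e2pi; rewrite /P; ring.
Qed.

Lemma freq_poly_phase J d t s x : freq_poly be J d (t + s) x = e2pi (- t * x) * freq_poly be J d s x.
Proof.
rewrite /freq_poly mulr_sumr; apply: eq_bigr => j _; rewrite mulrCA -e2piD; congr (_ * e2pi _); ring.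
Qed.

(** No limit is taken: a finite iterate already satisfies the fixed-point relation up to an
    exponentially small error. *)
Lemma almost_invP i x N : 0 <= x -> x < q -> (0 < N <= M)%N ->
  (forall k, (k < M)%N -> (x + k%:R * p < b) = (k < N)%N) ->
  `|almost_inv i x - r ^+ N * almost_inv i (x + N%:R * p)| <= r ^+ i.+1.
Proof.
move=> x0 xq NM HN; have wx : wrap x = x by rewrite wrap_id// (lt_trans xq).
by rewrite -almost_invS ?wx// distrC; exact: almost_inv_diff.
Qed.

(** Three errors add up: the defect of the iterate, the phase mismatch [eta] between x and x + N p,
    and the distance from the iterate to the polynomial [T]. The count M + 2 is one for x and M + 1
    for the possible x + N p. *)
Lemma nrm_periodization_small i (T : R -> C) J (c : nat -> C) s t eta U :
  (forall x, freq_poly be J (resolvent w al be c s) s x = e2pi (- t * x) * T x) ->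
  bmeas T -> (forall x, T (x + be) = T x) -> (forall x, cabs2 (T x) <= U) ->
  (forall N, (N <= M)%N -> cabs2 (1 - e2pi (- t * (N%:R * p))) <= eta) ->
  nrm p (periodization b w al be J c s) <= be * (4 * (r ^+ i.+1) ^+ 2 + 2 * (eta * U)) +
    8 * M.+2%:R * nrm be (fun x => (almost_inv i x)%:C - T x).
Proof.
move=> ST bT Tp TU He.
pose dl x := (almost_inv i x)%:C - T x.
have bdl : bmeas dl by apply: bmeasB => //; exact: bmeas_almost_inv.
have dlp x : cabs2 (dl (x + be)) = cabs2 (dl x) by rewrite /dl almost_inv_periodic Tp.
have bH : bmeas (periodization b w al be J c s) by exact: bmeas_periodization.
have eta0 : 0 <= eta by apply: le_trans (He 0%N _) => //; exact: cabs2_ge0.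
have U0 : 0 <= U by apply: le_trans (TU 0); exact: cabs2_ge0.
have bdx y : bmeasR (fun x => 8 * cabs2 (dl (x + y))).
  apply: bmeasRM; first exact: bmeasR_cst.
  by apply: bmeas_cabs2; exact: bmeas_shift.
pose k0 := 4 * (r ^+ i.+1) ^+ 2 + 2 * (eta * U).
have k00 : 0 <= k0 by rewrite addr_ge0// mulr_ge0 ?sqr_ge0// mulr_ge0.
pose G x := (k0 + 8 * cabs2 (dl (x + 0))) + \sum_(k < M.+1) 8 * cabs2 (dl (x + k%:R * p)).
have bk : bmeasR (fun x => k0 + 8 * cabs2 (dl (x + 0))) by apply: bmeasRD => //; exact: bmeasR_cst.
have bs : bmeasR (fun x => \sum_(k < M.+1) 8 * cabs2 (dl (x + k%:R * p))) by exact: bmeasR_sum.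
have bG : bmeasR G by exact: bmeasRD.
have G0 x : 0 <= G x.
  rewrite addr_ge0//; first by rewrite addr_ge0// mulr_ge0// cabs2_ge0.
  by apply: sumr_ge0 => k _; rewrite mulr_ge0// cabs2_ge0.
have bH2 := bmeas_cabs2 bH.
have HG x : 0 <= x -> x < q -> cabs2 (periodization b w al be J c s x) <= G x.
  move=> x0 xq; have [N [NM N0 HN ->]] := periodization_resolvent b w0 be al0 J c s x0.
  have {}N0 : (0 < N)%N by rewrite N0 (lt_le_trans xq).
  rewrite cabs2M cabs2C !ST.
  have e1 : expR (2 * pi * w * x) ^+ 2 <= 1.
    rewrite expr_le1// ?expR_ge0// -[leRHS]expR0 ler_expR.
    by rewrite mulr_le0_ge0// pmulr_rle0 ?(ltW w0)// mulr_gt0// pi_gt0.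
  set Z := _ - _.
  apply: (@le_trans _ _ (cabs2 Z)); first by rewrite -[leRHS]mul1r ler_wpM2r// cabs2_ge0.
  pose y := x + N%:R * p; pose rN := (r ^+ N)%:C : C; pose z := e2pi (- t * (N%:R * p)).
  (* The common phase e(-t x) has modulus 1 and drops out; the relative phase [z] is isolated in the
     last term. *)
  have -> : cabs2 Z = cabs2 ((T x - rN * T y) + rN * (1 - z) * T y).
    have EZ : Z = e2pi (- t * x) * T x - rN * (e2pi (- t * y) * T y) by [].
    have Ey : e2pi (- t * y) = e2pi (- t * x) * z by rewrite /z -e2piD /y; congr (e2pi _); ring.
    rewrite -[RHS]mul1r -(cabs2_e2pi (- t * x)) -cabs2M EZ Ey; congr cabs2; ring.
  have rN1 : cabs2 rN <= 1.
    by rewrite cabs2C expr_le1// ?exprn_ge0 ?exprn_ile1 ?(ltW r0) ?(ltW r1).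
  have rN0 : 0 <= cabs2 rN by exact: cabs2_ge0.
  have h2 : cabs2 (rN * (1 - z) * T y) <= eta * U.
    rewrite !cabs2M; apply: ler_pM; [by rewrite mulr_ge0 ?cabs2_ge0|exact: cabs2_ge0| |exact: TU].
    rewrite -[leRHS]mul1r; apply: ler_pM; [exact: cabs2_ge0|exact: cabs2_ge0| exact: rN1|exact: He].
  have h1 : cabs2 ((almost_inv i x)%:C - rN * (almost_inv i y)%:C) <= (r ^+ i.+1) ^+ 2.
    rewrite /rN -RtoCM -RtoCB cabs2C -(real_normK (num_real _)) ler_sqr ?nnegrE ?exprn_ge0 ?(ltW r0)//.
    by apply: almost_invP => //; rewrite N0.
  have h3 : cabs2 (T x - rN * T y) <= 2 * (r ^+ i.+1) ^+ 2 + 2 * (2 * cabs2 (dl x) + 2 * cabs2 (dl y)).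
    have -> : T x - rN * T y = ((almost_inv i x)%:C - rN * (almost_inv i y)%:C) - (dl x - rN * dl y).
      by rewrite /dl; ring.
    apply: le_trans (cabs2B_le _ _) _.
    have : cabs2 (dl x - rN * dl y) <= 2 * cabs2 (dl x) + 2 * cabs2 (dl y).
      apply: le_trans (cabs2B_le _ _) _; rewrite lerD2l ler_wpM2l// cabs2M.
      by rewrite -[leRHS]mul1r ler_wpM2r// cabs2_ge0.
    by move: h1; move: (cabs2 _) (cabs2 _) => u v; lra.
  have h4 : 8 * cabs2 (dl y) <= \sum_(k < M.+1) 8 * cabs2 (dl (x + k%:R * p)).
    rewrite (bigD1 (Ordinal (NM : (N < M.+1)%N)))//= -[leLHS]addr0 lerD2l.
    by apply: sumr_ge0 => k _; rewrite mulr_ge0// cabs2_ge0.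
  apply: le_trans (cabs2D_le _ _) _.
  move: h2 h3 h4; rewrite /G /k0 addr0.
  move: (cabs2 (T x - _)) (cabs2 (_ * _ * _)) (\sum_(k < _) _) (eta * U) => u v u' v'; lra.
(* If [q, p) is nonempty then q = b, so its points lie past the window and N = 0. *)
have HZ x : q <= x -> x < p -> cabs2 (periodization b w al be J c s x) = 0.
  move=> qx xp; have x0 : 0 <= x by rewrite (le_trans (ltW q0)).
  have bx : b <= x by move: qx; rewrite ge_min leNgt xp.
  have [N [_ N0 _ ->]] := periodization_resolvent b w0 be al0 J c s x0.
  have -> : N = 0%N by move: N0; rewrite ltNge bx/= lt0n => /negbFE/eqP.
  by rewrite expr0 mul1r mul0r addr0 subrr mulr0 cabs20.
rewrite /nrm (@Rintegral_itv_cat _ 0 q p)//; last exact: ltW.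
rewrite [X in _ + X](_ : _ = 0) ?addr0; last first.
  rewrite -[RHS](mul0r (fine (mu `[q, p[%classic))) -Rintegral_cst//.
  by apply: eq_Rintegral => x; rewrite inE/= in_itv/= => /andP[qx xp]; exact: HZ.
apply: (@le_trans _ _ (\int[mu]_(x in `[0%R, q[) G x)%R).
  apply: le_Rintegral => //.
  - by apply: bmeasR_integrable => //; exact: lebesgue_itv_fin.
  - by apply: bmeasR_integrable => //; exact: lebesgue_itv_fin.
  - by move=> x /=; rewrite in_itv/= => /andP[x0 xq]; exact: HG.
apply: (@le_trans _ _ (\int[mu]_(x in `[0%R, be[) G x)%R).
  rewrite (@Rintegral_itv_cat _ 0 q be)//; try exact: ltW.
  by rewrite lerDl; apply: Rintegral_ge0.
have fD : (mu `[0%R, be[%classic < +oo)%E by exact: lebesgue_itv_fin.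
have iDl y : (\int[mu]_(x in `[0%R, be[) (8 * cabs2 (dl (x + y))) = 8 * nrm be dl)%R.
  rewrite RintegralZl//; last first.
    by apply: bmeasR_integrable => //; apply: bmeas_cabs2; exact: bmeas_shift.
  by congr (_ * _); rewrite (Rintegral_periodic be0 y (bmeas_cabs2 bdl) dlp).
have muD : fine (mu `[0, be[%classic) = be by rewrite lebesgue_measure_itv/= lte_fin be0 -EFinB/= subr0.
rewrite RintegralD//; [|exact: bmeasR_integrable|exact: bmeasR_integrable].
rewrite RintegralD//; [|by apply: bmeasR_integrable => //; exact: bmeasR_cst|exact: bmeasR_integrable].
rewrite Rintegral_cst// muD iDl Rintegral_sum//.
rewrite (eq_bigr (fun=> 8 * nrm be dl)); last by move=> k _; exact: iDl.
rewrite sumr_const card_ord -[X in _ + X]mulr_natl -/k0 -/dl.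
rewrite le_eqVlt; apply/orP; left; apply/eqP; rewrite -[M.+2%:R]natr1 -/(nrm be dl); ring.
Qed.
End Necessary.

(** * Test functions concentrated on the fibers in [0, tau) *)

Section TestFunction.
Context {R : realType}.
Local Notation C := R[i].
Local Notation mu := (@lebesgue_measure R).
Variables b w : R.
Hypotheses (b0 : 0 < b) (w0 : w < 0).
Variables al be : R.
Hypotheses (al0 : 0 < al) (be0 : 0 < be).
Let P : R := be^-1.
Let P0 : 0 < P. Proof. by rewrite invr_gt0. Qed.
Let p : R := al^-1.
Let p0 : 0 < p. Proof. by rewrite invr_gt0. Qed.
Let r : R := decay w al.
Let r0 : 0 < r. Proof. exact: expR_gt0. Qed.
Let r1 : r < 1.
Proof.
by rewrite /r /decay -expR0 ltr_expR pmulr_llt0// pmulr_rlt0// mulr_gt0// pi_gt0.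
Qed.
Local Notation g := (gsinc b w).

Variables (d : nat -> C) (K : nat) (tau : R).
Hypotheses (tau0 : 0 < tau) (tauP : tau <= P).
Let J := (K + K)%N.

(** A step of height [d i] and width [tau] at the left end of each cell of length P. As tau <= P the
    steps are disjoint, and fibers t in [tau, P) see only zeros. *)
Definition test_step (u : R) : C :=
  \sum_(i < J) d i * (\1_(`[(- (K%:R * P) + i%:R * P)%R, (- (K%:R * P) + i%:R * P + tau)%R[%classic : set R) u)%:C.

(* The extra factor cancels both the twist and the denominators of the
   resolvent, so that every fiber in [0, tau) sees the same coefficients [d]. *)
Definition test_fun (u : R) : C :=
  test_step u * ((1 - r%:C * e2pi (- p * u)) * e2pi (- (b / 2) * u)).

Lemma bmeas_test_fun : bmeas test_fun.
Proof.
apply: bmeasM.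
  apply: bmeas_sum => i; apply: bmeasM; first exact: bmeas_cst.
  by apply: bmeas_indic; exact: measurable_itv.
apply: bmeasM; last exact: bmeas_e2piM.
apply: bmeasB; first exact: bmeas_cst.
by apply: bmeasM; [exact: bmeas_cst|exact: bmeas_e2piM].
Qed.

Lemma test_fun_supp (u : R) : ~~ (- (K%:R * P) <= u < K%:R * P) -> test_fun u = 0.
Proof.
move=> hu; rewrite /test_fun /test_step big1 ?mul0r// => i _.
rewrite indicE memNset ?mulr0//= in_itv/= => /andP[h1 h2].
move/negP: hu; apply; apply/andP; split.
  by apply: le_trans h1; rewrite lerDl mulr_ge0// ltW.
apply: (lt_le_trans h2).
have : i.+1%:R * P <= J%:R * P by rewrite ler_pM2r// ler_nat.
rewrite -natr1 /J natrD !mulrDl mul1r.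
have aux (a k t P' : R) : t <= P' -> a + P' <= k + k -> - k + a + t <= k by lra.
exact: aux.
Qed.

Lemma test_step_fiber t (j : 'I_J) : 0 <= t -> t < P ->
  test_step (t - K%:R * P + j%:R * P) = if t < tau then d j else 0.
Proof.
move=> t0 tP; rewrite /test_step (bigD1 j)//= big1 ?addr0; last first.
  move=> i ij; rewrite indicE memNset ?mulr0//= in_itv/= => /andP[h1 h2].
  have h3 : i%:R * P <= t + j%:R * P by lra.
  have h4 : t + j%:R * P < i%:R * P + tau by lra.
  have aux (a c t' P' s : R) : 0 <= t' -> t' < P' -> s <= P' -> a <= t' + c -> t' + c < a + s ->
      ~ (a + P' <= c) /\ ~ (c + P' <= a) by lra.
  have [n1 norm2] := aux _ _ _ _ _ t0 tP tauP h3 h4.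
  move: ij; rewrite neq_ltn => /orP[ij|ij].
    by apply: n1; rewrite -[X in _ + X]mul1r -mulrDl natr1 ler_pM2r// ler_nat.
  by apply: norm2; rewrite -[X in _ + X]mul1r -mulrDl natr1 ler_pM2r// ler_nat.
rewrite indicE; case: ifPn => tt.
  rewrite mem_set ?mulr1//= in_itv/=; apply/andP; split; lra.
rewrite memNset ?mulr0//= in_itv/= => /andP[_ h]; move/negP: tt; apply; lra.
Qed.

Lemma fiber_coef_test_fun t (j : 'I_J) : 0 <= t -> t < P ->
  fiber_coef be test_fun K t j = (if t < tau then d j else 0) *
   ((1 - r%:C * e2pi (- (t - K%:R * P + j%:R * P) * p)) * e2pi (- (b / 2 * (t - K%:R * P + j%:R * P)))).
Proof.
move=> t0 tP; rewrite /fiber_coef /test_fun test_step_fiber//.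
by rewrite !mulNr [p * _]mulrC.
Qed.

Lemma eq_freq_poly (d1 d2 : nat -> C) s x : (forall j : 'I_J, d1 j = d2 j) ->
  freq_poly be J d1 s x = freq_poly be J d2 s x.
Proof. by move=> h; apply: eq_bigr => j _; rewrite h. Qed.

(** After the cancellations built into [test_fun], only the base point differs from the case t = 0,
    hence a mere phase. *)
Lemma freq_poly_test_fun t x : 0 <= t -> t < tau ->
  freq_poly be J (resolvent w al be (twist b be J (fiber_coef be test_fun K t) (t - K%:R / be)) (t - K%:R / be)) (t - K%:R / be) x =
  e2pi (- t * x) * freq_poly be J d (- (K%:R * P)) x.
Proof.
move=> t0 tt; rewrite -freq_poly_phase; apply: eq_freq_poly => j.
have tP : t < P by exact: lt_le_trans tauP.
rewrite /resolvent /twist fiber_coef_test_fun// tt -/P -/p -/r.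
set u := t - _ + _.
have De : e2pi (- (b / 2 * u)) * e2pi (b / 2 * u) = 1 by rewrite mulrC e2piNK.
have D0 : 1 - r%:C * e2pi (- u * p) != 0 by exact: resolvent_den_neq0.
move: De D0; move: (e2pi (- (b / 2 * u))) (e2pi (b / 2 * u)) (1 - _) => e1 e2 D De D0.
rewrite (_ : d j * (D * e1) * e2 / D = d j * (e1 * e2) * (D / D)); last by ring.
by rewrite De mulr1 mulfV// mulr1.
Qed.

Lemma norm_test_fun : L2 test_fun /\
  ((tau * ((1 - r) ^+ 2 * \sum_(j < J) cabs2 (d j)))%:E <= L2norm2 test_fun)%E.
Proof.
have bt := bmeas_test_fun.
have E := L2norm2_fiber be0 bt test_fun_supp.
have bS : bmeasR (fun t => \sum_(j < J) cabs2 (fiber_coef be test_fun K t j)).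
  by apply: bmeasR_sum => j; apply: bmeas_cabs2; exact: bmeas_fiber_coef.
have S0 t : 0 <= \sum_(j < J) cabs2 (fiber_coef be test_fun K t j).
  by apply: sumr_ge0 => j _; exact: cabs2_ge0.
have mS : measurable_fun setT (fun t => (\sum_(j < J) cabs2 (fiber_coef be test_fun K t j))%:E).
  by apply/measurable_EFinP; case: bS.
split.
  split; first by case: bt.
  rewrite E.
  have := @bmeasR_integrable _ `[0, be^-1[%classic _ (measurable_itv _) (lebesgue_itv_fin _ _) bS.
  move=> /integrableP[_]; apply: le_lt_trans; apply: ge0_le_integral => //.
  - by move=> t _; rewrite lee_fin.
  - exact: measurable_funTS.
  - by apply: measurableT_comp => //; exact: measurable_funTS.
  - by move=> t _ /=; rewrite lee_fin ler_norm.
rewrite E (@ge0_integral_itv_cat _ 0 tau be^-1)//; last exact: ltW.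
rewrite -[leLHS]adde0; apply: leeD; last by apply: integral_ge0 => t _; rewrite lee_fin.
have mt : mu `[0, tau[%classic = tau%:E by rewrite lebesgue_measure_itv/= lte_fin tau0 oppr0 adde0.
rewrite mulrC EFinM -mt -integral_cst//; apply: ge0_le_integral => //.
- by move=> t _; rewrite lee_fin mulr_ge0 ?sqr_ge0// sumr_ge0// => j _; exact: cabs2_ge0.
- exact: measurable_funTS.
move=> t /=; rewrite in_itv/= => /andP[t0 tt]; rewrite lee_fin mulr_sumr.
apply: ler_sum => j _; rewrite fiber_coef_test_fun ?tt//; last exact: lt_le_trans tauP.
rewrite !cabs2M cabs2_e2pi mulr1 mulrC ler_wpM2l ?cabs2_ge0//.
by have /andP[] := resolvent_den_bounds w0 al0 (- (t - K%:R * P + j%:R * P) * p).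
Qed.

Let K1 : R := kappa b w ^+ 2 * al^-1.
Let K1_gt0 : 0 < K1.
Proof. by rewrite mulr_gt0 ?invr_gt0// exprn_gt0// kappa_gt0. Qed.

Lemma coefs_test_fun (eps : R) :
  (forall t, 0 <= t -> t < tau ->
     nrm p (periodization b w al be J (twist b be J (fiber_coef be test_fun K t) (t - K%:R / be)) (t - K%:R / be)) <= eps) ->
  (\esum_(mn in [set: int * int])
     (cabs2 (inner test_fun (tfshift (al * mn.2%:~R) (be * mn.1%:~R) g)))%:E <=
   (P * (tau * (K1 * eps)))%:E)%E.
Proof.
move=> Heps; have bt := bmeas_test_fun.
rewrite (frame_coefs_fiber b0 w0 al0 be0 bt test_fun_supp) -/P EFinM lee_pmul2l ?lte_fin//.
rewrite (@ge0_integral_itv_cat _ 0 tau P)//; first last.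
- by move=> t; rewrite lee_fin mulr_ge0 ?nrm_ge0// ltW.
- exact: measurable_fiber.
- exact: ltW.
rewrite [X in (_ + X)%E]integral0_eq ?adde0; last first.
  (* Beyond [tau] all coefficients of the fiber vanish, so [nrm_periodization_upper] forces its norm
     to be 0. *)
  move=> t /=; rewrite in_itv/= => /andP[t1 t2]; congr (_%:E); apply/eqP.
  rewrite mulf_eq0; apply/orP; right; rewrite eq_le nrm_ge0 andbT.
  apply: le_trans (nrm_periodization_upper _ w0 al0 be0 _ _ _) _.
  rewrite big1 ?mulr0// => j _; rewrite cabs2_twist fiber_coef_test_fun ?(le_trans (ltW tau0))//.
  by rewrite ltNge t1 mul0r cabs20.
have mt : mu `[0, tau[%classic = tau%:E by rewrite lebesgue_measure_itv/= lte_fin tau0 oppr0 adde0.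
rewrite [X in (_ <= X%:E)%E]mulrC [X in (_ <= X)%E]EFinM -mt -integral_cst//; apply: ge0_le_integral => //.
- by move=> t _; rewrite lee_fin mulr_ge0 ?nrm_ge0// ltW.
- by apply: measurable_funTS; exact: measurable_fiber.
move=> t /=; rewrite in_itv/= => /andP[t0 tt]; rewrite lee_fin ler_wpM2l ?(ltW K1_gt0)//.
exact: Heps.
Qed.
End TestFunction.

(** * Contradiction with the lower frame bound *)

Section FrameNecessary.
Context {R : realType}.
Local Notation C := R[i].
Local Notation mu := (@lebesgue_measure R).
Variables b w : R.
Hypotheses (b0 : 0 < b) (w0 : w < 0).
Variables al be : R.
Hypotheses (al0 : 0 < al) (be0 : 0 < be).
Let P : R := be^-1.
Let P0 : 0 < P. Proof. by rewrite invr_gt0. Qed.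
Let p : R := al^-1.
Let p0 : 0 < p. Proof. by rewrite invr_gt0. Qed.
Let r : R := decay w al.
Let r0 : 0 < r. Proof. exact: expR_gt0. Qed.
Let r1 : r < 1.
Proof.
by rewrite /r /decay -expR0 ltr_expR pmulr_llt0// pmulr_rlt0// mulr_gt0// pi_gt0.
Qed.
Local Notation M := (num_steps b al).
Local Notation g := (gsinc b w).
Let q : R := Num.min p b.

Lemma seq_int_bound (X : seq int) : exists K : nat, forall n, n \in X -> (`|n| < K)%N.
Proof.
elim: X => [|n X [K HK]]; first by exists 0%N.
exists (maxn `|n|.+1 K) => m; rewrite inE leq_max => /orP[/eqP->|/HK mK]; first by rewrite ltnSn.
by rewrite mK orbT.
Qed.

Lemma phase_small (eta Y : R) : 0 < eta -> 0 <= Y ->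
  exists2 tau, 0 < tau & forall t y, 0 <= t -> t < tau -> 0 <= y -> y <= Y ->
    cabs2 (1 - e2pi (- t * y)) <= eta.
Proof.
move=> eta0 Y0; have pi0 := pi_gt0 R.
have e2 : 0 < eta / 2 by rewrite divr_gt0.
have : cos x @[x --> (0 : R)] --> cos 0 by exact: continuous_cos.
move=> /cvgrPdist_le /(_ _ e2) [dl /= dl0 Hd].
have k0 : 0 < 2 * pi * (Y + 1) by rewrite mulr_gt0 ?mulr_gt0// ltr_wpDl.
exists (dl / (2 * pi * (Y + 1))); first by rewrite divr_gt0.
move=> t y t0; rewrite ltr_pdivlMr// => tt y0 yY; rewrite cabs2_1Be2pi.
have -> : 2 * pi * (- t * y) = - (2 * pi * (t * y)) by ring.
rewrite cosN.
have : `|0 - 2 * pi * (t * y)| < dl.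
  rewrite sub0r normrN ger0_norm; last by rewrite mulr_ge0 ?mulr_ge0// ltW.
  apply: le_lt_trans tt.
  rewrite (_ : 2 * pi * (t * y) = t * (2 * pi * y)); last by ring.
  apply: ler_wpM2l => //; apply: ler_wpM2l; first by rewrite mulr_ge0// ltW.
  by rewrite (le_trans yY)// lerDl.
move=> /Hd; rewrite cos0 ler_norml => /andP[_]; lra.
Qed.

(** The order of choices matters: the iterate i, then the polynomial [T] and with it its bound [U],
    and only then [tau], which depends on [U]. Shrinking [tau] is harmless because both sides of the
    frame inequality scale with it. *)
Lemma frame_necessary : gabor_frame g al be -> be <= q.
Proof.
move=> [A [B [A0 [_ HF]]]]; rewrite leNgt; apply/negP => q_lt_be.
pose K1 : R := kappa b w ^+ 2 * al^-1.
have K10 : 0 < K1 by rewrite mulr_gt0 ?invr_gt0// exprn_gt0// kappa_gt0.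
have r2 : 0 < (1 - r) ^+ 2 by rewrite exprn_gt0// subr_gt0.
have bq : 0 < be - q by rewrite subr_gt0.
(* Chosen so that the upper estimate P tau K1 eps is half of the lower estimate A tau (1 - r)^2 (be
   - q) / (4 be). *)
pose eps : R := A * (1 - r) ^+ 2 * (be - q) / (8 * be * P * K1).
have den0 : 0 < 8 * be * P * K1.
  by apply: mulr_gt0 => //; apply: mulr_gt0 => //; exact: mulr_gt0.
have eps0 : 0 < eps by exact: (divr_gt0 (mulr_gt0 (mulr_gt0 A0 r2) bq) den0).
have eps3 : 0 < eps / 3 by rewrite divr_gt0.
have [i Hi] : exists i, be * (4 * (r ^+ i.+1) ^+ 2) <= eps / 3.
  have r1' : `|r| < 1 by rewrite ger0_norm ?(ltW r0).
  have : 4 * be * r ^+ n @[n --> \oo] --> 4 * be * 0.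
    by apply: cvgMl_tmp; exact: cvg_expr.
  rewrite mulr0 => /cvgrPdist_le /(_ _ eps3) [i _ /(_ i (leqnn i))].
  rewrite sub0r normrN => Hi; exists i.
  apply: le_trans (le_trans (ler_norm _) Hi).
  rewrite (_ : 4 * be * r ^+ i = be * (4 * r ^+ i)); last by ring.
  apply: ler_wpM2l; first exact: ltW.
  apply: ler_wpM2l => //.
  by rewrite -exprM ler_wiXn2l ?(ltW r0) ?(ltW r1)// muln2 -addnn addSn leqW// leq_addr.
(* The first term makes the approximation error at most eps / 3; the second keeps the squared norm
   of [T] at least (be - q) / 4, since be - q <= 2 e2 + 2 nrm T. *)
pose e2 : R := Num.min (eps / (24 * M.+2%:R)) ((be - q) / 4).
have M20 : 0 < 24 * M.+2%:R :> R by rewrite mulr_gt0.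
have e20 : 0 < e2 by rewrite lt_min (divr_gt0 eps0 M20) (divr_gt0 bq).
have [T0 [[X [c [uX TX]]] HT]] := trig_poly_dense be0 (bmeas_almost_inv b w0 al0 be0 i) e20.
have [K HK] := seq_int_bound X.
pose J := (K + K)%N.
pose d (j : nat) : C := if (K%:Z - j%:Z) \in X then c (K%:Z - j%:Z) else 0.
pose T := freq_poly be J d (- (K%:R * P)).
have ET x : T0 x = T x by rewrite TX (trig_poly_freq_poly _ _ _ uX HK).
have {}HT : nrm be (fun x => (almost_inv b w al be i x)%:C - T x) <= e2.
  by apply: le_trans HT; rewrite le_eqVlt; apply/orP; left; apply/eqP; apply: eq_Rintegral => x _; rewrite ET.
have bT : bmeas T by exact: bmeas_freq_poly.
have Tp x : T (x + be) = T x.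
  rewrite /T freq_poly_quasiperiodic// opprK -mulrA mulVf ?gt_eqF// mulr1.
  by rewrite e2pi_nat mul1r.
have [_ [U HU]] := bT.
have U0 : 0 <= U by apply: le_trans (HU 0); exact: cabs2_ge0.
(* Makes the phase error 2 be eta U at most eps / 3; the 1 avoids dividing by U = 0. *)
pose eta : R := eps / (6 * be * (U + 1)).
have d60 : 0 < 6 * be * (U + 1) by rewrite mulr_gt0 ?mulr_gt0// ltr_wpDl.
have eta0 : 0 < eta by rewrite divr_gt0.
have [tau1 tau10 Htau] := phase_small eta0 (mulr_ge0 (ler0n R M) (ltW p0)).
pose tau := Num.min tau1 P.
have tau0 : 0 < tau by rewrite lt_min tau10.
have tauP : tau <= P by rewrite ge_min lexx orbT.
have Hnrm t : 0 <= t -> t < tau ->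
     nrm p (periodization b w al be J (twist b be J (fiber_coef be (test_fun b w al be d K tau) K t) (t - K%:R / be)) (t - K%:R / be)) <= eps.
  move=> t0 tt.
  apply: (le_trans (nrm_periodization_small b0 w0 al0 be0 q_lt_be i (T := T) (t := t) (eta := eta) (U := U) _ bT Tp HU _)).
  - by move=> x; exact: freq_poly_test_fun.
  - move=> N NM; apply: Htau => //; first by rewrite (lt_le_trans tt)// ge_min lexx.
      by rewrite mulr_ge0// ltW.
    by rewrite ler_pM2r// ler_nat.
  have h1 : be * (2 * (eta * U)) <= eps / 3.
    rewrite /eta (_ : be * (2 * (eps / (6 * be * (U + 1)) * U)) = eps / 3 * (U / (U + 1))); last first.
      by field; rewrite !gt_eqF// ltr_wpDl.
    rewrite -[leRHS]mulr1; apply: ler_wpM2l; first exact: ltW.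
    by rewrite ler_pdivrMr ?mul1r ?lerDl// ltr_wpDl.
  have h2 : 8 * M.+2%:R * nrm be (fun x => (almost_inv b w al be i x)%:C - T x) <= eps / 3.
    apply: (@le_trans _ _ (8 * M.+2%:R * (eps / (24 * M.+2%:R)))).
      by apply: ler_wpM2l => //; apply: (le_trans HT); rewrite ge_min lexx.
    by rewrite le_eqVlt; apply/orP; left; apply/eqP; field.
  by rewrite mulrDr; move: Hi h1 h2; lra.
pose D : R := \sum_(j < J) cabs2 (d j).
have HD : (be - q) / 4 <= be * D.
  rewrite -(freq_poly_nrm be0 J d (- (K%:R * P)) 0).
  have -> : (\int[mu]_(x in `[0%R, be[) cabs2 (freq_poly be J d (- (K%:R * P)) (x + 0)))%R = nrm be T.
    by apply: eq_Rintegral => x _; rewrite addr0.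
  have h1 := nrm_almost_inv b0 w0 al0 be0 q_lt_be i.
  have bd : bmeas (fun x => (almost_inv b w al be i x)%:C - T x).
    by apply: bmeasB => //; exact: bmeas_almost_inv.
  have := nrmD_le be bd bT.
  rewrite (_ : (fun x => _ + _) = (fun x => (almost_inv b w al be i x)%:C)); last first.
    by apply/funext => x; rewrite subrK.
  have : e2 <= (be - q) / 4 by rewrite ge_min lexx orbT.
  by move: HT h1; rewrite -/q; lra.
have [LF LB] := norm_test_fun b w0 al0 be0 d K tau0 tauP.
have := coefs_test_fun b0 w0 al0 be0 tau0 tauP Hnrm.
have /andP[HA _] := HF _ LF.
move=> /(le_trans HA).
have A0' : (0 < A%:E)%E by rewrite lte_fin.
have := LB; rewrite -(lee_pmul2l _ A0')// => /le_trans /[apply].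
rewrite -EFinM lee_fin -/K1 -/D -/r => main.
have : A * (tau * ((1 - r) ^+ 2 * ((be - q) / 4 / be))) <= P * (tau * (K1 * eps)).
  apply: le_trans main; apply: ler_wpM2l; first exact: ltW.
  apply: ler_wpM2l; first exact: ltW.
  apply: ler_wpM2l; first exact: ltW.
  by rewrite ler_pdivrMr// [D * be]mulrC.
rewrite (_ : P * (tau * (K1 * eps)) = A * (tau * ((1 - r) ^+ 2 * ((be - q) / 4 / be))) / 2); last first.
  by rewrite /eps /P; field; rewrite !gt_eqF.
have : 0 < A * (tau * ((1 - r) ^+ 2 * ((be - q) / 4 / be))).
  apply: (mulr_gt0 A0 (mulr_gt0 tau0 (mulr_gt0 r2 _))).
  by apply: (divr_gt0 _ be0); apply: divr_gt0.
lra.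
Qed.
End FrameNecessary.

Theorem theorem2 (R : realType) (b w : R) (hb : 0 < b) (hw : w < 0) :
  frame_set (gsinc b w) =
  [set ab : R * R | 0 < ab.1 /\ 0 < ab.2 /\ ab.1 * ab.2 <= 1 /\ ab.2 <= b].
Proof.
apply/seteqP; split => -[al be] /= [al0 [be0]].
  move=> /(frame_necessary hb hw al0 be0); rewrite le_min => /andP[h1 h2].
  split => //; split => //; split => //.
  by rewrite mulrC -ler_pdivlMr// mul1r.
by move=> [h1 h2]; split => //; split => //; exact: frame_sufficient.
Qed.
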